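(* Let $\mathcal{PF}$ be the category of the preordering Frobenius monad freely generated by a single object, let $\mathcal{PF}_{\mathrm H}$ be the syntactically defined category described in the context, and let $\mathit{SplPre}$ be the category of split preorders between finite ordinals. The categories $\mathcal{PF}$, $\mathcal{PF}_{\mathrm H}$ and $\mathit{SplPre}$ are isomorphic.
   Context: Notation: $\circ$ is composition of arrows; $\mathbf 1$ denotes identity arrows; for a natural transformation $\theta$ and functors $F,M$, $\theta_F$ has components $\theta_{Fa}$ and $M\theta$ has components $M(\theta_a)$. Finite ordinals are $n=\{0,\dots,n-1\}$. **SplPre.** A preorder is a reflexive and transitive binary relation. For a finite ordinal $n$ and a number $i$ write $n_i=n\times\{i\}$. A split preorder from $n$ to $m$ is a preorder on the set $n_1\cup m_2$ (the disjoint union of source $n$ and target $m$). $\mathit{SplPre}$ has the finite ordinals as objects and the split preorders from $n$ to $m$ as arrows $n\to m$. The identity on $n$ is $\{((a,i),(a,j)) : a\in n,\ i,j\in\{1,2\}\}$. The composition $Q\circ P$ of $P$ from $n$ to $m$ and $Q$ from $m$ to $k$ is obtained by relabelling the target copy of $m$ in $P$ and the source copy of $m$ in $Q$ both as $m_3$, taking the transitive closure of the union of the two relations, and deleting all pairs in which an element of $m_3$ occurs. **Preordering Frobenius monad.** This is a category $\mathcal A$ with an endofunctor $M$ and natural transformations $\nabla:MM\to M$, $\Delta:M\to MM$, $u:I\to M$, $\varepsilon:M\to I$, $\tau:MM\to MM$, $\downarrow:M\to M$ ($I$ the identity functor) satisfying the following. Monad: $\nabla\circ\nabla_M=\nabla\circ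 M\nabla$, $\nabla\circ u_M=\mathbf 1_M=\nabla\circ Mu$. Comonad: $\Delta_M\circ\Delta=M\Delta\circ\Delta$, $\varepsilon_M\circ\Delta=\mathbf 1_M=M\varepsilon\circ\Delta$. Frobenius: $M\nabla\circ\Delta_M=\Delta\circ\nabla=\nabla_M\circ M\Delta$. Symmetry: $\tau\circ\tau=\mathbf 1_{MM}$, $M\tau\circ\tau_M\circ M\tau=\tau_M\circ M\tau\circ\tau_M$, $\nabla\circ\tau=\nabla$, $\tau\circ\Delta=\Delta$, $\tau\circ\nabla_M=M\nabla\circ\tau_M\circ M\tau$, $\Delta_M\circ\tau=M\tau\circ\tau_M\circ M\Delta$, $\tau\circ u_M=Mu$, $\varepsilon_M\circ\tau=M\varepsilon$. Separability: $\nabla\circ\Delta=\mathbf 1_M$. Unit-counit homomorphism: $\varepsilon\circ u=\mathbf 1_I$. Equations for $\downarrow$: $\downarrow\circ\downarrow=\downarrow$ and $\tau\circ\downarrow_M=M{\downarrow}\circ\tau$. Up-and-down: $\nabla\circ M{\downarrow}\circ\uparrow_M\circ\Delta=\mathbf 1_M$, where $\uparrow\;=M\varepsilon\circ M\nabla\circ M{\downarrow}_M\circ\Delta_M\circ u_M$. With $\nabla^\downarrow=\nabla\circ M{\downarrow}\circ\downarrow_M$ and $\Delta^\downarrow=M{\downarrow}\circ\downarrow_M\circ\Delta$: $\varepsilon\circ\nabla^\downarrow=\varepsilon\circ M\varepsilon$, $\Delta^\downarrow\circ u=Mu\circ u$, $\Delta^\downarrow\circ\nabla^\downarrow=M\nabla^\downarrow\circ\nabla^\downarrow_{MM}\circ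 M\tau_M\circ MM\Delta^\downarrow\circ\Delta^\downarrow_M$, and $\nabla^\downarrow\circ\Delta^\downarrow=\downarrow$. **PF.** $\mathcal{PF}$ is the free preordering Frobenius monad on one object $0$: its objects are $M^n0$, identified with $n\ge 0$; its arrow terms are built from the components at all objects $n$ of the natural transformations $\nabla,\Delta,u,\varepsilon,\tau,\downarrow$ and from identities, by composition and by applying $M$; its arrows are the equivalence classes of arrow terms under the least congruence (for composition and $M$) validating the category axioms, functoriality of $M$, naturality of $\nabla,\Delta,u,\varepsilon,\tau,\downarrow$, and, at all objects, all the equations required in the definition of a preordering Frobenius monad (the monad, comonad, Frobenius, symmetry, separability, unit-counit homomorphism and up-and-down equations, the equations for $\downarrow$, and the four equations for $\nabla^\downarrow$ and $\Delta^\downarrow$). **$\mathcal{PF}_{\mathrm H}$.** Objects: finite ordinals. Primitive arrow terms, for all $n,m\ge0$: ${}_n\mathbf 1_m:n+m\to n+m$; ${}_nu_m:n+m\to n+1+m$; ${}_n\varepsilon_m:n+1+m\to n+m$; ${}_n\tau_m:n+2+m\to n+2+m$; ${}_n\mathrm H_m:n+2+m\to n+2+m$. Arrow terms are closed under composition of terms of matching type (parentheses are not written, so composition is associative). Set ${}_n({}_k\theta_l)_m={}_{n+k}\theta_{l+m}$ for primitive $\theta$, and ${}_n(g\circ f)_m={}_ng_m\circ{}_nf_m$; a subscript $0$ is omitted. Arrows are equivalence classes of arrow terms under the least equivalence relation (between terms of the same type) closed under the rules ''if $f=g$ then ${}_nf_m={}_ng_m$'' and ''if $f=g$ and $f'=g'$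 then $f'\circ f=g'\circ g$'' and containing: - $f\circ\mathbf 1_n=f=\mathbf 1_m\circ f$ for $f:n\to m$; ${}_1\mathbf 1=\mathbf 1_1$; - ${}_{q+r}\theta\circ\xi_{r+k}=\xi_{r+l}\circ{}_{p+r}\theta$ for $\xi:p\to q$, $\theta:k\to l$ in $\{u,\varepsilon,\tau,\mathrm H\}$, $r\ge0$; - $\tau\circ\tau=\mathbf 1_2$; ${}_1\tau\circ\tau_1\circ{}_1\tau=\tau_1\circ{}_1\tau\circ\tau_1$; $\tau\circ u_1={}_1u$; $\varepsilon_1\circ\tau={}_1\varepsilon$; - $\mathrm H\circ\mathrm H=\mathrm H$; ${}_1\tau\circ\mathrm H_1\circ{}_1\tau=\tau_1\circ{}_1\mathrm H\circ\tau_1$; - $\tau\circ\mathrm H\circ\tau\circ\mathrm H=\mathrm H\circ\tau\circ\mathrm H=\mathrm H\circ\tau\circ\mathrm H\circ\tau$; - $\varepsilon_1\circ\mathrm H\circ\tau\circ\mathrm H\circ u_1=\mathbf 1_1$ (or, alternatively, ${}_1\varepsilon\circ\mathrm H\circ\tau\circ\mathrm H\circ{}_1u=\mathbf 1_1$); - ${}_1\mathrm H\circ\mathrm H_1=\mathrm H_1\circ{}_1\mathrm H$; - $\tau_1\circ{}_1\mathrm H\circ\tau_1\circ{}_1\mathrm H={}_1\mathrm H\circ\tau_1\circ{}_1\mathrm H\circ\tau_1$; - ${}_1\tau\circ\mathrm H_1\circ{}_1\tau\circ\mathrm H_1=\mathrm H_1\circ{}_1\tau\circ\mathrm H_1\circ{}_1\tau$;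 - $\varepsilon\circ u=\mathbf 1$ (identity of $0$); - ${}_2\varepsilon\circ{}_1\mathrm H\circ\tau_1\circ{}_1\mathrm H\circ{}_2u=\tau$; $\varepsilon_2\circ\mathrm H_1\circ{}_1\tau\circ\mathrm H_1\circ u_2=\tau$; - ${}_2\varepsilon_2\circ{}_2\mathrm H_1\circ{}_1\mathrm H_2\circ{}_3\tau\circ\tau_3\circ{}_2\mathrm H_1\circ{}_1\mathrm H_2\circ{}_2u_2={}_1\mathrm H_1\circ{}_2\tau\circ{}_1\mathrm H_1\circ{}_2\tau\circ\tau_2\circ{}_1\mathrm H_1\circ{}_2\tau\circ{}_1\mathrm H_1$. *)

(* Defs.v *)
From HB Require Import structures.
From mathcomp Require Import all_boot.
From mathcomp Require Import boolp.

Set Implicit Arguments.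
Unset Strict Implicit.
Unset Printing Implicit Defensive.

Local Open Scope quotient_scope.

Record category := Category {
  obj : Type;
  hom : obj -> obj -> Type;
  idm : forall a, hom a a;
  comp : forall a b c, hom b c -> hom a b -> hom a c;
  comp_idl : forall a b (f : hom a b), comp (idm b) f = f;
  comp_idr : forall a b (f : hom a b), comp f (idm a) = f;
  comp_assoc : forall a b c d (h : hom c d) (g : hom b c) (f : hom a b),
    comp h (comp g f) = comp (comp h g) f }.

Arguments hom {c0} a b.
Arguments idm {c0} a.
Arguments comp {c0 a b c} g f : rename.

Record functor (C D : category) := Functor {
  fobj : obj C -> obj D;
  fhom : forall a b : obj C, hom a b -> hom (fobj a) (fobj b);
  fhom_id : forall a, fhom (idm a) = idm (fobj a);
  fhom_comp : forall (a b c : obj C) (g : hom b c) (f : hom a b),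
    fhom (comp g f) = comp (fhom g) (fhom f) }.

Definition functor_id (C : category) : functor C C :=
  @Functor C C id (fun _ _ f => f) (fun _ => erefl) (fun _ _ _ _ _ => erefl).

Program Definition functor_comp (C D E : category)
    (G : functor D E) (F : functor C D) : functor C E :=
  @Functor C E (fun a => fobj G (fobj F a))
    (fun a b f => fhom G (fhom F f)) _ _.
Next Obligation. by move=> *; rewrite !fhom_id. Qed.
Next Obligation. by move=> *; rewrite !fhom_comp. Qed.

Definition isomorphic (C D : category) : Prop :=
  exists (F : functor C D) (G : functor D C),
    functor_comp G F = functor_id C /\ functor_comp F G = functor_id D.

Definition is_preorder (T : finType) (R : {set T * T}) : bool :=
  [forall x, (x, x) \in R] &&
  [forall x, forall y, forall z,
     ((x, y) \in R) ==> ((y, z) \in R) ==> ((x, z) \in R)].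

(* [inl] tags the source n_1, [inr] the target m_2. *)
Definition split_preorder (n m : nat) : Type :=
  {R : {set ('I_n + 'I_m) * ('I_n + 'I_m)} | is_preorder R}.

Definition untag (n : nat) (x : 'I_n + 'I_n) : 'I_n :=
  match x with inl a => a | inr a => a end.

Definition spl_id_rel (n : nat) : {set ('I_n + 'I_n) * ('I_n + 'I_n)} :=
  [set p | untag p.1 == untag p.2].

(* The relations are glued on (n_1 + k_2) + m_3. *)
Definition glue1 (n m k : nat) (x : 'I_n + 'I_m) : ('I_n + 'I_k) + 'I_m :=
  match x with inl a => inl (inl a) | inr b => inr b end.

Definition glue2 (n m k : nat) (x : 'I_m + 'I_k) : ('I_n + 'I_k) + 'I_m :=
  match x with inl b => inr b | inr c => inl (inr c) end.

Definition glue (n m k : nat) (Q : {set ('I_m + 'I_k) * ('I_m + 'I_k)})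
    (P : {set ('I_n + 'I_m) * ('I_n + 'I_m)}) :
    {set (('I_n + 'I_k) + 'I_m) * (('I_n + 'I_k) + 'I_m)} :=
  [set (glue1 k p.1, glue1 k p.2) | p in P] :|:
  [set (glue2 n q.1, glue2 n q.2) | q in Q].

(* [connect] is the reflexive transitive closure; as P and Q are reflexive, so
   is their glued union, and this is its transitive closure. *)
Definition spl_comp_rel (n m k : nat) (Q : {set ('I_m + 'I_k) * ('I_m + 'I_k)})
    (P : {set ('I_n + 'I_m) * ('I_n + 'I_m)}) :
    {set ('I_n + 'I_k) * ('I_n + 'I_k)} :=
  [set p | connect (fun x y => (x, y) \in glue Q P) (inl p.1) (inl p.2)].

Lemma is_preorderP (T : finType) (R : {set T * T}) :
  reflect ((forall x, (x, x) \in R) /\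
           (forall x y z, (x, y) \in R -> (y, z) \in R -> (x, z) \in R))
          (is_preorder R).
Proof.
apply: (iffP andP) => -[Rxx Rt]; split.
- by move=> x; apply: (forallP Rxx).
- move=> x y z xy yz.
  by move/forallP: Rt => /(_ x)/forallP/(_ y)/forallP/(_ z); rewrite xy yz.
- exact/forallP.
- apply/forallP => x; apply/forallP => y; apply/forallP => z.
  by apply/implyP => xy; apply/implyP; apply: Rt.
Qed.

Lemma spl_id_preorder n : is_preorder (spl_id_rel n).
Proof.
apply/is_preorderP; split=> [x|x y z]; rewrite !inE //=.
by move=> /eqP-> /eqP->.
Qed.

Lemma spl_comp_preorder n m k (Q : {set ('I_m + 'I_k) * ('I_m + 'I_k)})
  (P : {set ('I_n + 'I_m) * ('I_n + 'I_m)}) : is_preorder (spl_comp_rel Q P).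
Proof.
apply/is_preorderP; split=> [x|x y z]; rewrite !inE /= ?connect0 //.
exact: connect_trans.
Qed.

Definition spl_id (n : nat) : split_preorder n n :=
  exist _ (spl_id_rel n) (spl_id_preorder n).

Definition spl_comp (n m k : nat) (Q : split_preorder m k)
    (P : split_preorder n m) : split_preorder n k :=
  exist _ (spl_comp_rel (val Q) (val P)) (spl_comp_preorder _ _).

(* A preorder is determined by its up-closed sets, and split preorders compose
   on up-closed sets as relations do. *)
Definition msum (n m : nat) (S : {set 'I_n}) (T : {set 'I_m}) (x : 'I_n + 'I_m) :=
  match x with inl a => a \in S | inr b => b \in T end.

Definition upset (n m : nat) (P : split_preorder n m)
    (S : {set 'I_n}) (T : {set 'I_m}) : Prop :=
  forall x y, (x, y) \in val P -> msum S T x -> msum S T y.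

Lemma upset_inj n m (P Q : split_preorder n m) :
  (forall S T, upset P S T <-> upset Q S T) -> P = Q.
Proof.
have main (A B : split_preorder n m) :
    (forall S T, upset B S T -> upset A S T) -> val A \subset val B.
  move=> AB; have /is_preorderP[Bxx Bt] := valP B.
  apply/subsetP => -[x y] Axy.
  pose S := [set a | (x, inl a) \in val B].
  pose T := [set b | (x, inr b) \in val B].
  have ST z : msum S T z = ((x, z) \in val B) by case: z => a /=; rewrite inE.
  suff /AB AST : upset B S T by have := AST _ _ Axy; rewrite !ST; apply.
  by move=> u v uv; rewrite !ST => /Bt; apply.
move=> PQ; apply/val_inj/eqP; rewrite eqEsubset !main // => S T; apply PQ.
Qed.

Lemma upset_id n (S T : {set 'I_n}) : upset (spl_id n) S T <-> S = T.
Proof.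
split=> [ST|-> [a|a] [b|b]]; last by rewrite inE /= => /eqP->.
  apply/setP => a; apply/idP/idP => Ha.
    by apply: (ST (inl a) (inr a)); rewrite ?inE.
  by apply: (ST (inr a) (inl a)); rewrite ?inE.
all: by rewrite inE /= => /eqP->.
Qed.

Lemma upset_comp n m k (Q : split_preorder m k) (P : split_preorder n m) S U :
  upset (spl_comp Q P) S U <-> exists T, upset P S T /\ upset Q T U.
Proof.
pose e := fun x y => (x, y) \in glue (val Q) (val P).
have eP x y : (x, y) \in val P -> e (glue1 k x) (glue1 k y).
  by move=> xy; rewrite /e inE; apply/orP; left; apply/imsetP; exists (x, y).
have eQ x y : (x, y) \in val Q -> e (glue2 n x) (glue2 n y).
  by move=> xy; rewrite /e inE; apply/orP; right; apply/imsetP; exists (x, y).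
split=> [SU|[T [PST QTU]] x y].
  pose T := [set b : 'I_m | [exists x, msum S U x && connect e (inl x) (inr b)]].
  pose W z := exists x, msum S U x && connect e (inl x) z.
  have W1 x : msum S T x <-> W (glue1 k x).
    case: x => [a|b] /=; last by rewrite inE; split=> [/existsP|/existsP].
    split=> [aS|[x /andP[xS]]]; first by exists (inl a); rewrite /= aS connect0.
    move=> c; have := SU x (inl a); apply=> //; by rewrite inE.
  have W2 x : msum T U x <-> W (glue2 n x).
    case: x => [b|a] /=; first by rewrite inE; split=> [/existsP|/existsP].
    split=> [aS|[x /andP[xS]]]; first by exists (inr a); rewrite /= aS connect0.
    move=> c; have := SU x (inr a); apply=> //; by rewrite inE.
  have We y z : e y z -> W y -> W z.
    move=> yz [x /andP[xS c]]; exists x; rewrite xS /=.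
    exact: connect_trans c (connect1 yz).
  exists T; split=> x y xy.
    by move=> /W1 Wx; apply/W1; apply: We Wx; apply: eP.
  by move=> /W2 Wx; apply/W2; apply: We Wx; apply: eQ.
rewrite inE /=.
pose W (z : ('I_n + 'I_k) + 'I_m) :=
  match z with inl x => msum S U x | inr b => b \in T end.
have We y' z' : e y' z' -> W y' -> W z'.
  rewrite /e inE => /orP[] /imsetP[[u v] uv [-> ->]].
    by have := PST _ _ uv; case: u {uv} => ?; case: v.
  by have := QTU _ _ uv; case: u {uv} => ?; case: v.
move=> /connectP[p pth lst] /= xS.
rewrite -[msum S U y]/(W (inl y)) lst.
have : W (inl x) by [].
by elim: p (inl x) pth {lst xS} => //= z p IH x' /andP[xz pz] /(We _ _ xz)/IH; apply.
Qed.

Lemma spl_idl n m (P : split_preorder n m) : spl_comp (spl_id m) P = P.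
Proof.
apply: upset_inj => S T; split.
  by move=> /upset_comp[T' [PS /upset_id <-]].
by move=> PS; apply/upset_comp; exists T; split=> //; apply/upset_id.
Qed.

Lemma spl_idr n m (P : split_preorder n m) : spl_comp P (spl_id n) = P.
Proof.
apply: upset_inj => S T; split.
  by move=> /upset_comp[T' [/upset_id ->]].
by move=> PS; apply/upset_comp; exists S; split=> //; apply/upset_id.
Qed.

Lemma spl_assoc n m k l (R : split_preorder k l) (Q : split_preorder m k)
  (P : split_preorder n m) :
  spl_comp R (spl_comp Q P) = spl_comp (spl_comp R Q) P.
Proof.
apply: upset_inj => S T; split.
  move=> /upset_comp[V [/upset_comp[U [PU QV]] RT]].
  by apply/upset_comp; exists U; split=> //; apply/upset_comp; exists V.
move=> /upset_comp[U [PU /upset_comp[V [QV RT]]]].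
by apply/upset_comp; exists V; split=> //; apply/upset_comp; exists U.
Qed.

Definition SplPre : category :=
  @Category nat split_preorder spl_id spl_comp spl_idl spl_idr spl_assoc.

(* The number n stands for M^n 0.  The component of a transformation theta at
   n is [theta n]; thus theta_M is [theta n.+1], and M theta is
   [pf_M (theta n)]. *)
Inductive pf_term : nat -> nat -> Type :=
| pf_id n : pf_term n n
| pf_comp n m k : pf_term m k -> pf_term n m -> pf_term n k
| pf_M n m : pf_term n m -> pf_term n.+1 m.+1
| pf_nabla n : pf_term n.+2 n.+1
| pf_Delta n : pf_term n.+1 n.+2
| pf_u n : pf_term n n.+1
| pf_eps n : pf_term n.+1 n
| pf_tau n : pf_term n.+2 n.+2
| pf_down n : pf_term n.+1 n.+1.

Section PFterms.
Local Notation "g ∘ f" := (pf_comp g f) (at level 40, left associativity).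
Local Notation "∇" := pf_nabla.
Local Notation "↓" := pf_down.
Local Notation M := pf_M.
Local Notation Δ := pf_Delta.
Local Notation u := pf_u.
Local Notation ε := pf_eps.
Local Notation τ := pf_tau.
Local Notation Id := pf_id.

Definition pf_up n : pf_term n.+1 n.+1 :=
  M (ε n) ∘ M (∇ n) ∘ M (↓ n.+1) ∘ Δ n.+1 ∘ u n.+1.

Definition pf_nabla_down n : pf_term n.+2 n.+1 := ∇ n ∘ M (↓ n) ∘ ↓ n.+1.
Definition pf_Delta_down n : pf_term n.+1 n.+2 := M (↓ n) ∘ ↓ n.+1 ∘ Δ n.

Local Notation "↑" := pf_up.
Local Notation "∇↓" := pf_nabla_down.
Local Notation "'Δ↓'" := pf_Delta_down.

Inductive pf_eq : forall n m, pf_term n m -> pf_term n m -> Prop :=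
| pf_refl n m (f : pf_term n m) : pf_eq f f
| pf_sym n m (f g : pf_term n m) : pf_eq f g -> pf_eq g f
| pf_trans n m (f g h : pf_term n m) : pf_eq f g -> pf_eq g h -> pf_eq f h
| pf_cong_comp n m k (g g' : pf_term m k) (f f' : pf_term n m) :
    pf_eq g g' -> pf_eq f f' -> pf_eq (g ∘ f) (g' ∘ f')
| pf_cong_M n m (f f' : pf_term n m) : pf_eq f f' -> pf_eq (M f) (M f')
| pf_idl n m (f : pf_term n m) : pf_eq (Id m ∘ f) f
| pf_idr n m (f : pf_term n m) : pf_eq (f ∘ Id n) f
| pf_assoc n m k l (h : pf_term k l) (g : pf_term m k) (f : pf_term n m) :
    pf_eq (h ∘ (g ∘ f)) (h ∘ g ∘ f)
| pf_M_id n : pf_eq (M (Id n)) (Id n.+1)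
| pf_M_comp n m k (g : pf_term m k) (f : pf_term n m) :
    pf_eq (M (g ∘ f)) (M g ∘ M f)
| pf_nabla_nat n m (f : pf_term n m) : pf_eq (∇ m ∘ M (M f)) (M f ∘ ∇ n)
| pf_Delta_nat n m (f : pf_term n m) : pf_eq (Δ m ∘ M f) (M (M f) ∘ Δ n)
| pf_u_nat n m (f : pf_term n m) : pf_eq (u m ∘ f) (M f ∘ u n)
| pf_eps_nat n m (f : pf_term n m) : pf_eq (ε m ∘ M f) (f ∘ ε n)
| pf_tau_nat n m (f : pf_term n m) : pf_eq (τ m ∘ M (M f)) (M (M f) ∘ τ n)
| pf_down_nat n m (f : pf_term n m) : pf_eq (↓ m ∘ M f) (M f ∘ ↓ n)
| pf_monad_assoc n : pf_eq (∇ n ∘ ∇ n.+1) (∇ n ∘ M (∇ n))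
| pf_monad_idl n : pf_eq (∇ n ∘ u n.+1) (Id n.+1)
| pf_monad_idr n : pf_eq (∇ n ∘ M (u n)) (Id n.+1)
| pf_comonad_assoc n : pf_eq (Δ n.+1 ∘ Δ n) (M (Δ n) ∘ Δ n)
| pf_comonad_idl n : pf_eq (ε n.+1 ∘ Δ n) (Id n.+1)
| pf_comonad_idr n : pf_eq (M (ε n) ∘ Δ n) (Id n.+1)
| pf_frobenius1 n : pf_eq (M (∇ n) ∘ Δ n.+1) (Δ n ∘ ∇ n)
| pf_frobenius2 n : pf_eq (Δ n ∘ ∇ n) (∇ n.+1 ∘ M (Δ n))
| pf_tau_tau n : pf_eq (τ n ∘ τ n) (Id n.+2)
| pf_yang_baxter n :
    pf_eq (M (τ n) ∘ τ n.+1 ∘ M (τ n)) (τ n.+1 ∘ M (τ n) ∘ τ n.+1)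
| pf_nabla_tau n : pf_eq (∇ n ∘ τ n) (∇ n)
| pf_tau_Delta n : pf_eq (τ n ∘ Δ n) (Δ n)
| pf_tau_nabla n :
    pf_eq (τ n ∘ ∇ n.+1) (M (∇ n) ∘ τ n.+1 ∘ M (τ n))
| pf_Delta_tau n :
    pf_eq (Δ n.+1 ∘ τ n) (M (τ n) ∘ τ n.+1 ∘ M (Δ n))
| pf_tau_u n : pf_eq (τ n ∘ u n.+1) (M (u n))
| pf_eps_tau n : pf_eq (ε n.+1 ∘ τ n) (M (ε n))
| pf_separable n : pf_eq (∇ n ∘ Δ n) (Id n.+1)
| pf_eps_u n : pf_eq (ε n ∘ u n) (Id n)
| pf_down_down n : pf_eq (↓ n ∘ ↓ n) (↓ n)
| pf_tau_down n : pf_eq (τ n ∘ ↓ n.+1) (M (↓ n) ∘ τ n)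
| pf_up_and_down n : pf_eq (∇ n ∘ M (↓ n) ∘ ↑ n.+1 ∘ Δ n) (Id n.+1)
| pf_eps_nabla_down n : pf_eq (ε n ∘ ∇↓ n) (ε n ∘ M (ε n))
| pf_Delta_down_u n : pf_eq (Δ↓ n ∘ u n) (M (u n) ∘ u n)
| pf_bialgebra_down n :
    pf_eq (Δ↓ n ∘ ∇↓ n)
          (M (∇↓ n) ∘ ∇↓ n.+2 ∘ M (τ n.+1) ∘ M (M (Δ↓ n)) ∘ Δ↓ n.+1)
| pf_separable_down n : pf_eq (∇↓ n ∘ Δ↓ n) (↓ n).

End PFterms.

HB.instance Definition _ n m := gen_eqMixin (pf_term n m).
HB.instance Definition _ n m := gen_choiceMixin (pf_term n m).

Definition pf_rel n m : rel (pf_term n m) := fun f g => `[< pf_eq f g >].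

Lemma pf_rel_refl n m : reflexive (@pf_rel n m).
Proof. by move=> f; apply/asboolP/pf_refl. Qed.

Lemma pf_rel_sym n m : symmetric (@pf_rel n m).
Proof. by move=> f g; apply/asboolP/asboolP => /pf_sym. Qed.

Lemma pf_rel_trans n m : transitive (@pf_rel n m).
Proof.
by move=> g f h /asboolP fg /asboolP gh; apply/asboolP/(pf_trans fg gh).
Qed.

Canonical pf_equiv n m := EquivRel (@pf_rel n m)
  (@pf_rel_refl n m) (@pf_rel_sym n m) (@pf_rel_trans n m).

Definition pf_hom (n m : nat) : Type := {eq_quot (pf_equiv n m)}.

Definition pf_class n m (f : pf_term n m) : pf_hom n m :=
  \pi_({eq_quot (pf_equiv n m)}) f.

Definition pf_repr n m (f : pf_hom n m) : pf_term n m :=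
  repr (f : {eq_quot (pf_equiv n m)}).

Lemma pf_reprK n m (f : pf_hom n m) : pf_class (pf_repr f) = f.
Proof. exact: reprK. Qed.

Lemma pf_classP n m (f g : pf_term n m) : pf_class f = pf_class g <-> pf_eq f g.
Proof.
split=> [/(@eqmodP _ (pf_equiv n m))/asboolP //|fg].
by apply/(@eqmodP _ (pf_equiv n m)); apply/asboolP.
Qed.

Definition pf_hom_id (n : nat) : pf_hom n n := pf_class (pf_id n).

Definition pf_hom_comp n m k (g : pf_hom m k) (f : pf_hom n m) : pf_hom n k :=
  pf_class (pf_comp (pf_repr g) (pf_repr f)).

Lemma pf_class_comp n m k (g : pf_term m k) (f : pf_term n m) :
  pf_hom_comp (pf_class g) (pf_class f) = pf_class (pf_comp g f).
Proof. by apply/pf_classP/pf_cong_comp; apply/pf_classP/pf_reprK. Qed.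

Lemma pf_hom_idl n m (f : pf_hom n m) : pf_hom_comp (pf_hom_id m) f = f.
Proof. by rewrite -[f]pf_reprK pf_class_comp; apply/pf_classP/pf_idl. Qed.

Lemma pf_hom_idr n m (f : pf_hom n m) : pf_hom_comp f (pf_hom_id n) = f.
Proof. by rewrite -[f]pf_reprK pf_class_comp; apply/pf_classP/pf_idr. Qed.

Lemma pf_hom_assoc n m k l (h : pf_hom k l) (g : pf_hom m k) (f : pf_hom n m) :
  pf_hom_comp h (pf_hom_comp g f) = pf_hom_comp (pf_hom_comp h g) f.
Proof.
rewrite -[h]pf_reprK -[g]pf_reprK -[f]pf_reprK !pf_class_comp.
exact/pf_classP/pf_assoc.
Qed.

Definition PF : category :=
  @Category nat pf_hom pf_hom_id pf_hom_comp pf_hom_idl pf_hom_idr pf_hom_assoc.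

Inductive h_gen := HOne | HU | HEps | HTau | HH.

Definition h_gen_src (x : h_gen) : nat :=
  match x with HOne => 0 | HU => 0 | HEps => 1 | HTau => 2 | HH => 2 end.

Definition h_gen_tgt (x : h_gen) : nat :=
  match x with HOne => 0 | HU => 1 | HEps => 0 | HTau => 2 | HH => 2 end.

(* [HPrim n x m] is the primitive term x with left subscript n and right
   subscript m. *)
Inductive h_prim := HPrim of nat & h_gen & nat.

HB.instance Definition _ := gen_eqMixin h_prim.
HB.instance Definition _ := gen_choiceMixin h_prim.

Definition h_src (p : h_prim) : nat := let: HPrim n x m := p in n + h_gen_src x + m.
Definition h_tgt (p : h_prim) : nat := let: HPrim n x m := p in n + h_gen_tgt x + m.

(* Since parentheses in compositions are not written, a term is the nonempty
   sequence of its factors, the outermost factor first. *)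
Definition h_raw := seq h_prim.

Fixpoint h_wf (n m : nat) (t : h_raw) : bool :=
  match t with
  | [::] => false
  | [:: p] => (h_src p == n) && (h_tgt p == m)
  | p :: t' => (h_tgt p == m) && h_wf n (h_src p) t'
  end.

Definition h_comp (g f : h_raw) : h_raw := g ++ f.

Definition h_whisker (n : nat) (f : h_raw) (m : nat) : h_raw :=
  [seq (let: HPrim k x l := p in HPrim (n + k) x (l + m)) | p <- f].

Section PFHterms.
Local Notation "g ∘ f" := (h_comp g f) (at level 40, left associativity).

Definition h_one n m : h_raw := [:: HPrim n HOne m].

Local Notation "'u_[' n , m ]" := [:: HPrim n HU m].
Local Notation "'ε_[' n , m ]" := [:: HPrim n HEps m].
Local Notation "'τ_[' n , m ]" := [:: HPrim n HTau m].
Local Notation "'H_[' n , m ]" := [:: HPrim n HH m].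

Inductive h_ax : h_raw -> h_raw -> Prop :=
| h_ax_idr n m f : h_wf n m f -> h_ax (f ∘ h_one 0 n) f
| h_ax_idl n m f : h_wf n m f -> h_ax (h_one 0 m ∘ f) f
| h_ax_one : h_ax (h_one 1 0) (h_one 0 1)
| h_ax_interchange (xi theta : h_gen) r :
    xi <> HOne -> theta <> HOne ->
    let p := h_gen_src xi in let q := h_gen_tgt xi in
    let k := h_gen_src theta in let l := h_gen_tgt theta in
    h_ax ([:: HPrim (q + r) theta 0] ∘ [:: HPrim 0 xi (r + k)])
         ([:: HPrim 0 xi (r + l)] ∘ [:: HPrim (p + r) theta 0])
| h_ax_tau_tau : h_ax (τ_[0,0] ∘ τ_[0,0]) (h_one 0 2)
| h_ax_yang_baxter :
    h_ax (τ_[1,0] ∘ τ_[0,1] ∘ τ_[1,0]) (τ_[0,1] ∘ τ_[1,0] ∘ τ_[0,1])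
| h_ax_tau_u : h_ax (τ_[0,0] ∘ u_[0,1]) u_[1,0]
| h_ax_eps_tau : h_ax (ε_[0,1] ∘ τ_[0,0]) ε_[1,0]
| h_ax_H_H : h_ax (H_[0,0] ∘ H_[0,0]) H_[0,0]
| h_ax_tau_H :
    h_ax (τ_[1,0] ∘ H_[0,1] ∘ τ_[1,0]) (τ_[0,1] ∘ H_[1,0] ∘ τ_[0,1])
| h_ax_HtH_l :
    h_ax (τ_[0,0] ∘ H_[0,0] ∘ τ_[0,0] ∘ H_[0,0]) (H_[0,0] ∘ τ_[0,0] ∘ H_[0,0])
| h_ax_HtH_r :
    h_ax (H_[0,0] ∘ τ_[0,0] ∘ H_[0,0]) (H_[0,0] ∘ τ_[0,0] ∘ H_[0,0] ∘ τ_[0,0])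
| h_ax_eps_HtH_u :
    h_ax (ε_[0,1] ∘ H_[0,0] ∘ τ_[0,0] ∘ H_[0,0] ∘ u_[0,1]) (h_one 0 1)
| h_ax_H_comm : h_ax (H_[1,0] ∘ H_[0,1]) (H_[0,1] ∘ H_[1,0])
| h_ax_H_fork :
    h_ax (τ_[0,1] ∘ H_[1,0] ∘ τ_[0,1] ∘ H_[1,0])
         (H_[1,0] ∘ τ_[0,1] ∘ H_[1,0] ∘ τ_[0,1])
| h_ax_H_join :
    h_ax (τ_[1,0] ∘ H_[0,1] ∘ τ_[1,0] ∘ H_[0,1])
         (H_[0,1] ∘ τ_[1,0] ∘ H_[0,1] ∘ τ_[1,0])
| h_ax_eps_u : h_ax (ε_[0,0] ∘ u_[0,0]) (h_one 0 0)
| h_ax_eps_u_fork :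
    h_ax (ε_[2,0] ∘ H_[1,0] ∘ τ_[0,1] ∘ H_[1,0] ∘ u_[2,0]) τ_[0,0]
| h_ax_eps_u_join :
    h_ax (ε_[0,2] ∘ H_[0,1] ∘ τ_[1,0] ∘ H_[0,1] ∘ u_[0,2]) τ_[0,0]
| h_ax_bialgebra :
    h_ax (ε_[2,2] ∘ H_[2,1] ∘ H_[1,2] ∘ τ_[3,0] ∘ τ_[0,3]
            ∘ H_[2,1] ∘ H_[1,2] ∘ u_[2,2])
         (H_[1,1] ∘ τ_[2,0] ∘ H_[1,1] ∘ τ_[2,0] ∘ τ_[0,2]
            ∘ H_[1,1] ∘ τ_[2,0] ∘ H_[1,1]).

Inductive h_eq : nat -> nat -> h_raw -> h_raw -> Prop :=
| h_eq_ax n m f g : h_ax f g -> h_wf n m f -> h_wf n m g -> h_eq n m f g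
| h_eq_refl n m f : h_wf n m f -> h_eq n m f f
| h_eq_sym n m f g : h_eq n m f g -> h_eq n m g f
| h_eq_trans n m f g h : h_eq n m f g -> h_eq n m g h -> h_eq n m f h
| h_eq_whisker a b n m f g : h_eq n m f g ->
    h_eq (a + n + b) (a + m + b) (h_whisker a f b) (h_whisker a g b)
| h_eq_comp n m k f g f' g' : h_eq n m f g -> h_eq m k f' g' ->
    h_eq n k (f' ∘ f) (g' ∘ g).

End PFHterms.

Definition h_term (n m : nat) : Type := {t : h_raw | h_wf n m t}.

Lemma h_wf_one n : h_wf n n (h_one 0 n).
Proof. by rewrite /= add0n eqxx. Qed.

Lemma h_wf_cons n m p t : t != [::] ->
  h_wf n m (p :: t) = (h_tgt p == m) && h_wf n (h_src p) t.
Proof. by case: t. Qed.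

Lemma h_wf_comp n m k g f : h_wf m k g -> h_wf n m f -> h_wf n k (h_comp g f).
Proof.
move=> wg wf; have f0 : f != [::] by case: f wf.
elim: g k wg => [//|p [|q g] IH] k wg; rewrite /h_comp cat_cons h_wf_cons //.
- by case/andP: wg => /eqP-> ->.
- by move: wg; rewrite h_wf_cons // => /andP[-> /IH].
Qed.

Definition h_id_term n : h_term n n := exist _ (h_one 0 n) (h_wf_one n).

Definition h_comp_term n m k (g : h_term m k) (f : h_term n m) : h_term n k :=
  exist _ (h_comp (val g) (val f)) (h_wf_comp (valP g) (valP f)).

Definition h_rel n m : rel (h_term n m) := fun f g => `[< h_eq n m (val f) (val g) >].

Lemma h_rel_refl n m : reflexive (@h_rel n m).
Proof. by move=> f; apply/asboolP/h_eq_refl/valP. Qed.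

Lemma h_rel_sym n m : symmetric (@h_rel n m).
Proof. by move=> f g; apply/asboolP/asboolP => /h_eq_sym. Qed.

Lemma h_rel_trans n m : transitive (@h_rel n m).
Proof.
by move=> g f h /asboolP fg /asboolP gh; apply/asboolP/(h_eq_trans fg gh).
Qed.

HB.instance Definition _ n m := Choice.on (h_term n m).

Canonical h_equiv n m := EquivRel (@h_rel n m)
  (@h_rel_refl n m) (@h_rel_sym n m) (@h_rel_trans n m).

Definition h_hom (n m : nat) : Type := {eq_quot (h_equiv n m)}.

Definition h_class n m (f : h_term n m) : h_hom n m :=
  \pi_({eq_quot (h_equiv n m)}) f.

Definition h_repr n m (f : h_hom n m) : h_term n m :=
  repr (f : {eq_quot (h_equiv n m)}).

Lemma h_reprK n m (f : h_hom n m) : h_class (h_repr f) = f.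
Proof. exact: reprK. Qed.

Lemma h_classP n m (f g : h_term n m) :
  h_class f = h_class g <-> h_eq n m (val f) (val g).
Proof.
split=> [/(@eqmodP _ (h_equiv n m))/asboolP //|fg].
by apply/(@eqmodP _ (h_equiv n m)); apply/asboolP.
Qed.

Definition h_hom_id (n : nat) : h_hom n n := h_class (h_id_term n).

Definition h_hom_comp n m k (g : h_hom m k) (f : h_hom n m) : h_hom n k :=
  h_class (h_comp_term (h_repr g) (h_repr f)).

Lemma h_class_comp n m k (g : h_term m k) (f : h_term n m) :
  h_hom_comp (h_class g) (h_class f) = h_class (h_comp_term g f).
Proof. by apply/h_classP/h_eq_comp; apply/h_classP/h_reprK. Qed.

Lemma h_hom_idl n m (f : h_hom n m) : h_hom_comp (h_hom_id m) f = f.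
Proof.
rewrite -[f]h_reprK h_class_comp; apply/h_classP/h_eq_ax; try exact: valP.
exact/h_ax_idl/valP.
Qed.

Lemma h_hom_idr n m (f : h_hom n m) : h_hom_comp f (h_hom_id n) = f.
Proof.
rewrite -[f]h_reprK h_class_comp; apply/h_classP/h_eq_ax; try exact: valP.
exact/h_ax_idr/valP.
Qed.

Lemma h_hom_assoc n m k l (h : h_hom k l) (g : h_hom m k) (f : h_hom n m) :
  h_hom_comp h (h_hom_comp g f) = h_hom_comp (h_hom_comp h g) f.
Proof.
rewrite -[h]h_reprK -[g]h_reprK -[f]h_reprK !h_class_comp.
congr h_class; apply: val_inj; exact: catA.
Qed.

Definition PFH : category :=
  @Category nat h_hom h_hom_id h_hom_comp h_hom_idl h_hom_idr h_hom_assoc.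

(* Main.v *)
Require Import Defs.
From mathcomp Require Import all_boot.
From mathcomp Require Import boolp.

Set Implicit Arguments.
Unset Strict Implicit.
Unset Printing Implicit Defensive.

(** Why the three categories are isomorphic.

    Read an arrow [n -> m] as a relation between bits on [n] source wires and
    bits on [m] target wires: [u] and [ε] create and forget a wire without
    constraint, [τ] swaps two wires, [H] passes two wires on provided that the
    first bit is at most the second, and [M f] keeps a further head wire.  The
    relations so obtained contain the constant vectors and are closed under
    pointwise meets and joins, and by Birkhoff's theorem ([birkhoff]) these are
    exactly the families of up-sets of split preorders.  As split preorders
    compose on up-sets as relations do, each of the two syntactic categories maps
    to [SplPre] once its equations have been checked on bits ([h_eq_run],
    [pf_eq_run]).  It remains to see that the two functors are bijective on
    arrows ([iso_SplPre]); the third isomorphism is then a composite.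

    Both syntactic categories carry the same structure, [h_structure], and only
    this structure is used.  The category [PFH] has it by definition, up to the
    extension of the interchange law from generators to all terms ([h_eq_nat]).
    In a preordering Frobenius monad one sets [H = M∇ ∘ M↓ ∘ Δ], that is, copy the
    first wire, let the copy pass a one-way link, and merge it with the second
    wire.  The decisive point is that [τ ∘ H ∘ τ ∘ H = Δ ∘ ∇] ([spider]), which
    turns the up-and-down equation into the identification of two wires; the
    equations between [H], [u] and [ε] follow from those of the Frobenius monad by
    moving multiplications and comultiplications past each other.

    In an [h_structure], let [conn n i j] impose that bit [i] is at most bit [j].
    These endomorphisms of [n] commute and are idempotent, and the bialgebra
    equation makes them transitive ([conn_trans]).  Hence a finite product
    [R n s] of them depends only on the up-sets of the relation [s]
    ([R_eq_up]): the wires provably above a given one form an up-set.  Forgetting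
    a wire of such a system yields such a system again ([Ex_R]), because
    eliminating [h] from [B <= h <= A] leaves [b <= a] for all [b] in [B] and [a]
    in [A] ([eliminatesP]); the bialgebra equation is the case of two elements on
    either side, from which the others are built with intermediate wires.
    Therefore every arrow [0 -> n] is a system of constraints on fresh wires
    ([state_form]), and is determined by its relation.  Bending a source wire to
    the target by means of identified pairs of wires ([bendK]) reduces all arrows
    to this case, both for injectivity ([den_faithful]) and for surjectivity
    ([den_full]). *)

(** * Monads with symmetry and a one-way link *)

(** The equations of [PFH], with [aM] for the addition of a head wire, so that an
    equation at [n] is the primitive one with [n] idle wires to its right. *)
Record h_structure := HStructure {
  arr : nat -> nat -> Type;
  aid : forall n, arr n n;
  acomp : forall n m k, arr m k -> arr n m -> arr n k;
  aM : forall n m, arr n m -> arr n.+1 m.+1;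
  au : forall n, arr n n.+1;
  aeps : forall n, arr n.+1 n;
  atau : forall n, arr n.+2 n.+2;
  aH : forall n, arr n.+2 n.+2;
  acomp_idl : forall n m (f : arr n m), acomp (aid m) f = f;
  acomp_idr : forall n m (f : arr n m), acomp f (aid n) = f;
  acompA : forall n m k l (h : arr k l) (g : arr m k) (f : arr n m),
    acomp h (acomp g f) = acomp (acomp h g) f;
  aM_id : forall n, aM (aid n) = aid n.+1;
  aM_comp : forall n m k (g : arr m k) (f : arr n m),
    aM (acomp g f) = acomp (aM g) (aM f);
  au_nat : forall n m (f : arr n m), acomp (au m) f = acomp (aM f) (au n);
  aeps_nat : forall n m (f : arr n m), acomp (aeps m) (aM f) = acomp f (aeps n);
  atau_nat : forall n m (f : arr n m),
    acomp (atau m) (aM (aM f)) = acomp (aM (aM f)) (atau n);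
  aH_nat : forall n m (f : arr n m),
    acomp (aH m) (aM (aM f)) = acomp (aM (aM f)) (aH n);
  atau_inv : forall n, acomp (atau n) (atau n) = aid n.+2;
  aYB : forall n, acomp (aM (atau n)) (acomp (atau n.+1) (aM (atau n))) =
                  acomp (atau n.+1) (acomp (aM (atau n)) (atau n.+1));
  atau_u : forall n, acomp (atau n) (au n.+1) = aM (au n);
  aeps_tau : forall n, acomp (aeps n.+1) (atau n) = aM (aeps n);
  aHH : forall n, acomp (aH n) (aH n) = aH n;
  atau_H : forall n, acomp (aM (atau n)) (acomp (aH n.+1) (aM (atau n))) =
                  acomp (atau n.+1) (acomp (aM (aH n)) (atau n.+1));
  aHtH_l : forall n, acomp (atau n) (acomp (aH n) (acomp (atau n) (aH n))) =
                    acomp (aH n) (acomp (atau n) (aH n));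
  aHtH_r : forall n, acomp (aH n) (acomp (atau n) (aH n)) =
                    acomp (aH n) (acomp (atau n) (acomp (aH n) (atau n)));
  aeps_HtH_u : forall n,
    acomp (aeps n.+1) (acomp (aH n) (acomp (atau n) (acomp (aH n) (au n.+1)))) =
    aid n.+1;
  aHcomm : forall n, acomp (aM (aH n)) (aH n.+1) = acomp (aH n.+1) (aM (aH n));
  afork : forall n,
    acomp (atau n.+1) (acomp (aM (aH n)) (acomp (atau n.+1) (aM (aH n)))) =
    acomp (aM (aH n)) (acomp (atau n.+1) (acomp (aM (aH n)) (atau n.+1)));
  ajoin : forall n,
    acomp (aM (atau n)) (acomp (aH n.+1) (acomp (aM (atau n)) (aH n.+1))) =
    acomp (aH n.+1) (acomp (aM (atau n)) (acomp (aH n.+1) (aM (atau n))));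
  aeps_u : forall n, acomp (aeps n) (au n) = aid n;
  aeps_u_fork : forall n,
    acomp (aM (aM (aeps n))) (acomp (aM (aH n)) (acomp (atau n.+1)
      (acomp (aM (aH n)) (aM (aM (au n)))))) = atau n;
  aeps_u_join : forall n,
    acomp (aeps n.+2) (acomp (aH n.+1) (acomp (aM (atau n))
      (acomp (aH n.+1) (au n.+2)))) = atau n;
  abialg : forall n,
    acomp (aM (aM (aeps n.+2))) (acomp (aM (aM (aH n.+1))) (acomp (aM (aH n.+2))
      (acomp (aM (aM (aM (atau n)))) (acomp (atau n.+3)
      (acomp (aM (aM (aH n.+1))) (acomp (aM (aH n.+2))
      (aM (aM (au n.+2))))))))) =
    acomp (aM (aH n.+1)) (acomp (aM (aM (atau n))) (acomp (aM (aH n.+1))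
      (acomp (aM (aM (atau n))) (acomp (atau n.+2)
      (acomp (aM (aH n.+1)) (acomp (aM (aM (atau n))) (aM (aH n.+1)))))))) }.

Declare Scope arr_scope.
Delimit Scope arr_scope with arr.
Notation "g ∘ f" := (acomp g f) (at level 41, right associativity) : arr_scope.
Arguments aid {h n} : rename.
Arguments acomp {h n m k} g f : rename.
Arguments aM {h n m} f : rename.
Arguments au {h} n : rename.
Arguments aeps {h} n : rename.
Arguments atau {h} n : rename.
Arguments aH {h} n : rename.

Section Connections.
Variable X : h_structure.
Local Open Scope arr_scope.
Local Notation C := (arr X).
Local Notation M := aM.
Local Notation τ := (@atau X).
Local Notation H := (@aH X).

(** Composites are kept nested to the right; an equation between composites of two
    or three factors then rewrites inside a longer one in this form. *)
Lemma rw2 n m k l (f : C m k) (g : C n m) (h : C n k) (e : f ∘ g = h) (x : C l n) :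
  f ∘ g ∘ x = h ∘ x.
Proof. by rewrite acompA e. Qed.

Lemma rw3 n m k l p (f : C k l) (g : C m k) (h : C n m) (e : C n l)
  (E : f ∘ g ∘ h = e) (x : C p n) : f ∘ g ∘ h ∘ x = e ∘ x.
Proof. by rewrite -E -?acompA. Qed.

Lemma tau_tauK n l (x : C l n.+2) : τ n ∘ τ n ∘ x = x.
Proof. by rewrite acompA atau_inv acomp_idl. Qed.

Lemma M_tau_tauK n l (x : C l n.+3) : M (τ n) ∘ M (τ n) ∘ x = x.
Proof. by rewrite acompA -aM_comp atau_inv aM_id acomp_idl. Qed.

(** The link in the opposite direction. *)
Definition K n : C n.+2 n.+2 := τ n ∘ H n ∘ τ n.

(** [hd_conn Y N j] lets the head wire interact through [Y] with wire [j] of the tail. *)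
Fixpoint hd_conn (Y : forall n, C n.+2 n.+2) N (j : nat) : C N.+1 N.+1 :=
  match N with
  | 0 => aid
  | N'.+1 => match j with
             | 0 => Y N'
             | j'.+1 => τ N' ∘ M (hd_conn Y N' j') ∘ τ N'
             end
  end.

(** Wire [i] is constrained below wire [j].  By recursion on the number of wires,
    each constraint has one fixed expression, whatever permutation could bring the
    two wires to the head.  An index out of range, or [i = j], gives no
    constraint. *)
Fixpoint conn N (i j : nat) : C N N :=
  match N with
  | 0 => aid
  | N'.+1 => match i, j with
             | 0, 0 => aid
             | 0, j'.+1 => hd_conn H N' j'
             | i'.+1, 0 => hd_conn K N' i'
             | i'.+1, j'.+1 => M (conn N' i' j')
             end
  end.

Definition swap01 k := match k with 0 => 1 | 1 => 0 | _ => k end.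
Definition lift0 p k := match k with 0 => 0 | k'.+1 => (p k').+1 end.

(** Arrows built from transpositions, recorded with a permutation of the indices:
    conjugation by such an arrow acts on constraints through the permutation alone
    ([conn_perm]), so the arrow itself never has to be put into a normal form. *)
Inductive realizes : forall n, C n n -> (nat -> nat) -> Prop :=
| realizes_id n : realizes (@aid X n) id
| realizes_comp n (f g : C n n) p q :
    realizes f p -> realizes g q -> realizes (f ∘ g) (p \o q)
| realizes_tau n : realizes (τ n) swap01
| realizes_M n (f : C n n) p : realizes f p -> realizes (M f) (lift0 p).

Lemma realizes_inv n (f : C n n) p : realizes f p ->
  exists g q, [/\ realizes g q, g ∘ f = aid, f ∘ g = aid & cancel p q].
Proof.
elim=> [m|m f1 f2 p1 p2 _ [g1 [q1 [w1 e1 e1' K1]]] _ [g2 [q2 [w2 e2 e2' K2]]]|m|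
        m f1 p1 _ [g1 [q1 [w1 e1 e1' K1]]]].
- by exists aid, id; rewrite acomp_idl; split=> //; apply: realizes_id.
- exists (g2 ∘ g1), (q2 \o q1); split; first exact: realizes_comp.
  + by rewrite -acompA (rw2 e1) acomp_idl.
  + by rewrite -acompA (rw2 e2') acomp_idl.
  + by move=> k /=; rewrite K1 K2.
- exists (τ m), swap01; rewrite atau_inv; split=> //; first exact: realizes_tau.
  by case=> [|[|k]].
- exists (M g1), (lift0 q1); rewrite -!aM_comp e1 e1' aM_id; split=> //.
    exact: realizes_M.
  by case=> [|k] //=; rewrite K1.
Qed.

Lemma realizes_lt n (f : C n n) p : realizes f p -> forall k, (p k < n) = (k < n).
Proof.
elim=> // [m f1 f2 p1 p2 _ IH1 _ IH2 k|m [|[|k]] //|m f1 p1 _ IH [|k] //=].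
  by rewrite /= IH1 IH2.
by rewrite !ltnS IH.
Qed.

Section Head.
Variable Y : forall n, C n.+2 n.+2.
Hypothesis Y_nat : forall n m (f : C n m), Y m ∘ M (M f) = M (M f) ∘ Y n.
Hypothesis tY : forall n, M (τ n) ∘ Y n.+1 ∘ M (τ n) = τ n.+1 ∘ M (Y n) ∘ τ n.+1.

Lemma tY' n : M (τ n) ∘ Y n.+1 = τ n.+1 ∘ M (Y n) ∘ τ n.+1 ∘ M (τ n).
Proof.
transitivity ((τ n.+1 ∘ M (Y n) ∘ τ n.+1) ∘ M (τ n)); last by rewrite -?acompA.
by rewrite -tY -?acompA -aM_comp atau_inv aM_id acomp_idr.
Qed.

Lemma tY'' n : τ n.+1 ∘ M (Y n) ∘ τ n.+1 = M (τ n) ∘ Y n.+1 ∘ M (τ n).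
Proof. by rewrite tY. Qed.

(** At the transposition, position by position, this is the compatibility of [Y]
    with [τ] on the first three wires, then the Yang-Baxter equation. *)
Lemma hd_conn_perm n (f : C n n) p j : realizes f p ->
  M f ∘ hd_conn Y n j = hd_conn Y n (p j) ∘ M f.
Proof.
move=> w; elim: w j => {n f p} [n j|n f g p q wf IHf wg IHg j|n j|n f p w IH j].
- by rewrite aM_id acomp_idl acomp_idr.
- by rewrite aM_comp -acompA IHg (rw2 (IHf _)) -acompA.
- case: j => [|[|j]] /=.
  + by rewrite tY' -?acompA.
  + by rewrite -?acompA tY'' M_tau_tauK.
  + rewrite !aM_comp -?acompA (rw3 (aYB _ _)) -?acompA.
    rewrite (rw2 (atau_nat _)) -?acompA.
    by rewrite -(aYB _ n).
- case: j => [|j] /=; first by rewrite Y_nat.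
  rewrite -?acompA atau_nat (rw2 (esym (atau_nat f))) -?acompA.
  by rewrite (rw2 (esym (aM_comp _ _))) IH aM_comp -?acompA.
Qed.

End Head.

Lemma K_nat n m (f : C n m) : K m ∘ M (M f) = M (M f) ∘ K n.
Proof.
by rewrite /K -?acompA atau_nat (rw2 (aH_nat _)) -?acompA (rw2 (atau_nat _)) -?acompA.
Qed.

Lemma MH_t n : M (H n) = τ n.+1 ∘ M (τ n) ∘ H n.+1 ∘ M (τ n) ∘ τ n.+1.
Proof.
have := congr1 (fun x => τ n.+1 ∘ x ∘ τ n.+1) (atau_H X n).
by rewrite -?acompA !tau_tauK atau_inv acomp_idr => <-.
Qed.

Lemma tKt n : M (τ n) ∘ K n.+1 ∘ M (τ n) = τ n.+1 ∘ M (K n) ∘ τ n.+1.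
Proof.
rewrite /K !aM_comp MH_t -?acompA.
rewrite (rw3 (esym (aYB X n))) -?acompA M_tau_tauK.
by rewrite (rw3 (aYB X n)) -?acompA atau_inv acomp_idr.
Qed.

Lemma conn_perm n (f : C n n) p i j : realizes f p ->
  f ∘ conn n i j = conn n (p i) (p j) ∘ f.
Proof.
move=> w; elim: w i j => {n f p} [n i j|n f g p q wf IHf wg IHg i j|n i j|n f p w IH i j].
- by rewrite acomp_idl acomp_idr.
- by rewrite -acompA IHg (rw2 (IHf _ _)) -acompA.
- case: i j => [|[|i]] [|[|j]] /=; rewrite ?aM_id ?acomp_idl ?acomp_idr //.
  + by rewrite /K -?acompA atau_inv acomp_idr.
  + by rewrite !tau_tauK.
  + by rewrite /K !tau_tauK.
  + by rewrite -?acompA atau_inv acomp_idr.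
  + by rewrite !tau_tauK.
  + by rewrite -?acompA atau_inv acomp_idr.
  + exact: atau_nat.
- case: i j => [|i] [|j] /=; rewrite ?acomp_idl ?acomp_idr //.
  + by apply: hd_conn_perm w; [apply: aH_nat | apply: atau_H].
  + by apply: hd_conn_perm w; [apply: K_nat | apply: tKt].
  + by rewrite -!aM_comp IH.
Qed.

Lemma gather1 n i : i < n -> exists f p, @realizes n f p /\ p i = 0.
Proof.
elim: i n => [|i IH] [|[|n]] // lt_in; first by exists aid, id; split=> //; apply: realizes_id.
  by exists aid, id; split=> //; apply: realizes_id.
have [f [p [w pi]]] := IH n.+1 lt_in.
exists (τ n ∘ M f), (swap01 \o lift0 p); split; last by rewrite /= pi.
by apply: realizes_comp (realizes_tau n) (realizes_M w).
Qed.

Lemma realizes_inj n (f : C n n) p : realizes f p -> injective p.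
Proof. by move=> /realizes_inv[g [q [_ _ _ /can_inj]]]. Qed.

(** Any distinct wires can be moved to the first positions, so an identity between
    constraints on them need only be checked there ([transfer], [transferEx]). *)
Lemma gather n l : uniq l -> all (fun k => k < n) l ->
  exists f p, @realizes n f p /\ map p l = iota 0 (size l).
Proof.
elim: {l}(size l) {-2}l (erefl (size l)) n => [|k IH] [|i l] //= sz n.
  by exists aid, id; split=> //; apply: realizes_id.
move=> /andP[il ul] /andP[lt_in ltl].
have [f [p [w pi]]] := gather1 lt_in.
case: n => [|n] // in f w lt_in ltl *.
have pl x : x \in l -> p x != 0.
  move=> xl; apply/eqP => px; have xi : x = i by apply: (realizes_inj w); rewrite px.
  by rewrite -xi xl in il.
pose l' := map (fun x => (p x).-1) l.
have el' : map p l = map succn l'.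
  rewrite -map_comp; apply/eq_in_map => x /pl /=.
  by case: (p x).
have [|||g [q [w' e]]] := IH l' _ n.
- by rewrite size_map; case: sz.
- have : uniq (map p l) by rewrite (map_inj_uniq (realizes_inj w)).
  by rewrite el' (map_inj_uniq succn_inj).
- apply/allP => y yl'; have : y.+1 \in map p l by rewrite el' map_f.
  move/mapP => [x xl /(congr1 (fun k => k < n.+1))].
  by rewrite ltnS (realizes_lt w) (allP ltl).
exists (M g ∘ f), (lift0 q \o p); split; first exact: realizes_comp (realizes_M w') w.
rewrite /= pi; congr cons; rewrite map_comp el' -map_comp.
transitivity (map succn (map q l')); first by rewrite -map_comp.
by rewrite e size_map -(iotaDl 1 0).
Qed.

End Connections.

(** * The calculus of constraints *)

Section Constraints.
Variable X : h_structure.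
Local Open Scope arr_scope.
Local Notation C := (arr X).
Local Notation M := aM.
Local Notation u := (@au X).
Local Notation ε := (@aeps X).
Local Notation τ := (@atau X).
Local Notation H := (@aH X).
Local Notation conn := (conn X).

Definition map_pair (p : nat -> nat) (x : nat * nat) := (p x.1, p x.2).

Fact R_key : unit. Proof. exact: tt. Qed.

(** The conjunction of a system of constraints.  It is locked, since unification
    would otherwise unfold it to a composite. *)
Definition R := locked_with R_key (fun n (s : seq (nat * nat)) =>
  foldr (fun x f => conn n x.1 x.2 ∘ f) aid s : C n n).

Lemma R_nil n : R n [::] = aid.
Proof. by rewrite /R unlock. Qed.

Lemma R_cons n x s : R n (x :: s) = conn n x.1 x.2 ∘ R n s.
Proof. by rewrite /R unlock. Qed.

Lemma R1 n i j : R n [:: (i, j)] = conn n i j.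
Proof. by rewrite R_cons R_nil acomp_idr. Qed.

Definition RE := (R_cons, R_nil, acomp_idr).

Definition wf n (s : seq (nat * nat)) := all (fun x => (x.1 < n) && (x.2 < n)) s.

Lemma R_cat n s t : R n (s ++ t) = R n s ∘ R n t.
Proof. by elim: s => [|x s IH]; rewrite ?R_nil ?acomp_idl // cat_cons !R_cons IH acompA. Qed.

Lemma conn_refl n i : conn n i i = aid.
Proof. by elim: n i => [|n IH] [|i] //=; rewrite IH aM_id. Qed.

Lemma R_perm n (f : C n n) p s : realizes f p -> f ∘ R n s = R n (map (map_pair p) s) ∘ f.
Proof.
move=> w; elim: s => [|x s IH]; first by rewrite R_nil acomp_idl acomp_idr.
by rewrite map_cons !R_cons (rw2 (conn_perm _ _ w)) -?acompA IH.
Qed.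

Lemma R_conj n (f : C n n) p s t : realizes f p ->
  R n (map (map_pair p) s) = R n (map (map_pair p) t) -> R n s = R n t.
Proof.
move=> w e; have [g [q [_ gf _ _]]] := realizes_inv w.
have : g ∘ f ∘ R n s = g ∘ f ∘ R n t by rewrite !(R_perm _ w) e.
by rewrite !(rw2 gf) !acomp_idl.
Qed.

(** The existential quantification over the head wire. *)
Definition Ex n (f : C n.+1 n.+1) : C n n := ε n ∘ f ∘ u n.

Lemma Ex_comp n (a b : C n n) f : Ex (M a ∘ f ∘ M b) = a ∘ Ex f ∘ b.
Proof. by rewrite /Ex -?acompA (rw2 (aeps_nat _)) -?acompA au_nat. Qed.

Lemma Ex_l n (a : C n n) f : Ex (M a ∘ f) = a ∘ Ex f.
Proof. by have := Ex_comp a aid f; rewrite aM_id !acomp_idr. Qed.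

Lemma Ex_r n (a : C n n) f : Ex (f ∘ M a) = Ex f ∘ a.
Proof. by have := Ex_comp aid a f; rewrite aM_id !acomp_idl. Qed.

Lemma Ex_conj n (f : C n n) p s t : realizes f p ->
  Ex (R n.+1 (map (map_pair (lift0 p)) s)) = R n (map (map_pair p) t) -> Ex (R n.+1 s) = R n t.
Proof.
move=> w e; have [g [q [_ gf _ _]]] := realizes_inv w.
have : g ∘ f ∘ Ex (R n.+1 s) = g ∘ f ∘ R n t.
  by rewrite -Ex_l (R_perm _ (realizes_M w)) Ex_r e -(R_perm _ w).
by rewrite !(rw2 gf) !acomp_idl.
Qed.

Lemma uniq_size_lt n l : uniq l -> all (fun k => k < n) l -> size l <= n.
Proof.
move=> ul ltl; rewrite -[n](size_iota 0); apply: uniq_leq_size => // k /(allP ltl).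
by rewrite mem_iota.
Qed.

Lemma map_pair_nth p l s : map p l = iota 0 (size l) -> wf (size l) s ->
  map (map_pair p) (map (map_pair (nth 0 l)) s) = s.
Proof.
move=> e ws; rewrite -map_comp -[RHS]map_id; apply/eq_in_map => -[i j] xs.
have /andP[/= li lj] := allP ws _ xs.
by rewrite /map_pair /= -!(nth_map 0 0 p) // e !nth_iota.
Qed.

Lemma transfer l n s t : uniq l -> all (fun k => k < n) l ->
  wf (size l) s -> wf (size l) t ->
  (forall m, R (size l + m) s = R (size l + m) t) ->
  R n (map (map_pair (nth 0 l)) s) = R n (map (map_pair (nth 0 l)) t).
Proof.
move=> ul ltl ws wt e; have [f [p [w pl]]] := gather X ul ltl.
apply: (R_conj w); rewrite !map_pair_nth //.
by rewrite -(subnKC (uniq_size_lt ul ltl)).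
Qed.

Lemma transferEx l n s t : uniq l -> all (fun k => k < n) l ->
  wf (size l).+1 s -> wf (size l) t ->
  (forall m, Ex (R (size l + m).+1 s) = R (size l + m) t) ->
  Ex (R n.+1 (map (map_pair (nth 0 (0 :: map succn l))) s)) = R n (map (map_pair (nth 0 l)) t).
Proof.
move=> ul ltl ws wt e; have [f [p [w pl]]] := gather X ul ltl.
apply: (Ex_conj w); rewrite !map_pair_nth ?size_map //.
- by rewrite -(subnKC (uniq_size_lt ul ltl)).
- by rewrite /= size_map -map_comp (iotaDl 1 0) -pl -map_comp.
- by rewrite /= size_map.
Qed.

(** The commutation of two constraints depends only on which of the four indices
    coincide, and each pattern is one of the equations of the structure. *)
Lemma connC n i j k l : i < n -> j < n -> k < n -> l < n ->
  conn n i j ∘ conn n k l = conn n k l ∘ conn n i j.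
Proof.
move=> li lj lk ll.
have [->|ij] := eqVneq i j; first by rewrite conn_refl acomp_idl acomp_idr.
have [->|kl] := eqVneq k l; first by rewrite conn_refl acomp_idl acomp_idr.
have RR a b c d : R n [:: (a, b); (c, d)] = conn n a b ∘ conn n c d.
  by rewrite R_cons R1.
rewrite -!RR.
have [ki|ki] := eqVneq k i; have [lj'|lj'] := eqVneq l j; subst=> //.
- apply: (@transfer [:: i; j; l] n [:: (0, 1); (0, 2)] [:: (0, 2); (0, 1)]) => //.
  + by rewrite /= !inE !negb_or ij kl eq_sym lj'.
  + by rewrite /= li lj ll.
  + move=> m; rewrite !RE /=.
    by rewrite tY''; [|exact: atau_H]; rewrite -?acompA ajoin.
- apply: (@transfer [:: i; k; j] n [:: (0, 2); (1, 2)] [:: (1, 2); (0, 2)]) => //.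
  + by rewrite /= !inE !negb_or eq_sym ki ij kl.
  + by rewrite /= li lj lk.
  + by move=> m; rewrite !RE /= -?acompA afork.
have [kj|kj] := eqVneq k j; have [li'|li'] := eqVneq l i; subst=> //.
- apply: (@transfer [:: i; j] n [:: (0, 1); (1, 0)] [:: (1, 0); (0, 1)]) => //.
  + by rewrite /= !inE ij.
  + by rewrite /= li lj.
  + by move=> m; rewrite !RE /= -?acompA /K -?acompA aHtH_l aHtH_r.
- apply: (@transfer [:: i; j; l] n [:: (0, 1); (1, 2)] [:: (1, 2); (0, 1)]) => //.
  + by rewrite /= !inE !negb_or ij kl eq_sym li'.
  + by rewrite /= li lj ll.
  + by move=> m; rewrite !RE /= aHcomm.
- apply: (@transfer [:: k; i; j] n [:: (1, 2); (0, 1)] [:: (0, 1); (1, 2)]) => //.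
  + by rewrite /= !inE !negb_or ij kl kj.
  + by rewrite /= li lj lk.
  + by move=> m; rewrite !RE /= aHcomm.
- apply: (@transfer [:: i; j; k; l] n [:: (0, 1); (2, 3)] [:: (2, 3); (0, 1)]) => //.
  + by rewrite /= !inE !negb_or ij kl eq_sym ki (eq_sym i) li' (eq_sym j) kj eq_sym lj'.
  + by rewrite /= li lj lk ll.
  + by move=> m; rewrite !RE /= aH_nat.
Qed.

Lemma conn_idem n i j : i < n -> j < n -> conn n i j ∘ conn n i j = conn n i j.
Proof.
move=> li lj.
have [->|ij] := eqVneq i j; first by rewrite conn_refl acomp_idl.
suff : R n [:: (i, j); (i, j)] = R n [:: (i, j)] by rewrite !RE.
apply: (@transfer [:: i; j] n [:: (0, 1); (0, 1)] [:: (0, 1)]); rewrite /= ?inE ?li ?lj ?andbT //.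
by move=> m; rewrite !RE aHH.
Qed.

Lemma R_connC n s i j : wf n s -> i < n -> j < n ->
  conn n i j ∘ R n s = R n s ∘ conn n i j.
Proof.
move=> ws li lj; elim: s ws => [|[k l] s IH]; first by rewrite R_nil acomp_idl acomp_idr.
case/andP=> /andP[lk ll] ws.
by rewrite R_cons (rw2 (connC li lj lk ll)) -acompA IH // -acompA.
Qed.

Lemma R_comm n s t : wf n s -> wf n t -> R n s ∘ R n t = R n t ∘ R n s.
Proof.
move=> ws; elim: t => [|[k l] t IH]; first by rewrite R_nil acomp_idl acomp_idr.
case/andP=> /andP[lk ll] wt.
by rewrite R_cons (rw2 (esym (R_connC ws lk ll))) -acompA IH // -acompA.
Qed.

Lemma R_mem n s i j : wf n s -> (i, j) \in s -> R n s ∘ conn n i j = R n s.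
Proof.
move=> ws; elim: s ws => [|[k l] s IH] //= /andP[/andP[lk ll] ws].
rewrite inE R_cons => /orP[/eqP[-> ->]|ijs]; last by rewrite -acompA IH.
by rewrite -acompA -R_connC // (rw2 (conn_idem lk ll)).
Qed.

Lemma R_sub n s t : wf n s -> {subset t <= s} -> R n s ∘ R n t = R n s.
Proof.
move=> ws; elim: t => [|[i j] t IH] ts; first by rewrite R_nil acomp_idr.
rewrite R_cons acompA R_mem //; first by apply: IH => x xt; apply: ts; rewrite inE xt orbT.
by apply: ts; rewrite inE eqxx.
Qed.

Lemma R_eq_mem n s t : wf n s -> s =i t -> R n s = R n t.
Proof.
move=> ws st; have wt : wf n t by rewrite /wf -(eq_all_r st).
have st1 : {subset t <= s} by move=> x; rewrite st.
have st2 : {subset s <= t} by move=> x; rewrite st.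
by rewrite -(R_sub ws st1) R_comm // R_sub.
Qed.

Lemma R_eq_all n s t : wf n s -> all [in t] s -> all [in s] t -> R n s = R n t.
Proof.
move=> ws st ts; apply: R_eq_mem => // x.
by apply/idP/idP => [/(allP st)|/(allP ts)].
Qed.

Lemma tauM2u n : M (M (u n)) = M (τ n) ∘ τ n.+1 ∘ u n.+2.
Proof. by rewrite atau_u -aM_comp atau_u. Qed.

Lemma tauM2e n : M (M (ε n)) = ε n.+2 ∘ τ n.+1 ∘ M (τ n).
Proof. by rewrite (rw2 (aeps_tau _ _)) -aM_comp aeps_tau. Qed.

(** Moving the middle wire of the bialgebra equation to the head turns its left
    side into an elimination: four wires, two below and two above a fifth. *)
Lemma Ex_bialg0 n : Ex (R n.+4.+1 [:: (0, 3); (2, 0); (0, 4); (1, 0)]) =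
  R n.+4 [:: (1, 2); (1, 3); (0, 2); (0, 3)].
Proof.
have wa : realizes (M (M (τ n))) (lift0 (lift0 swap01)) := realizes_M (realizes_M (realizes_tau X n)).
have wt : realizes (τ n.+2) swap01 := realizes_tau X n.+2.
have wt3 : realizes (τ n.+3) swap01 := realizes_tau X n.+3.
have ws : realizes (M (τ n.+2)) (lift0 swap01) := realizes_M (realizes_tau X n.+2).
pose p := τ n.+2 ∘ M (M (τ n)).
have [g [q [_ _ pgK _]]] := realizes_inv (realizes_comp wt wa).
suff e : Ex (R n.+4.+1 [:: (0, 3); (2, 0); (0, 4); (1, 0)]) ∘ p =
  R n.+4 [:: (1, 2); (1, 3); (0, 2); (0, 3)] ∘ p.
  by have := congr1 (fun x => x ∘ g) e; rewrite -!(acompA _ p g) [p ∘ g]pgK !acomp_idr.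
have -> : R n.+4 [:: (1, 2); (1, 3); (0, 2); (0, 3)] ∘ p =
    M (H n.+1) ∘ M (M (τ n)) ∘ M (H n.+1) ∘ M (M (τ n)) ∘ τ n.+2
      ∘ M (H n.+1) ∘ M (M (τ n)) ∘ M (H n.+1).
  have -> : M (H n.+1) = R n.+4 [:: (1, 2)] by rewrite R1.
  rewrite (rw2 (R_perm _ wa)) -?acompA.
  have aa : M (M (τ n)) ∘ M (M (τ n)) = aid by rewrite -!aM_comp atau_inv !aM_id.
  rewrite (rw2 aa) acomp_idl (R_perm _ wa) !(rw2 (R_perm _ wt)) -?acompA.
  by rewrite (rw2 (R_perm _ wt)) !RE -?acompA.
rewrite -(abialg X n).
have E1 : M (M (H n.+1)) ∘ M (H n.+2) = R n.+4.+1 [:: (2, 3); (1, 2)].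
  by rewrite R_cons R1.
rewrite (rw2 E1) (rw2 E1) tauM2u tauM2e -?acompA.
rewrite (rw2 (R_perm _ ws)) -?acompA (rw2 (R_perm _ wt3)) -?acompA.
rewrite (rw2 (R_perm _ wt3)) -?acompA (rw2 (R_perm _ (realizes_M wa))) -?acompA.
rewrite (rw2 (R_perm _ ws)) -?acompA (rw2 (R_perm _ wt3)) -?acompA.
rewrite (rw2 (esym (R_cat _ _ _))) /Ex -?acompA.
congr (_ ∘ (_ ∘ _)).
have Q : M (M (M (τ n))) ∘ M (τ n.+2) = M (τ n.+2) ∘ M (M (M (τ n))).
  by rewrite -!aM_comp atau_nat.
rewrite (rw2 (esym (atau_nat (M (τ n))))) -?acompA (rw2 Q) -?acompA.
rewrite (rw2 (esym (atau_nat (M (τ n))))) -?acompA.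
by rewrite (rw3 (aYB X _)) -?acompA !tau_tauK au_nat /p aM_comp -?acompA.
Qed.

Lemma Ex_bialg n i i' j j' : uniq [:: i; i'; j; j'] ->
  all (fun k => k < n) [:: i; i'; j; j'] ->
  Ex (R n.+1 [:: (i.+1, 0); (i'.+1, 0); (0, j.+1); (0, j'.+1)]) =
  R n [:: (i, j); (i, j'); (i', j); (i', j')].
Proof.
move=> ul ltl.
apply: (@transferEx [:: i; i'; j; j'] n [:: (1, 0); (2, 0); (0, 3); (0, 4)]
  [:: (0, 2); (0, 3); (1, 2); (1, 3)]) => // m.
have -> : R (4 + m) [:: (0, 2); (0, 3); (1, 2); (1, 3)] =
    R (4 + m) [:: (1, 2); (1, 3); (0, 2); (0, 3)].
  by apply: R_eq_mem => //; apply: perm_mem.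
have -> : R (4 + m).+1 [:: (1, 0); (2, 0); (0, 3); (0, 4)] =
    R (4 + m).+1 [:: (0, 3); (2, 0); (0, 4); (1, 0)].
  by apply: R_eq_mem => //; apply: perm_mem.
exact: Ex_bialg0.
Qed.

(** A common upper bound of two wires can be chosen freely: the equation with
    [τ] on its right side, after moving its third wire to the head. *)
Lemma Ex_fork n i i' : uniq [:: i; i'] -> all (fun k => k < n) [:: i; i'] ->
  Ex (R n.+1 [:: (i.+1, 0); (i'.+1, 0)]) = aid.
Proof.
move=> ul ltl.
rewrite -(R_nil n); apply: (@transferEx [:: i; i'] n [:: (1, 0); (2, 0)] [::]) => // m.
have wt : realizes (τ m) swap01 := realizes_tau X m.
have wt3 : realizes (τ m.+1) swap01 := realizes_tau X m.+1.
have ws : realizes (M (τ m)) (lift0 swap01) := realizes_M (realizes_tau X m).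
suff e : Ex (R (2 + m).+1 [:: (1, 0); (2, 0)]) ∘ τ m = τ m.
  by have := congr1 (fun x => x ∘ τ m) e; rewrite -?acompA atau_inv acomp_idr R_nil.
rewrite -[RHS](aeps_u_fork X m).
have -> : M (H m) = R m.+3 [:: (1, 2)] by rewrite R1.
rewrite tauM2u tauM2e -?acompA.
rewrite !(rw2 (R_perm _ ws)) -?acompA !(rw2 (R_perm _ wt3)) -?acompA.
rewrite !(rw2 (R_perm _ ws)) -?acompA !(rw2 (R_perm _ wt3)) -?acompA.
rewrite (rw2 (esym (R_cat _ _ _))) /Ex -?acompA /=.
have -> : R m.+3 [:: (1, 0); (2, 0)] = R m.+3 [:: (2, 0); (1, 0)].
  by apply: R_eq_mem => // x; rewrite !inE orbC.
congr (_ ∘ (_ ∘ _)).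
by rewrite (rw3 (aYB X _)) -?acompA !tau_tauK au_nat.
Qed.

Lemma Ex_join n i i' : uniq [:: i; i'] -> all (fun k => k < n) [:: i; i'] ->
  Ex (R n.+1 [:: (0, i.+1); (0, i'.+1)]) = aid.
Proof.
move=> ul ltl.
rewrite -(R_nil n); apply: (@transferEx [:: i; i'] n [:: (0, 1); (0, 2)] [::]) => // m.
have ws : realizes (M (τ m)) (lift0 swap01) := realizes_M (realizes_tau X m).
suff e : Ex (R (2 + m).+1 [:: (0, 1); (0, 2)]) ∘ τ m = τ m.
  by have := congr1 (fun x => x ∘ τ m) e; rewrite -?acompA atau_inv acomp_idr R_nil.
rewrite -[RHS](aeps_u_join X m).
have -> : H m.+1 = R m.+3 [:: (0, 1)] by rewrite R1.
by rewrite (rw2 (R_perm _ ws)) -?acompA -au_nat (rw2 (esym (R_cat _ _ _))) /Ex -?acompA.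
Qed.

(** A fresh wire identified with a given one may be forgotten. *)
Lemma Ex_EQ n i : i < n -> Ex (R n.+1 [:: (0, i.+1); (i.+1, 0)]) = aid.
Proof.
move=> li.
rewrite -(R_nil n); apply: (@transferEx [:: i] n [:: (0, 1); (1, 0)] [::]) => //=.
  by rewrite li.
move=> m; rewrite R_nil -[RHS](aeps_HtH_u X m) /Ex.
have -> : R (1 + m).+1 [:: (0, 1); (1, 0)] = H m ∘ τ m ∘ H m.
  by rewrite R_cons R1 aHtH_r.
by rewrite -?acompA.
Qed.

Definition EQ i j := [:: (i, j); (j, i)] : seq (nat * nat).

(** Once two wires are identified, constraints may name either of them: the
    identification absorbs the transposition. *)
Lemma EQ_tau m : R m.+2 (EQ 0 1) ∘ τ m = R m.+2 (EQ 0 1).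
Proof. by rewrite R_cons R1 /= /K -?acompA atau_inv acomp_idr -[RHS]aHtH_r. Qed.

Lemma EQ_swap m s : wf m.+2 s ->
  R m.+2 (EQ 0 1) ∘ R m.+2 s = R m.+2 (EQ 0 1) ∘ R m.+2 (map (map_pair swap01) s).
Proof.
move=> ws; have wt := realizes_tau X m.
have ws' : wf m.+2 (map (map_pair swap01) s).
  rewrite /wf all_map (eq_all (a2 := fun x => (x.1 < m.+2) && (x.2 < m.+2))) // => x /=.
  by rewrite !(realizes_lt wt).
rewrite -[in LHS]EQ_tau -acompA (R_perm _ wt) (rw2 (R_comm _ ws')) -?acompA ?EQ_tau //.
by rewrite R_comm.
Qed.

Lemma EQ_subst n i j k : uniq [:: i; j; k] -> all (fun k => k < n) [:: i; j; k] ->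
  (R n (EQ i j ++ [:: (i, k)]) = R n (EQ i j ++ [:: (j, k)])) /\
  (R n (EQ i j ++ [:: (k, i)]) = R n (EQ i j ++ [:: (k, j)])).
Proof.
move=> ul ltl; split.
  apply: (@transfer [:: i; j; k] n (EQ 0 1 ++ [:: (0, 2)]) (EQ 0 1 ++ [:: (1, 2)])) => // m.
  by rewrite !R_cat (@EQ_swap m.+1).
apply: (@transfer [:: i; j; k] n (EQ 0 1 ++ [:: (2, 0)]) (EQ 0 1 ++ [:: (2, 1)])) => // m.
by rewrite !R_cat (@EQ_swap m.+1).
Qed.

Lemma R_subst n e x y t : R n (e ++ [:: x]) = R n (e ++ [:: y]) ->
  R n (e ++ x :: t) = R n (e ++ y :: t).
Proof. by move=> E; rewrite -!cat_rcons -!cats1 !R_cat -!R_cat R_cat E -R_cat. Qed.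

Definition sh (s : seq (nat * nat)) := map (map_pair succn) s.

Lemma M_R n s : M (R n s) = R n.+1 (sh s).
Proof. by elim: s => [|x s IH]; rewrite ?R_nil ?aM_id //= !R_cons aM_comp IH. Qed.

(** Two links through a common wire compose.  Double the middle wire [c] into
    [c'] and [c]: the bialgebra equation with sources [a, c] and targets [c', b]
    has the two links on its left side and a third, from [a] to [b], on its right. *)
Lemma conn_trans n a c b : uniq [:: a; c; b] -> all (fun k => k < n) [:: a; c; b] ->
  R n [:: (a, c); (c, b)] = R n [:: (a, c); (c, b); (a, b)].
Proof.
move=> ul ltl.
apply: (@transfer [:: a; c; b] n [:: (0, 1); (1, 2)] [:: (0, 1); (1, 2); (0, 2)]) => // m.
(* from here the wires are c', a, c, b in this order, with c' = c imposed by
   the constraints between 0 and 2 *)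
have -> : R m.+3 [:: (0, 1); (1, 2)] =
    Ex (R m.+4 (EQ 0 2 ++ [:: (1, 2); (2, 3)])).
  by rewrite R_cat -[R _ [:: _; (2, 3)]](M_R _ [:: (0, 1); (1, 2)]) Ex_r Ex_EQ // acomp_idl.
have -> : R m.+3 [:: (0, 1); (1, 2); (0, 2)] =
    Ex (R m.+4 (EQ 0 2 ++ [:: (1, 2); (2, 3); (1, 3)])).
  by rewrite R_cat -[R _ [:: _; _; (1, 3)]](M_R _ [:: (0, 1); (1, 2); (0, 2)]) Ex_r Ex_EQ // acomp_idl.
congr Ex.
transitivity (R m.+4 (EQ 0 2 ++ [:: (1, 0); (1, 3); (2, 0); (2, 3)])); last first.
  transitivity (R m.+4 (EQ 0 2 ++ [:: (1, 2); (1, 3); (2, 0); (2, 3)])).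
    by apply: R_subst; apply: (EQ_subst (k := 1) _ _).2.
  exact: R_eq_all.
(* the bialgebra equation introduces a wire d above a and c and below c' and b,
   which becomes wire 0; as c <= d <= c' = c, it can be eliminated as a copy of c' *)
rewrite [in RHS]R_cat -(@Ex_bialg _ 1 2 0 3) // -Ex_l M_R -R_cat.
transitivity (Ex (R m.+4.+1 (EQ 0 1 ++ sh (EQ 0 2 ++ [:: (1, 0); (0, 3)])))).
  rewrite [in RHS]R_cat -M_R Ex_r Ex_EQ // acomp_idl.
  transitivity (R m.+4 (EQ 0 2 ++ [:: (1, 0); (2, 3)])).
    by apply: R_subst; apply/esym/(EQ_subst (k := 1) _ _).2.
  rewrite (@R_eq_all _ _ (EQ 0 2 ++ [:: (2, 3); (1, 0)])) //.
  rewrite (@R_subst _ (EQ 0 2) _ (0, 3)); last first.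
    by apply/esym/(EQ_subst (k := 3) _ _).1.
  exact: R_eq_all.
congr Ex.
transitivity (R m.+4.+1 (EQ 1 3 ++ [:: (1, 0); (2, 0); (0, 1); (0, 4)])); last first.
  rewrite (@R_subst _ (EQ 1 3) _ (3, 0)); last first.
    by apply: (EQ_subst (k := 0) _ _).1.
  exact: R_eq_all.
rewrite (@R_eq_all _ _ (EQ 0 1 ++ [:: (2, 1); (1, 3); (3, 1); (1, 4)])) //.
rewrite (@R_subst _ (EQ 0 1) _ (2, 0)); last first.
  by apply/esym/(EQ_subst (k := 2) _ _).2.
rewrite (@R_eq_all _ _ (EQ 0 1 ++ [:: (1, 4); (1, 3); (3, 1); (2, 0)])) //.
rewrite (@R_subst _ (EQ 0 1) _ (0, 4)); last first.
  by apply/esym/(EQ_subst (k := 4) _ _).1.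
exact: R_eq_all.
Qed.

End Constraints.

(** * Completeness for constraints and elimination of a wire *)

Section Elimination.
Variable X : h_structure.
Local Open Scope arr_scope.
Local Notation C := (arr X).
Local Notation τ := (@atau X).
Local Notation conn := (conn X).
Local Notation R := (R X).

Definition up (s : seq (nat * nat)) (v : seq bool) :=
  all (fun x => nth false v x.1 ==> nth false v x.2) s.

Lemma wf_cat n s t : wf n (s ++ t) = wf n s && wf n t.
Proof. exact: all_cat. Qed.

Lemma up_cat s t v : up (s ++ t) v = up s v && up t v.
Proof. exact: all_cat. Qed.

Lemma R_step n s i k l : wf n s -> i < n -> R n s ∘ conn n i k = R n s ->
  (k, l) \in s -> R n s ∘ conn n i l = R n s.
Proof.
move=> ws li ik kls; have /andP[/= lk ll] := allP ws _ kls.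
have kl := R_mem X ws kls.
have [<-|nil] := eqVneq i l; first by rewrite conn_refl acomp_idr.
have [->//|nik] := eqVneq i k.
have [<-//|nkl] := eqVneq k l.
have /(_ X) e := @conn_trans _ n i k l.
rewrite /= !inE !negb_or nil nik nkl li lk ll in e.
have := e isT isT; rewrite !RE => e'.
rewrite -[in LHS]kl -[in LHS]ik -?acompA.
by rewrite -e' acompA ik kl.
Qed.

(** Completeness for constraints: [v] below is the set of wires provably above
    [i], and transitivity makes it an up-set of [s]. *)
Lemma R_complete n s i j : wf n s -> i < n -> j < n ->
  (forall v, size v = n -> up s v -> nth false v i -> nth false v j) ->
  R n s ∘ conn n i j = R n s.
Proof.
move=> ws li lj sij.
pose v := mkseq (fun k => `[< R n s ∘ conn n i k = R n s >]) n.
have vE k : k < n -> nth false v k = `[< R n s ∘ conn n i k = R n s >].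
  by move=> lk; rewrite nth_mkseq.
suff : nth false v j by rewrite vE // => /asboolP.
apply: sij; first by rewrite size_mkseq.
  apply/allP => -[k l] kls /=; have /andP[/= lk ll] := allP ws _ kls.
  rewrite !vE //; apply/implyP => /asboolP ik; apply/asboolP.
  exact: R_step ik kls.
by rewrite vE //; apply/asboolP; rewrite conn_refl acomp_idr.
Qed.

Lemma R_entail n s t : wf n s -> wf n t ->
  (forall v, size v = n -> up s v -> up t v) -> R n s ∘ R n t = R n s.
Proof.
move=> ws; elim: t => [|[i j] t IH]; first by rewrite R_nil acomp_idr.
move=> /andP[/= /andP[li lj] wt] st.
rewrite R_cons acompA R_complete //; first by apply: IH => // v sv /(st v sv)/andP[].
by move=> v sv /(st v sv)/andP[/= /implyP].
Qed.

Lemma R_eq_up n s t : wf n s -> wf n t ->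
  (forall v, size v = n -> up s v = up t v) -> R n s = R n t.
Proof.
move=> ws wt st.
by rewrite -(R_entail ws wt) => [|v sv]; rewrite ?st // R_comm // R_entail // => v sv; rewrite st.
Qed.

(** Two existential quantifiers commute, since forgetting two wires does not
    depend on their order. *)
Lemma Ex_swap n (f : C n.+2 n.+2) : Ex (Ex (τ n ∘ f ∘ τ n)) = Ex (Ex f).
Proof.
rewrite /Ex -?acompA (rw2 (atau_u _ _)) (rw2 (aeps_tau _ _)).
by rewrite -au_nat (rw2 (aeps_nat _)) -?acompA.
Qed.

Lemma Ex_swapR n s : Ex (Ex (R n.+2 (map (map_pair swap01) s))) = Ex (Ex (R n.+2 s)).
Proof.
rewrite -[LHS]Ex_swap; congr (Ex (Ex _)).
have wt := realizes_tau X n.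
rewrite acompA (R_perm _ wt) -acompA atau_inv acomp_idr -map_comp map_id_in //.
by move=> [[|[|i]] [|[|j]]].
Qed.

(** Substitution of wire [b] for the head wire. *)
Definition contr b k := if k is k'.+1 then k' else b.

(** The one-point rule: under the identification of the head wire with [b], the
    substituted system has the same up-sets, and no longer names the head wire. *)
Lemma Ex_contr n s b : wf n.+1 s -> b < n ->
  Ex (R n.+1 (EQ 0 b.+1 ++ s)) = R n (map (map_pair (contr b)) s).
Proof.
move=> ws lb.
have ws' : wf n (map (map_pair (contr b)) s).
  rewrite /wf all_map; apply: sub_all ws => -[[|i] [|j]] /=;
    by rewrite ?lb /= ?ltnS ?andbT.
have wsh : wf n.+1 (sh (map (map_pair (contr b)) s)) by rewrite /wf all_map.
rewrite (@R_eq_up _ _ (EQ 0 b.+1 ++ sh (map (map_pair (contr b)) s))).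
- by rewrite R_cat -M_R Ex_r Ex_EQ // acomp_idl.
- by rewrite wf_cat /= ws !ltnS lb.
- by rewrite wf_cat /= wsh !ltnS lb.
move=> v _; rewrite !up_cat; have [E|//] := boolP (up (EQ 0 b.+1) v) => /=.
rewrite /up !all_map; apply: eq_all => -[i j] /=.
have vk k : nth false v (contr b k).+1 = nth false v k.
  by case: k => [|k] //=; move: E; rewrite /= andbT; case: nth; case: nth.
by rewrite !vk.
Qed.

Definition orient (d : bool) (x : nat * nat) := if d then (x.2, x.1) else x.
Definition below B := [seq (b.+1, 0) | b <- B].
Definition above A := [seq (0, a.+1) | a <- A].
Definition prod B A := [seq (b, a) | b <- B, a <- A] : seq (nat * nat).
Definition ltall n B := all (fun k => k < n) B.

(** Eliminating a wire between [B] and [A] leaves [B] below [A]; [d] reverses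
    the direction of all constraints. *)
Definition eliminates d n B A :=
  Ex (R n.+1 (map (orient d) (below B ++ above A))) = R n (map (orient d) (prod B A)).

Definition impl d p q := if d then q ==> p else p ==> q.

Lemma up_orient d s v :
  up (map (orient d) s) v = all (fun x => impl d (nth false v x.1) (nth false v x.2)) s.
Proof. by rewrite /up all_map; apply: eq_all => -[i j]; case: d. Qed.

Lemma all_prod p B A :
  all p (prod B A) = all (fun b => all (fun a => p (b, a)) A) B.
Proof. by elim: B => //= b B IH; rewrite all_cat IH all_map. Qed.

Lemma wf_orient d n s : wf n (map (orient d) s) = wf n s.
Proof. by rewrite /wf all_map; apply: eq_all => -[i j]; case: d => //=; rewrite andbC. Qed.

Lemma wf_prod n B A : ltall n B -> ltall n A -> wf n (prod B A).
Proof.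
move=> lB lA; rewrite /wf all_prod; apply: sub_all lB => b lb.
by apply: sub_all lA => a /= ->; rewrite lb.
Qed.

Lemma wf_below n B : wf n.+1 (below B) = ltall n B.
Proof. by rewrite /wf all_map; apply: eq_all => b /=; rewrite andbT. Qed.

Lemma wf_above n A : wf n.+1 (above A) = ltall n A.
Proof. by rewrite /wf all_map; apply: eq_all. Qed.

Lemma eliminates_ext d n B B' A A' : ltall n B -> ltall n A -> B =i B' -> A =i A' ->
  eliminates d n B A -> eliminates d n B' A'.
Proof.
move=> lB lA BB AA.
have lB' : ltall n B' by rewrite /ltall -(eq_all_r BB).
have lA' : ltall n A' by rewrite /ltall -(eq_all_r AA).
rewrite /eliminates => e.
rewrite (@R_eq_up n _ (map (orient d) (prod B A))) -?e ?wf_orient ?wf_prod //.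
  congr Ex; apply: R_eq_up; rewrite ?wf_orient ?wf_cat ?wf_below ?wf_above ?lB ?lA ?lB' ?lA' // => v _.
  by rewrite !up_orient !all_cat !all_map (eq_all_r BB) (eq_all_r AA).
move=> v _; rewrite !up_orient !all_prod (eq_all_r BB).
by apply: eq_all => b; rewrite (eq_all_r AA).
Qed.

Lemma eliminates_flip d n B A : ltall n B -> ltall n A ->
  eliminates d n B A -> eliminates (~~ d) n A B.
Proof.
move=> lB lA; rewrite /eliminates => e.
rewrite (@R_eq_up n _ (map (orient d) (prod B A))) -?e ?wf_orient ?wf_prod //.
  congr Ex; apply: R_eq_up; rewrite ?wf_orient ?wf_cat ?wf_below ?wf_above ?lB ?lA // => v _.
  by rewrite !up_orient !all_cat !all_map andbC; case: d {e}.
move=> v _; rewrite !up_orient !all_prod.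
apply/allP/allP => h x xB; apply/allP => y yA; move: (allP (h y yA) x xB); by case: d {e h}.
Qed.

Lemma map_pair_orient d p s : map (map_pair p) (map (orient d) s) = map (orient d) (map (map_pair p) s).
Proof. by rewrite -!map_comp; apply: eq_map => -[i j]; case: d. Qed.

Lemma map_prod p B A : map (map_pair p) (prod B A) = prod (map p B) (map p A).
Proof.
by rewrite /prod map_allpairs allpairs_mapl allpairs_mapr.
Qed.

(** Wires named by the bounds may be identified: take the head wire of the larger
    system, identify it with [b], and quantify over it. *)
Lemma eliminates_contr d n B A b : ltall n.+1 B -> ltall n.+1 A -> b < n ->
  eliminates d n.+1 B A -> eliminates d n (map (contr b) B) (map (contr b) A).
Proof.
move=> lB lA lb e; rewrite /eliminates.
pose s := map (orient d) (below B ++ above A).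
have ws : wf n.+2 (map (map_pair swap01) s).
  rewrite map_pair_orient wf_orient map_cat wf_cat -!map_comp /wf !all_map.
  apply/andP; split; [apply: sub_all lB|apply: sub_all lA] => -[|k] //=.
  by rewrite andbT.
have -> : map (orient d) (below (map (contr b) B) ++ above (map (contr b) A)) =
    map (map_pair (contr b.+1)) (map (map_pair swap01) s).
  rewrite !map_pair_orient !map_cat -!map_comp.
  by congr (_ ++ _); apply: eq_map => -[|k].
rewrite -Ex_contr ?ltnS // -Ex_swapR map_cat -map_comp.
have -> : map (map_pair swap01) (EQ 0 b.+2) = sh (EQ 0 b.+1) by [].
rewrite [map _ s]map_id_in; last by move=> [[|[|i]] [|[|j]]].
rewrite R_cat -M_R Ex_l e -R_cat Ex_contr //; first by rewrite map_pair_orient map_prod.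
by rewrite wf_orient wf_prod.
Qed.

(** The bialgebra equation needs four distinct wires; apply it to four fresh ones
    and identify these one by one with [b], [b'], [a] and [a']. *)
Lemma eliminates22 d n b b' a a' : b < n -> b' < n -> a < n -> a' < n ->
  eliminates d n [:: b; b'] [:: a; a'].
Proof.
have main i i' j j' : i < n -> i' < n -> j < n -> j' < n ->
    eliminates false n [:: i; i'] [:: j; j'].
  move=> li li' lj lj'.
  have c0 : eliminates false n.+4 [:: 0; 1] [:: 2; 3] by exact: Ex_bialg.
  have c1 := @eliminates_contr _ n.+3 [:: 0; 1] [:: 2; 3] i.+3 isT isT li c0.
  have c2 : eliminates false n.+2 [:: i.+2; i'.+2] [:: 0; 1].
    by apply: (@eliminates_contr _ n.+2 [:: i.+3; 0] [:: 1; 2] i'.+2); rewrite /= ?andbT.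
  have c3 : eliminates false n.+1 [:: i.+1; i'.+1] [:: j.+1; 0].
    by apply: (@eliminates_contr _ n.+1 _ _ j.+1 _ _ _ c2); rewrite /= ?ltnS ?li ?li'.
  by apply: (eliminates_contr _ _ lj' c3); rewrite /= ?ltnS ?li ?li' ?lj.
move=> lb lb' la la'; case: d; last exact: main.
by apply: (@eliminates_flip false); rewrite /= ?lb ?lb' ?la ?la' //; apply: main.
Qed.

Lemma eliminates20 d n b b' : b < n -> b' < n -> eliminates d n [:: b; b'] [::].
Proof.
move=> lb lb'.
have c0 : eliminates d n.+2 [:: 0; 1] [::].
  rewrite /eliminates; case: d; rewrite /= R_nil.
    exact: (@Ex_join X n.+2 0 1).
  exact: (@Ex_fork X n.+2 0 1).
have c1 := @eliminates_contr _ n.+1 [:: 0; 1] [::] b.+1 isT isT lb c0.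
by apply: (eliminates_contr _ _ lb' c1); rewrite /= ?ltnS ?lb.
Qed.

Lemma eliminates00 d n : eliminates d n [::] [::].
Proof. by rewrite /eliminates /= !R_nil /Ex acomp_idl aeps_u. Qed.

Lemma eliminates_small d n B A : ltall n B -> ltall n A -> size B <= 2 -> size A <= 2 ->
  eliminates d n B A.
Proof.
have dup (l : seq nat) : size l <= 2 -> l = [::] \/ exists x y, l =i [:: x; y].
  case: l => [|x [|y [|]]] // _; first by left.
    by right; exists x, x => z; rewrite !inE orbb.
  by right; exists x, y.
have two l x y : l =i [:: x; y] -> ltall n l -> x < n /\ y < n.
  by move=> e; rewrite /ltall (eq_all_r e) /= andbT => /andP[].
move=> lB lA /dup[->|[b [b' eB]]] /dup[->|[a [a' eA]]].
- exact: eliminates00.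
- have [la la'] := two _ _ _ eA lA.
  rewrite -[d]negbK; apply: (@eliminates_ext _ _ [::] _ [:: a; a']) => //=.
  + by rewrite la la'.
  + by apply: eliminates_flip; rewrite /= ?la ?la' //; apply: eliminates20.
- have [lb lb'] := two _ _ _ eB lB.
  apply: (@eliminates_ext _ _ [:: b; b'] _ [::]) => //=; first by rewrite lb lb'.
  exact: eliminates20.
- have [lb lb'] := two _ _ _ eB lB; have [la la'] := two _ _ _ eA lA.
  apply: (@eliminates_ext _ _ [:: b; b'] _ [:: a; a']); rewrite /= ?lb ?lb' ?la ?la' //.
  exact: eliminates22.
Qed.

Lemma ltall_S n B : ltall n.+1 (map succn B) = ltall n B.
Proof. by rewrite /ltall all_map; apply: eq_all. Qed.

Lemma wf_sh n s : wf n.+1 (sh s) = wf n s.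
Proof. by rewrite /wf all_map; apply: eq_all. Qed.

Lemma up_sh_orient d s v : up (sh (map (orient d) s)) v =
  all (fun x => impl d (nth false v x.1.+1) (nth false v x.2.+1)) s.
Proof. by rewrite /sh map_pair_orient up_orient all_map. Qed.

(** The bounds [A] of the eliminated wire [h] are replaced by a single fresh wire
    [g] with [h <= g <= A].  Quantifying over [h] first, which then has the two
    upper bounds [a] and [g], leaves [B <= g <= A] together with [b <= a] for all
    [b] in [B]. *)
Lemma eliminates_step d n B a A : ltall n B -> a < n -> ltall n A ->
  eliminates d n.+1 (map succn B) [:: a.+1; 0] -> eliminates d n.+1 [:: 0] (map succn A) ->
  eliminates d n B A -> eliminates d n B (a :: A).
Proof.
move=> lB la lA c1 c2 c3; rewrite /eliminates.
pose s := below B ++ [:: (0, a.+1)].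
have ws : wf n.+1 (map (orient d) s) by rewrite wf_orient wf_cat wf_below lB /= ltnS la.
have wp : wf n.+1 (prod [:: 0] (map succn A)) by rewrite wf_prod ?ltall_S.
have wA : wf n.+1 (above A) by rewrite wf_above.
have wB : wf n.+1 (below B) by rewrite wf_below.
have E : map (map_pair swap01) (sh (map (orient d) s) ++
      map (orient d) (below [:: 0] ++ above (map succn A))) =
    map (orient d) ((below (map succn B) ++ [:: (0, a.+2)]) ++ (0, 1) :: sh (above A)).
  rewrite /sh map_pair_orient -map_cat map_pair_orient /s !map_cat -!map_comp.
  by congr ((_ ++ _) ++ _); rewrite /= -map_comp.
rewrite (@R_eq_up _ _ (map (orient d) s ++ map (orient d) (prod [:: 0] (map succn A)))).
- rewrite R_cat -c2 -Ex_l M_R -R_cat -Ex_swapR E.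
  rewrite (@R_eq_up _ _ (map (orient d) (below (map succn B) ++ above [:: a.+1; 0]) ++
    sh (map (orient d) (above A)))).
  + rewrite R_cat -M_R Ex_r c1 -R_cat.
    rewrite (@R_eq_up _ _ (sh (map (orient d) (prod B [:: a])) ++
      map (orient d) (below B ++ above A))).
    * rewrite R_cat -M_R Ex_l c3 -R_cat.
      apply: R_eq_up; rewrite ?wf_cat ?wf_orient ?wf_prod //= ?la //.
      move=> v _; rewrite up_cat !up_orient !all_prod -all_predI.
      by apply: eq_all => b /=; rewrite andbT.
    * by rewrite wf_cat !wf_orient wA wf_prod ?ltall_S //= ltnS la.
    * by rewrite !wf_cat wf_sh !wf_orient wf_prod //= ?la // wf_cat wB wA.
    * move=> v _; rewrite !up_cat up_sh_orient !up_orient !all_prod all_cat !all_map.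
      rewrite andbA -all_predI; congr andb; apply: eq_all => b /=.
      by rewrite !andbT.
  + by rewrite wf_orient !wf_cat wf_below ltall_S lB /= !ltnS la wf_sh wA.
  + rewrite !wf_cat wf_sh !wf_orient wA wf_cat wf_below wf_above ltall_S lB.
    by rewrite /= !ltnS la.
  + move=> v _; rewrite up_cat up_sh_orient !up_orient !all_cat /= !all_map /= !andbT.
    by rewrite -!andbA.
- by rewrite wf_orient wf_cat wB wf_above /= la.
- by rewrite wf_cat ws wf_orient wp.
- move=> v _; rewrite up_cat !up_orient all_prod /s !all_cat /= !all_map !andbT.
  by rewrite -!andbA.
Qed.

Lemma eliminates_le2 d n B A : ltall n B -> ltall n A -> size B <= 2 -> eliminates d n B A.
Proof.
elim: {A}(size A) {-2}A (leqnn (size A)) n B => [|k IH] [|a A] // sA n B lB lA sB;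
  try exact: eliminates_small.
case/andP: lA => la lA; apply: eliminates_step => //.
- by apply: eliminates_small; rewrite ?ltall_S ?size_map //= ltnS la.
- by apply: IH; rewrite ?ltall_S ?size_map.
- exact: IH.
Qed.

(** The induction step applies to the lower bounds as well, after reversing the
    direction of all constraints. *)
Lemma eliminatesP d n B A : ltall n B -> ltall n A -> eliminates d n B A.
Proof.
elim: {B}(size B) {-2}B (leqnn (size B)) d n A => [|k IH] [|b B] // sB d n A lB lA;
  try exact: eliminates_le2.
case/andP: lB => lb lB; rewrite -[d]negbK.
apply: eliminates_flip; rewrite /= ?lb //; apply: eliminates_step => //.
- rewrite -[d]negbK; apply: eliminates_flip; rewrite ?ltall_S /= ?ltnS ?lb //.
  by apply: eliminates_le2; rewrite ?ltall_S /= ?ltnS ?lb.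
- rewrite -[d]negbK; apply: eliminates_flip; rewrite ?ltall_S //.
  by apply: IH; rewrite ?ltall_S ?size_map.
- by apply: eliminates_flip => //; apply: IH.
Qed.

(** Eliminating the head wire from any system of constraints leaves a system of
    constraints: the consequences not naming that wire. *)
Lemma Ex_R n s : wf n.+1 s -> exists t, wf n t /\ Ex (R n.+1 s) = R n t.
Proof.
move=> ws.
pose s2 i j := `[< forall v, size v = n.+1 -> up s v -> nth false v i -> nth false v j >].
pose B := [seq b <- iota 0 n | s2 b.+1 0].
pose A := [seq a <- iota 0 n | s2 0 a.+1].
pose t := [seq x <- prod (iota 0 n) (iota 0 n) | s2 x.1.+1 x.2.+1].
have lB : ltall n B by apply/allP => b; rewrite mem_filter mem_iota => /andP[_].
have lA : ltall n A by apply/allP => b; rewrite mem_filter mem_iota => /andP[_].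
have wt : wf n t.
  apply/allP => x; rewrite mem_filter => /andP[_ xp].
  by apply: (allP (@wf_prod n (iota 0 n) (iota 0 n) _ _) x xp); apply/allP => b; rewrite mem_iota.
exists (prod B A ++ t); rewrite wf_cat wf_prod // wt; split=> //.
have <- : R n.+1 ((below B ++ above A) ++ sh t) = R n.+1 s; last first.
  rewrite R_cat -M_R Ex_r [in RHS]R_cat; have := @eliminatesP false n B A lB lA.
  by rewrite /eliminates !map_id => ->.
apply: R_eq_up => //; first by rewrite !wf_cat wf_below wf_above lB lA /wf all_map.
move=> v sv; apply/idP/idP; last first.
  move=> vs; rewrite !up_cat /up !all_map -andbA; apply/and3P; split; apply/allP.
  - by move=> b; rewrite mem_filter => /andP[/asboolP h _] /=; apply/implyP; apply: h.
  - by move=> b; rewrite mem_filter => /andP[/asboolP h _] /=; apply/implyP; apply: h.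
  - by move=> b; rewrite mem_filter => /andP[/asboolP h _] /=; apply/implyP; apply: h.
rewrite !up_cat /up !all_map => /andP[/andP[hB hA] ht]; apply/allP => -[i j] ijs /=.
have /andP[/= li lj] := allP ws _ ijs.
have h : s2 i j by apply/asboolP => w _ /allP /(_ _ ijs) /= /implyP.
case: i j li lj h {ijs} => [|i] [|j] /= li lj h; first exact: implybb.
- by apply: (allP hA j); rewrite mem_filter h mem_iota.
- by apply: (allP hB i); rewrite mem_filter h mem_iota.
- by apply: (allP ht (i, j)); rewrite mem_filter h allpairs_f // mem_iota.
Qed.

End Elimination.

(** * States and bending *)

Section States.
Variable X : h_structure.
Local Open Scope arr_scope.
Local Notation C := (arr X).
Local Notation M := aM.
Local Notation u := (@au X).
Local Notation ε := (@aeps X).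
Local Notation τ := (@atau X).
Local Notation conn := (conn X).
Local Notation R := (R X).

Fixpoint U n : C 0 n := if n is n'.+1 then u n' ∘ U n' else aid.

(** Generation by arrows which act on systems of constraints in an evident way.
    [M u] and [M ε] are not generators: they are [τ ∘ u] and [ε ∘ τ]. *)
Inductive generated_by_conn : forall n m, C n m -> Prop :=
| gen_id n : generated_by_conn (@aid X n)
| gen_comp n m k (g : C m k) (f : C n m) :
    generated_by_conn g -> generated_by_conn f -> generated_by_conn (g ∘ f)
| gen_u n : generated_by_conn (u n)
| gen_e n : generated_by_conn (ε n)
| gen_perm n (f : C n n) p : realizes f p -> generated_by_conn f
| gen_conn n i j : i < n -> j < n -> generated_by_conn (conn n i j).

Lemma gen_M n m (f : C n m) : generated_by_conn f -> generated_by_conn (M f).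
Proof.
elim=> {n m f} [n|n m k g f _ IHg _ IHf|n|n|n f p w|n i j li lj].
- by rewrite aM_id; apply: gen_id.
- by rewrite aM_comp; apply: gen_comp.
- rewrite -atau_u; apply: gen_comp; last exact: gen_u.
  exact: gen_perm (realizes_tau X n).
- rewrite -aeps_tau; apply: gen_comp; first exact: gen_e.
  exact: gen_perm (realizes_tau X n).
- exact: gen_perm (realizes_M w).
- exact: (@gen_conn n.+1 i.+1 j.+1).
Qed.

Lemma U_perm n (f : C n n) p : realizes f p -> f ∘ U n = U n.
Proof.
elim=> {n f p} [n|n f g p q _ IHf _ IHg|n|n f p _ IH]; rewrite ?acomp_idl //.
- by rewrite -acompA IHg.
- by rewrite /= (rw2 (atau_u _ _)) (rw2 (esym (au_nat _))) -?acompA.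
- by rewrite /= (rw2 (esym (au_nat _))) -acompA IH.
Qed.

(** Generators relabel, extend or enlarge the system, except [ε], which eliminates
    its head wire ([Ex_R]). *)
Lemma gen_state n m (f : C n m) s : generated_by_conn f -> wf n s ->
  exists t, wf m t /\ f ∘ R n s ∘ U n = R m t ∘ U m.
Proof.
move=> w; elim: w s => {n m f} [n|n m k g f _ IHg _ IHf|n|n|n f p w|n i j li lj] s ws.
- by exists s; rewrite acomp_idl.
- have [t [wt e]] := IHf _ ws; have [t' [wt' e']] := IHg _ wt.
  by exists t'; rewrite -acompA e e'.
- exists (sh s); rewrite wf_sh; split=> //=.
  by rewrite -M_R (rw2 (au_nat _)) -?acompA.
- have [t [wt e]] := Ex_R X ws; exists t; split=> //.
  by rewrite -e /Ex /= -?acompA.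
- exists (map (map_pair p) s); split.
    by rewrite /wf all_map; apply: sub_all ws => x /=; rewrite !(realizes_lt w).
  by rewrite (rw2 (R_perm _ w)) -acompA (U_perm w).
- by exists ((i, j) :: s); rewrite R_cons /= li lj -acompA.
Qed.

(** One wire is bent from the source to the target with [cup] and back with
    [cap], so arrows are determined by the states [0 -> n]. *)
Definition cup n : C n n.+2 := R n.+2 (EQ 0 1) ∘ u n.+1 ∘ u n.
Definition cap n : C n.+2 n := ε n ∘ ε n.+1 ∘ R n.+2 (EQ 0 1).

Lemma cap_nat n m (f : C n m) : cap m ∘ M (M f) = f ∘ cap n.
Proof.
have E : R m.+2 (EQ 0 1) ∘ M (M f) = M (M f) ∘ R n.+2 (EQ 0 1).
  rewrite !R_cons !R_nil !acomp_idr /=.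
  by rewrite -[LHS]acompA K_nat (rw2 (aH_nat f)) -[LHS]acompA.
rewrite /cap -?acompA E.
by rewrite (rw2 (aeps_nat _)) -?acompA (rw2 (aeps_nat _)) -?acompA.
Qed.

(** Straightening leaves three identified wires crossed by a permutation, which
    the identification absorbs; two of them can then be eliminated. *)
Lemma snake n : cap n.+1 ∘ M (cup n) = aid.
Proof.
rewrite /cap /cup !aM_comp M_R -!atau_u -?acompA (rw2 (au_nat _)) -?acompA.
have E : R n.+3 (EQ 0 1) ∘ R n.+3 (sh (EQ 0 1)) ∘ τ n.+1 ∘ M (τ n) =
    R n.+3 (EQ 0 1) ∘ R n.+3 (sh (EQ 0 1)).
  rewrite (rw2 (R_comm _ _ _)) // -?acompA (rw2 (EQ_tau _ _)) -M_R.
  by rewrite M_R (rw2 (R_comm _ _ _)) // -?acompA -M_R -aM_comp EQ_tau.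
have := congr1 (fun f => ε n.+1 ∘ ε n.+2 ∘ f ∘ u n.+2 ∘ u n.+1) E.
rewrite -?acompA => ->.
transitivity (Ex (Ex (R n.+3 (EQ 0 1) ∘ M (R n.+2 (EQ 0 1))))).
  by rewrite /Ex M_R -?acompA.
by rewrite Ex_r Ex_EQ // acomp_idl Ex_EQ.
Qed.

Definition bend n m (f : C n.+1 m) : C n m.+1 := M f ∘ cup n.
Definition unbend n m (g : C n m.+1) : C n.+1 m := cap m ∘ M g.

Lemma bendK n m (f : C n.+1 m) : unbend (bend f) = f.
Proof. by rewrite /unbend /bend aM_comp (rw2 (cap_nat _)) -acompA snake acomp_idr. Qed.

End States.

(** * Up-set semantics *)

Definition bit n m (v w : seq bool) (x : 'I_n + 'I_m) :=
  match x with inl i => nth false v i | inr j => nth false w j end.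

Definition band (v w : seq bool) := [seq x.1 && x.2 | x <- zip v w].
Definition bor (v w : seq bool) := [seq x.1 || x.2 | x <- zip v w].

Lemma size_band v w : size v = size w -> size (band v w) = size v.
Proof. by move=> e; rewrite size_map size_zip e minnn. Qed.

Lemma size_bor v w : size v = size w -> size (bor v w) = size v.
Proof. by move=> e; rewrite size_map size_zip e minnn. Qed.

Lemma nth_band v w i : size v = size w ->
  nth false (band v w) i = nth false v i && nth false w i.
Proof.
by elim: v w i => [|a v IH] [|b w] [|i] //= [e]; rewrite ?IH ?nth_nil.
Qed.

Lemma nth_bor v w i : size v = size w ->
  nth false (bor v w) i = nth false v i || nth false w i.
Proof.
by elim: v w i => [|a v IH] [|b w] [|i] //= [e]; rewrite ?IH ?nth_nil.
Qed.

(** Sublattices of the powerset of [n + m] that contain both bounds. *)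
Record lattice n m (D : seq bool -> seq bool -> Prop) : Prop := Lattice {
  lat_size : forall v w, D v w -> size v = n /\ size w = m;
  lat1 : D (nseq n true) (nseq m true);
  lat0 : D (nseq n false) (nseq m false);
  latI : forall v w v' w', D v w -> D v' w' -> D (band v v') (band w w');
  latU : forall v w v' w', D v w -> D v' w' -> D (bor v v') (bor w w') }.

Definition denP n m (P : split_preorder n m) (v w : seq bool) : Prop :=
  [/\ size v = n, size w = m &
      upset P [set i : 'I_n | nth false v i] [set i : 'I_m | nth false w i]].

Lemma msum_bit n m v w (x : 'I_n + 'I_m) :
  msum [set i : 'I_n | nth false v i] [set i : 'I_m | nth false w i] x = bit v w x.
Proof. by case: x => i /=; rewrite inE. Qed.

Lemma bit_inj n m v w v' w' : size v = n -> size w = m -> size v' = n ->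
  size w' = m -> (forall x : 'I_n + 'I_m, bit v w x = bit v' w' x) -> v = v' /\ w = w'.
Proof.
move=> sv sw sv' sw' e; split.
  apply: (@eq_from_nth _ false); first by rewrite sv.
  by rewrite sv => i li; apply: (e (inl (Ordinal li))).
apply: (@eq_from_nth _ false); first by rewrite sw.
by rewrite sw => i li; apply: (e (inr (Ordinal li))).
Qed.

Section Birkhoff.
Variables (n m : nat) (D : seq bool -> seq bool -> Prop).
Hypothesis latD : lattice n m D.
Implicit Types x y : 'I_n + 'I_m.

Lemma bitI v w v' w' x : D v w -> D v' w' ->
  bit (band v v') (band w w') x = bit v w x && bit v' w' x.
Proof.
move=> /(lat_size latD)[sv sw] /(lat_size latD)[sv' sw'].
by case: x => i /=; rewrite nth_band ?sv ?sw.
Qed.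

Lemma bitU v w v' w' x : D v w -> D v' w' ->
  bit (bor v v') (bor w w') x = bit v w x || bit v' w' x.
Proof.
move=> /(lat_size latD)[sv sw] /(lat_size latD)[sv' sw'].
by case: x => i /=; rewrite nth_bor ?sv ?sw.
Qed.

Lemma bit1 x : bit (nseq n true) (nseq m true) x.
Proof. by case: x => i /=; rewrite nth_nseq ltn_ord. Qed.

Lemma bit0 x : bit (nseq n false) (nseq m false) x = false.
Proof. by case: x => i /=; rewrite nth_nseq ltn_ord. Qed.

(** If the points of [l] can be separated one by one from [x] by members of [D],
    then the meet of these members separates them all. *)
Lemma meets x (l : seq ('I_n + 'I_m)) :
  (forall y, y \in l -> exists v w, [/\ D v w, bit v w x & ~~ bit v w y]) ->
  exists v w, [/\ D v w, bit v w x & forall y, y \in l -> ~~ bit v w y].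
Proof.
elim: l => [_|y l IH h].
  by exists (nseq n true), (nseq m true); split; rewrite ?bit1 //; apply: (lat1 latD).
have [|v [w [Dvw vx vl]]] := IH; first by move=> z zl; apply: h; rewrite inE zl orbT.
have [v' [w' [Dvw' vx' vy]]] := h y (mem_head _ _).
exists (band v v'), (band w w'); split; first exact: (latI latD).
  by rewrite bitI // vx.
move=> z; rewrite inE bitI // negb_and => /orP[/eqP->|/vl->//].
by rewrite vy orbT.
Qed.

Lemma joins v w (l : seq ('I_n + 'I_m)) :
  (forall x, x \in l -> exists v' w', [/\ D v' w', bit v' w' x &
     forall y, bit v' w' y -> bit v w y]) ->
  exists v' w', [/\ D v' w', forall x, x \in l -> bit v' w' x &
     forall y, bit v' w' y -> bit v w y].
Proof.
elim: l => [_|x l IH h].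
  by exists (nseq n false), (nseq m false); split=> // [|y]; rewrite ?bit0 //; apply: (lat0 latD).
have [|v1 [w1 [D1 l1 s1]]] := IH; first by move=> z zl; apply: h; rewrite inE zl orbT.
have [v2 [w2 [D2 l2 s2]]] := h x (mem_head _ _).
exists (bor v1 v2), (bor w1 w2); split; first exact: (latU latD).
  by move=> z; rewrite inE bitU // => /orP[/eqP->|/l1->//]; rewrite l2 orbT.
by move=> z; rewrite bitU // => /orP[/s1|/s2].
Qed.

(** The preorder is [x <= y] when each member of [D] containing [x] contains [y].
    An up-set is the join, over its elements [x], of a member of [D] that contains
    [x] and none of the points outside the up-set. *)
Lemma birkhoff : exists P : split_preorder n m, forall v w, denP P v w <-> D v w.
Proof.
pose r x y := `[< forall v w, D v w -> bit v w x -> bit v w y >].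
pose P := [set p | r p.1 p.2].
have preP : is_preorder P.
  apply/is_preorderP; split=> [x|x y z]; rewrite !inE; first by apply/asboolP.
  move=> /asboolP xy /asboolP yz; apply/asboolP => v w Dvw /(xy _ _ Dvw).
  exact: yz.
exists (exist _ P preP) => v w; split=> [[sv sw vw]|Dvw]; last first.
  have [sv sw] := lat_size latD Dvw; split=> // x y; rewrite inE => /asboolP xy.
  by rewrite !msum_bit; apply: xy.
have [|v' [w' [D' l' s']]] := @joins v w [seq x <- enum {: 'I_n + 'I_m} | bit v w x].
  move=> x; rewrite mem_filter => /andP[vx _].
  have [|v' [w' [D' x' y']]] := @meets x [seq y <- enum {: 'I_n + 'I_m} | ~~ bit v w y].
    move=> y; rewrite mem_filter => /andP[vy _].
    apply: contrapT => h; move/negP: vy; apply.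
    rewrite -msum_bit; apply: (vw x); last by rewrite msum_bit.
    rewrite inE; apply/asboolP => v' w' D' x'; apply/negPn/negP => y'.
    by apply: h; exists v', w'.
  exists v', w'; split=> // y; apply: contraLR => vy.
  by apply: y'; rewrite mem_filter vy mem_enum.
have [sv' sw'] := lat_size latD D'.
have [|-> -> //] := @bit_inj n m v w v' w' sv sw sv' sw'.
move=> x; apply/idP/idP => [vx|/s' //].
by apply: l'; rewrite mem_filter vx mem_enum.
Qed.

End Birkhoff.

Definition bits n (S : {set 'I_n}) := [seq i \in S | i <- enum 'I_n].

Lemma bitsK n (S : {set 'I_n}) : [set i : 'I_n | nth false (bits S) i] = S.
Proof.
apply/setP => i; rewrite inE (nth_map i) ?nth_ord_enum //.
by rewrite size_enum_ord.
Qed.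

Lemma size_bits n (S : {set 'I_n}) : size (bits S) = n.
Proof. by rewrite size_map size_enum_ord. Qed.

Lemma denP_inj n m (P Q : split_preorder n m) :
  (forall v w, denP P v w <-> denP Q v w) -> P = Q.
Proof.
move=> PQ; apply: upset_inj => S T.
have E (P' : split_preorder n m) : denP P' (bits S) (bits T) <-> upset P' S T.
  by rewrite /denP !bitsK !size_bits; split=> [[]|].
by rewrite -!E.
Qed.

Lemma denP_id n v w : denP (spl_id n) v w <-> v = w /\ size v = n.
Proof.
split=> [[sv sw /upset_id e]|[<- sv]]; last by split=> //; apply/upset_id.
split=> //; apply: (@eq_from_nth _ false); first by rewrite sv.
rewrite sv => i li; by have /setP/(_ (Ordinal li)) := e; rewrite !inE.
Qed.

Lemma denP_comp n m k (Q : split_preorder m k) (P : split_preorder n m) v w :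
  denP (spl_comp Q P) v w <-> exists z, denP P v z /\ denP Q z w.
Proof.
split=> [[sv sw /upset_comp[T [PT QT]]]|[z [[sv sz Pz] [_ sw Qz]]]].
  by exists (bits T); rewrite /denP bitsK size_bits.
by split=> //; apply/upset_comp; exists [set i : 'I_m | nth false z i].
Qed.

Lemma denP_lattice n m (P : split_preorder n m) : lattice n m (denP P).
Proof.
have key v w : denP P v w <-> [/\ size v = n, size w = m &
    forall x y, (x, y) \in val P -> bit v w x -> bit v w y].
  by split=> -[sv sw h]; split=> // x y /h; rewrite !msum_bit.
split=> [v w [] //|||v w v' w'|v w v' w'].
- by apply/key; rewrite !size_nseq; split=> // x y _ _; apply: bit1.
- by apply/key; rewrite !size_nseq; split=> // x y _; rewrite bit0.
- move=> /key[sv sw h] /key[sv' sw' h']; apply/key.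
  rewrite !size_band ?sv ?sw //; split=> // x y xy.
  by move: (h x y xy) (h' x y xy); case: x {xy} => ?; case: y => ? /=;
    rewrite !nth_band ?sv ?sw // => h1 h2 /andP[/h1-> /h2].
- move=> /key[sv sw h] /key[sv' sw' h']; apply/key.
  rewrite !size_bor ?sv ?sw //; split=> // x y xy.
  by move: (h x y xy) (h' x y xy); case: x {xy} => ?; case: y => ? /=;
    rewrite !nth_bor ?sv ?sw // => h1 h2 /orP[/h1->|/h2->] //; rewrite orbT.
Qed.

(** * Isomorphisms of categories *)

Lemma functor_eq (C D : category) (o : obj C -> obj D)
  (h h' : forall a b : obj C, hom a b -> hom (o a) (o b)) i c i' c' :
  (forall a b f, h a b f = h' a b f) ->
  @Functor C D o h i c = @Functor C D o h' i' c'.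
Proof.
move=> e; have E : h = h'.
  apply: functional_extensionality_dep => a; apply: functional_extensionality_dep => b.
  exact: funext.
by subst h'; congr Functor; apply: Prop_irrelevance.
Qed.

Lemma isomorphic_sym C D : isomorphic C D -> isomorphic D C.
Proof. by move=> [F [G [GF FG]]]; exists G, F. Qed.

Lemma functor_comp_cancel C D E (F : functor C D) (F' : functor D E)
  (G : functor D C) (G' : functor E D) :
  functor_comp G' F' = functor_id D -> functor_comp G F = functor_id C ->
  functor_comp (functor_comp G G') (functor_comp F' F) = functor_id C.
Proof.
move=> e <-; transitivity (functor_comp G (functor_comp (functor_comp G' F') F)).
  exact: functor_eq.
by rewrite e; congr functor_comp; case: F => *; apply: functor_eq.
Qed.

Lemma isomorphic_trans C D E : isomorphic C D -> isomorphic D E -> isomorphic C E.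
Proof.
move=> [F [G [GF FG]]] [F' [G' [GF' FG']]].
by exists (functor_comp F' F), (functor_comp G G'); split; apply: functor_comp_cancel.
Qed.

(** * The isomorphism with split preorders *)

Local Open Scope arr_scope.

(** The relations are the intended families of up-sets.  The induction principle
    [generated] excludes structures with further arrows, for which the relations
    would not determine the arrow. *)
Record upset_semantics (X : h_structure) := UpsetSemantics {
  den : forall n m, arr X n m -> seq bool -> seq bool -> Prop;
  den_id : forall n v w, den (@aid X n) v w <-> v = w /\ size v = n;
  den_comp : forall n m k (g : arr X m k) (f : arr X n m) v w,
    den (g ∘ f) v w <-> exists z, den f v z /\ den g z w;
  den_M : forall n m (f : arr X n m) v w, den (aM f) v w <->
    exists b v' w', [/\ v = b :: v', w = b :: w' & den f v' w'];
  den_u : forall n v w, den (@au X n) v w <-> size v = n /\ exists b, w = b :: v;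
  den_e : forall n v w, den (@aeps X n) v w <-> size w = n /\ exists b, v = b :: w;
  den_t : forall n v w, den (@atau X n) v w <->
    exists a b z, [/\ size z = n, v = [:: a, b & z] & w = [:: b, a & z]];
  den_H : forall n v w, den (@aH X n) v w <->
    exists a b z, [/\ size z = n, v = [:: a, b & z], w = v & a ==> b];
  generated : forall Q : (forall n m, arr X n m -> Prop),
    (forall n, Q n n aid) ->
    (forall n m k g f, Q m k g -> Q n m f -> Q n k (g ∘ f)) ->
    (forall n m f, Q n m f -> Q n.+1 m.+1 (aM f)) ->
    (forall n, Q _ _ (@au X n)) -> (forall n, Q _ _ (@aeps X n)) ->
    (forall n, Q _ _ (@atau X n)) -> (forall n, Q _ _ (@aH X n)) ->
    forall n m f, Q n m f }.

Local Close Scope arr_scope.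

Section Iso.
Variables (X : h_structure) (S : upset_semantics X).
Local Open Scope arr_scope.
Local Notation C := (arr X).
Local Notation conn := (conn X).
Local Notation R := (R X).
Local Notation den := (den S).
Local Notation U := (U X).

Lemma all_generated n m (f : C n m) : generated_by_conn f.
Proof.
apply: (generated S) f => {n m}.
- exact: gen_id.
- exact: gen_comp.
- exact: gen_M.
- exact: gen_u.
- exact: gen_e.
- by move=> n; apply: gen_perm (realizes_tau X n).
- by move=> n; apply: (@gen_conn X n.+2 0 1).
Qed.

Lemma state_form n (f : C 0 n) : exists s, wf n s /\ f = R n s ∘ U n.
Proof.
have [s [ws e]] := @gen_state X 0 n f [::] (all_generated f) isT.
by exists s; rewrite -e R_nil !acomp_idr.
Qed.

Lemma den_hd_conn (Y : forall n, C n.+2 n.+2) d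
  (denY : forall n v w, den (Y n) v w <->
    exists a b z, [/\ size z = n, v = [:: a, b & z], w = v & impl d a b]) n j v w :
  j < n -> den (hd_conn Y n j) v w <->
  [/\ v = w, size v = n.+1 & impl d (nth false v 0) (nth false v j.+1)].
Proof.
elim: n j v w => [|n IH] [|j] v w //= lj.
  rewrite denY; split=> [[a [b [z [sz -> -> ab]]]]|[<- ]]; first by rewrite /= sz.
  by case: v => [|a [|b z]] //= [sz] ab; exists a, b, z.
split.
  move=> /den_comp[x [/den_comp[y [/den_t[a [b [z [sz -> ->]]]] yx]] xw]].
  move: yx xw => /den_M[c [v' [w' [[<- <-] -> /(IH _ _ _ lj)[<- /= sz' ab]]]]].
  by move=> /den_t[a' [b' [z' [_ [<- <- <-] ->]]]]; rewrite sz.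
case=> <-; case: v => [|a [|b z]] //= [sz] ab.
apply/den_comp; exists [:: b, a & z]; split.
  apply/den_comp; exists [:: b, a & z]; split; first by apply/den_t; exists a, b, z.
  by apply/den_M; exists b, (a :: z), (a :: z); split=> //; apply/IH; rewrite //= sz.
by apply/den_t; exists b, a, z.
Qed.

Lemma den_K n v w : den (K X n) v w <->
  exists a b z, [/\ size z = n, v = [:: a, b & z], w = v & impl true a b].
Proof.
split.
  move=> /den_comp[x [/den_comp[y [/den_t[a [b [z [sz -> ->]]]] /den_H]]]].
  move=> [a' [b' [z' [_ [<- <- _] -> ba]]]] /den_t[c [c' [z'' [_ [<- <- <-] ->]]]].
  by exists a, b, z.
case=> a [b [z [sz -> -> ba]]].
apply/den_comp; exists [:: b, a & z]; split; last by apply/den_t; exists b, a, z.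
apply/den_comp; exists [:: b, a & z]; split; first by apply/den_t; exists a, b, z.
by apply/den_H; exists b, a, z.
Qed.

Lemma den_conn n i j v w : i < n -> j < n -> den (conn n i j) v w <->
  [/\ v = w, size v = n & nth false v i ==> nth false v j].
Proof.
elim: n i j v w => [|n IH] [|i] [|j] v w // li lj.
- by rewrite /= den_id implybb; split=> [[]|[]].
- exact: (@den_hd_conn _ false (@den_H X S)).
- exact: (@den_hd_conn (K X) true den_K).
rewrite /= den_M; split.
  by move=> [b [v' [w' [-> -> /IH]]]] /(_ li lj)[<- <-].
by case=> <-; case: v => //= b v [sv] h; exists b, v, v; split=> //; apply/IH.
Qed.

Lemma den_R n s v w : wf n s -> den (R n s) v w <-> [/\ v = w, size v = n & up s v].
Proof.
elim: s v w => [v w _|[i j] s IH v w] /=; first by rewrite R_nil den_id; split=> [[]|[]].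
move=> /andP[/andP[li lj] ws]; rewrite R_cons den_comp; split.
  by move=> [z [/(IH _ _ ws)[<- _ sv] /(den_conn _ _ li lj)[<- -> ->]]].
move=> [<- sv /andP[ij us]]; exists v; split; first by apply/IH.
by apply/den_conn.
Qed.

Lemma den_U n v w : den (U n) v w <-> v = [::] /\ size w = n.
Proof.
elim: n v w => [|n IH] v w /=.
  by rewrite den_id; split=> [[<- /size0nil->]|[-> /size0nil->]].
rewrite den_comp; split=> [[z [/IH[-> sz] /den_u[_ [b ->]]]]|[->]]; first by rewrite /= sz.
by case: w => //= b w [sw]; exists w; split; [apply/IH|apply/den_u; split=> //; exists b].
Qed.

Lemma den_state n s v w : wf n s ->
  den (R n s ∘ U n) v w <-> [/\ v = [::], size w = n & up s w].
Proof.
move=> ws; rewrite den_comp; split=> [[z [/den_U[-> _] /(den_R _ _ ws)[<-]]]|[-> sw us]] //.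
by exists w; split; [apply/den_U|apply/den_R].
Qed.

(** States are systems of constraints, determined by their up-sets; a source wire
    is removed by bending it to the target. *)
Lemma den_faithful n m (f g : C n m) : (forall v w, den f v w <-> den g v w) -> f = g.
Proof.
elim: n m f g => [|n IH] m f g fg.
  have [s [ws ef]] := state_form f; have [t [wt eg]] := state_form g.
  rewrite ef eg; congr (_ ∘ _); apply: R_eq_up => // v sv.
  apply/idP/idP => h.
    by have /(den_state _ _ wt)[] : den (R m t ∘ U m) [::] v by rewrite -eg -fg ef; apply/den_state.
  by have /(den_state _ _ ws)[] : den (R m s ∘ U m) [::] v by rewrite -ef fg eg; apply/den_state.
rewrite -[f]bendK -[g]bendK; congr unbend; apply: IH => v w.
rewrite /bend !den_comp; split=> -[z [cz /den_M[b [v' [w' [ez ew fw]]]]]]; exists z; split=> //;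
  by apply/den_M; exists b, v', w'; split=> //; apply/fg.
Qed.

Lemma den_cap m v w : den (cap X m) v w <-> size w = m /\ exists b, v = [:: b, b & w].
Proof.
rewrite /cap; split.
  move=> /den_comp[x [/den_comp[y [/(@den_R m.+2 (EQ 0 1) _ _ isT)[<- sv uv]]]]].
  move=> /den_e[_ [b ev]] /den_e[sw [b' ex]].
  split=> //; exists b; move: uv; rewrite ev ex /up /= andbT.
  by case: b {ev}; case: b' {ex}.
move=> [sw [b ->]]; apply/den_comp; exists (b :: w); split; last by apply/den_e; split=> //; exists b.
apply/den_comp; exists [:: b, b & w]; split; last by apply/den_e; rewrite /= sw; split=> //; exists b.
by apply/den_R; rewrite //= sw implybb.
Qed.

Lemma den_lattice n m (f : C n m) : lattice n m (den f).
Proof.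
apply: (generated S (Q := fun n m f => lattice n m (den f))) f => {n m}.
- move=> n; split=> [v w|||v w v' w'|v w v' w']; rewrite !den_id.
  + by move=> [<-].
  + by rewrite size_nseq.
  + by rewrite size_nseq.
  + by move=> [<- sv] [<- sv']; rewrite size_band ?sv.
  + by move=> [<- sv] [<- sv']; rewrite size_bor ?sv.
- move=> n m k g f latg latf; split=> [v w|||v w v' w'|v w v' w']; rewrite !den_comp.
  + by move=> [z [/(lat_size latf)[-> _] /(lat_size latg)[_ ->]]].
  + by exists (nseq m true); split; [apply: (lat1 latf)|apply: (lat1 latg)].
  + by exists (nseq m false); split; [apply: (lat0 latf)|apply: (lat0 latg)].
  + move=> [z [vz zw]] [z' [vz' zw']]; exists (band z z').
    by split; [apply: (latI latf)|apply: (latI latg)].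
  + move=> [z [vz zw]] [z' [vz' zw']]; exists (bor z z').
    by split; [apply: (latU latf)|apply: (latU latg)].
- move=> n m f latf; split=> [v w|||v w v' w'|v w v' w']; rewrite !den_M.
  + by move=> [b [x [y [-> -> /(lat_size latf)[<- <-]]]]].
  + by exists true, (nseq n true), (nseq m true); split=> //; apply: (lat1 latf).
  + by exists false, (nseq n false), (nseq m false); split=> //; apply: (lat0 latf).
  + move=> [b [x [y [-> -> xy]]]] [b' [x' [y' [-> -> xy']]]].
    by exists (b && b'), (band x x'), (band y y'); split=> //; apply: (latI latf).
  + move=> [b [x [y [-> -> xy]]]] [b' [x' [y' [-> -> xy']]]].
    by exists (b || b'), (bor x x'), (bor y y'); split=> //; apply: (latU latf).
- move=> n; split=> [v w|||v w v' w'|v w v' w']; rewrite !den_u.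
  + by move=> [<- [b ->]].
  + by rewrite size_nseq; split=> //; exists true.
  + by rewrite size_nseq; split=> //; exists false.
  + move=> [sv [b ->]] [sv' [b' ->]]; rewrite size_band ?sv //; split=> //.
    by exists (b && b').
  + move=> [sv [b ->]] [sv' [b' ->]]; rewrite size_bor ?sv //; split=> //.
    by exists (b || b').
- move=> n; split=> [v w|||v w v' w'|v w v' w']; rewrite !den_e.
  + by move=> [<- [b ->]].
  + by rewrite size_nseq; split=> //; exists true.
  + by rewrite size_nseq; split=> //; exists false.
  + move=> [sv [b ->]] [sv' [b' ->]]; rewrite size_band ?sv //; split=> //.
    by exists (b && b').
  + move=> [sv [b ->]] [sv' [b' ->]]; rewrite size_bor ?sv //; split=> //.
    by exists (b || b').
- move=> n; split=> [v w|||v w v' w'|v w v' w']; rewrite !den_t.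
  + by move=> [a [b [z [<- -> ->]]]].
  + by exists true, true, (nseq n true); rewrite size_nseq.
  + by exists false, false, (nseq n false); rewrite size_nseq.
  + move=> [a [b [z [sz -> ->]]]] [a' [b' [z' [sz' -> ->]]]].
    by exists (a && a'), (b && b'), (band z z'); rewrite size_band ?sz.
  + move=> [a [b [z [sz -> ->]]]] [a' [b' [z' [sz' -> ->]]]].
    by exists (a || a'), (b || b'), (bor z z'); rewrite size_bor ?sz.
- move=> n; split=> [v w|||v w v' w'|v w v' w']; rewrite !den_H.
  + by move=> [a [b [z [<- -> ->]]]].
  + by exists true, true, (nseq n true); rewrite size_nseq.
  + by exists false, false, (nseq n false); rewrite size_nseq.
  + move=> [a [b [z [sz -> -> ab]]]] [a' [b' [z' [sz' -> -> ab']]]].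
    exists (a && a'), (b && b'), (band z z'); rewrite size_band ?sz //; split=> //.
    by move: ab ab'; case: a => //=; case: a' => //= -> ->.
  + move=> [a [b [z [sz -> -> ab]]]] [a' [b' [z' [sz' -> -> ab']]]].
    exists (a || a'), (b || b'), (bor z z'); rewrite size_bor ?sz //; split=> //.
    by move: ab ab'; case: a => /= [->|_] //; case: a' => //= ->; rewrite orbT.
Qed.

(** Without source wires, [D] is the family of up-sets of a preorder, which is
    realized as a system of constraints on fresh wires. *)
Lemma den_full n m D : lattice n m D ->
  exists f : C n m, forall v w, den f v w <-> D v w.
Proof.
elim: n m D => [|n IH] m D latD.
  have [P PD] := birkhoff latD.
  pose s := [seq (val x.1, val x.2) | x <- enum {: 'I_m * 'I_m} & (inr x.1, inr x.2) \in val P].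
  have ws : wf m s.
    by rewrite /wf all_map; apply/allP => -[i j] _ /=; rewrite !ltn_ord.
  exists (R m s ∘ U m) => v w; rewrite den_state // -PD; split.
    move=> [-> sw us]; split=> // -[[]//|i] [[]//|j] ij /=; rewrite !inE => wi.
    have /allP/(_ (val i, val j)) := us; rewrite /= wi; apply.
    by apply/mapP; exists (i, j); rewrite // mem_filter ij mem_enum.
  move=> [/size0nil-> sw uw]; split=> //; apply/allP => x /mapP[[i j]].
  rewrite mem_filter => /andP[ij _] -> /=; apply/implyP => wi.
  by have := uw _ _ ij; rewrite /= !inE; apply.
pose D' v w := exists b w', w = b :: w' /\ D (b :: v) w'.
have [|g gD] := IH m.+1 D'.
  split=> [v w [b [w' [-> /(lat_size latD)[[sv] sw]]]]|||v w v' w'|v w v' w'].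
  - by rewrite /= sw.
  - by exists true, (nseq m true); split=> //; apply: (lat1 latD).
  - by exists false, (nseq m false); split=> //; apply: (lat0 latD).
  - move=> [b [x [-> D1]]] [c [y [-> D2]]]; exists (b && c), (band x y); split=> //.
    exact: (latI latD D1 D2).
  - move=> [b [x [-> D1]]] [c [y [-> D2]]]; exists (b || c), (bor x y); split=> //.
    exact: (latU latD D1 D2).
exists (unbend g) => v w; rewrite /unbend den_comp; split.
  by move=> [z [/den_M[b [v' [w' [-> -> /gD[c [w'' [-> Dw]]]]]]] /den_cap[_ [b' [<- <- <-]]]]].
move=> Dvw; have [sv sw] := lat_size latD Dvw; case: v sv Dvw => // b v [sv] Dvw.
exists [:: b, b & w]; split; last by apply/den_cap; split=> //; exists b.
by apply/den_M; exists b, v, (b :: w); split=> //; apply/gD; exists b, w.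
Qed.

Definition cat_of : category :=
  @Category nat (arr X) (@aid X) (@acomp X) (@acomp_idl X) (@acomp_idr X)
    (fun a b c d h g f => @acompA X a b c d h g f).

Definition sem n m (f : C n m) : split_preorder n m :=
  projT1 (cid (birkhoff (den_lattice f))).

Lemma semP n m (f : C n m) v w : denP (sem f) v w <-> den f v w.
Proof. by rewrite /sem; case: cid. Qed.

Lemma sem_id n : sem (@aid X n) = spl_id n.
Proof. by apply: denP_inj => v w; rewrite semP denP_id den_id. Qed.

Lemma sem_comp n m k (g : C m k) (f : C n m) : sem (g ∘ f) = spl_comp (sem g) (sem f).
Proof.
apply: denP_inj => v w; rewrite semP denP_comp den_comp.
by split=> -[z [fz gz]]; exists z; split; apply/semP.
Qed.

Lemma sem_inj n m (f g : C n m) : sem f = sem g -> f = g.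
Proof. by move=> e; apply: den_faithful => v w; rewrite -!semP e. Qed.

Lemma sem_surj n m (P : split_preorder n m) : exists f : C n m, sem f = P.
Proof.
have [f fP] := den_full (denP_lattice P).
by exists f; apply: denP_inj => v w; rewrite semP fP.
Qed.

Definition arr_of n m (P : split_preorder n m) : C n m := projT1 (cid (sem_surj P)).

Lemma arr_ofK n m (P : split_preorder n m) : sem (arr_of P) = P.
Proof. by rewrite /arr_of; case: cid. Qed.

Lemma semK n m (f : C n m) : arr_of (sem f) = f.
Proof. by apply: sem_inj; rewrite arr_ofK. Qed.

Lemma arr_of_id n : arr_of (spl_id n) = aid.
Proof. by apply: sem_inj; rewrite arr_ofK sem_id. Qed.

Lemma arr_of_comp n m k (Q : split_preorder m k) (P : split_preorder n m) :
  arr_of (spl_comp Q P) = arr_of Q ∘ arr_of P.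
Proof. by apply: sem_inj; rewrite sem_comp !arr_ofK. Qed.

Definition sem_functor : functor cat_of SplPre :=
  @Functor cat_of SplPre id sem sem_id sem_comp.

Definition arr_functor : functor SplPre cat_of :=
  @Functor SplPre cat_of id arr_of arr_of_id arr_of_comp.

Lemma iso_SplPre : isomorphic cat_of SplPre.
Proof.
exists sem_functor, arr_functor; split; apply: functor_eq => n m f /=.
  exact: semK.
exact: arr_ofK.
Qed.

End Iso.

(** * The syntactic category on H *)

(** Possible outputs of a generator for a given input; interpreting terms by
    functions into lists makes the equations without variables checkable by
    computation. *)
Definition gen_run (x : h_gen) (a : seq bool) : seq (seq bool) :=
  match x, a with
  | HOne, _ => [:: [::]]
  | HU, _ => [:: [:: true]; [:: false]]
  | HEps, _ => [:: [::]]
  | HTau, [:: b; c] => [:: [:: c; b]]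
  | HH, [:: b; c] => if b ==> c then [:: a] else [::]
  | _, _ => [::]
  end.

Definition step (p : h_prim) (s : seq bool) : seq (seq bool) :=
  let: HPrim n x m := p in
  [seq take n s ++ o ++ drop (n + h_gen_src x) s
  | o <- gen_run x (take (h_gen_src x) (drop n s))].

Arguments step : simpl never.

Fixpoint run (f : h_raw) (s : seq bool) : seq (seq bool) :=
  if f is p :: f' then flatten [seq step p t | t <- run f' s] else [:: s].

Lemma run_cons p f s t : reflect (exists2 z, z \in run f s & t \in step p z)
  (t \in run (p :: f) s).
Proof. exact: flatten_mapP. Qed.

Lemma run1 p s : run [:: p] s = step p s.
Proof. by rewrite /= cats0. Qed.

Lemma run_cat g f s t : reflect (exists2 z, z \in run f s & t \in run g z)
  (t \in run (g ++ f) s).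
Proof.
elim: g t => [|p g IH] t.
  apply: (iffP idP) => [h|[z zf]]; last by rewrite inE => /eqP->.
  by exists t; rewrite // inE.
rewrite cat_cons; apply: (iffP (run_cons _ _ _ _)).
  by move=> [y /IH[z zf yg] ty]; exists z => //; apply/run_cons; exists y.
by move=> [z zf /run_cons[y yg ty]]; exists y => //; apply/IH; exists z.
Qed.

Lemma stepP n x m p a q t : size p = n -> size a = h_gen_src x ->
  reflect (exists2 o, o \in gen_run x a & t = p ++ o ++ q) (t \in step (HPrim n x m) (p ++ a ++ q)).
Proof.
move=> sp sa; rewrite /step (@take_size_cat _ n p) // (@drop_size_cat _ n p) //.
rewrite (@take_size_cat _ _ a) // catA drop_size_cat ?size_cat ?sp ?sa //.
exact: mapP.
Qed.

Lemma gen_run_size x a o : size a = h_gen_src x -> o \in gen_run x a -> size o = h_gen_tgt x.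
Proof.
case: x; case: a => [|b [|c [|]]] //=; rewrite ?inE => _.
- by move/eqP->.
- by case/orP=> /eqP->.
- by move/eqP->.
- by move/eqP->.
- by case: ifP => // _; rewrite inE => /eqP->.
Qed.

Lemma split3 (s : seq bool) a b c : size s = a + b + c ->
  exists s1 s2 s3, [/\ s = s1 ++ s2 ++ s3, size s1 = a, size s2 = b & size s3 = c].
Proof.
move=> ss; exists (take a s), (take b (drop a s)), (drop b (drop a s)).
by rewrite !cat_take_drop !size_take_min !size_drop ss -addnA addKn !(minn_idPl _) ?leq_addr // addKn.
Qed.

Lemma step_size p s t : size s = h_src p -> t \in step p s -> size t = h_tgt p.
Proof.
case: p => n x m /= /split3[s1 [s2 [s3 [-> e1 e2 e3]]]] /(stepP _ _ _ e1 e2)[o ox ->].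
by rewrite !size_cat e1 e3 (gen_run_size e2 ox) addnA.
Qed.

Lemma wf_consP n m p f : h_wf n m (p :: f) ->
  h_tgt p = m /\ ((f = [::] /\ h_src p = n) \/ h_wf n (h_src p) f).
Proof.
case: f => [|p' f] /=; first by case/andP=> /eqP-> /eqP->; split; auto.
by case/andP=> /eqP->; auto.
Qed.

Lemma run_size n m f s t : h_wf n m f -> size s = n -> t \in run f s -> size t = m.
Proof.
elim: f m t => [//|p f IH] m t /wf_consP[<- wf] ss /run_cons[z zf tz].
case: wf zf => [[-> sp]|wf zf].
  by rewrite inE => /eqP ez; apply: step_size tz; rewrite ez ss.
by apply: step_size tz; apply: IH zf.
Qed.

(** Added wires are carried along unchanged. *)
Lemma run_whisker a b n m f p s q t : h_wf n m f -> size p = a -> size s = n ->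
  reflect (exists2 t', t' \in run f s & t = p ++ t' ++ q)
    (t \in run (h_whisker a f b) (p ++ s ++ q)).
Proof.
move=> wf sp ss.
have stepW k x l z t' : size z = k + h_gen_src x + l ->
    (t' \in step (HPrim (a + k) x (l + b)) (p ++ z ++ q)) <->
    (exists2 y, y \in step (HPrim k x l) z & t' = p ++ y ++ q).
  move=> /split3[s1 [s2 [s3 [-> e1 e2 e3]]]].
  have -> : p ++ (s1 ++ s2 ++ s3) ++ q = (p ++ s1) ++ s2 ++ (s3 ++ q) by rewrite -!catA.
  have e1' : size (p ++ s1) = a + k by rewrite size_cat sp e1.
  split=> [/(stepP _ _ _ e1' e2)[o ox ->]|[y /(stepP _ _ _ e1 e2)[o ox ->] ->]].
    by exists (s1 ++ o ++ s3); rewrite -?catA //; apply/stepP => //; exists o.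
  by apply/stepP => //; exists o; rewrite -?catA.
elim: f m t wf => [//|[k x l] f IH] m t /wf_consP[_ wf].
apply: (iffP (run_cons _ _ _ _)).
  case: wf => [[-> /= sk]|wf].
    move=> [z]; rewrite inE => /eqP-> /stepW[|y ys ->]; first by rewrite ss.
    by exists y => //; rewrite cats0.
  move=> [z /(IH _ _ wf)[y yf ->] /stepW[|w ws ->]]; first exact: (run_size wf ss yf).
  by exists w => //; apply/run_cons; exists y.
case: wf => [[-> /= sk]|wf].
  move=> [t']; rewrite cats0 => ts ->; exists (p ++ s ++ q); first by rewrite inE.
  by apply/stepW; rewrite ?ss //; exists t'.
move=> [t' /run_cons[z zf tz] ->]; exists (p ++ z ++ q).
  by apply/(IH _ _ wf); exists z.
by apply/stepW; [exact: (run_size wf ss zf)|exists t'].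
Qed.

Lemma run_one n m s : run (h_one n m) s = [:: s].
Proof. by rewrite run1 /step /= addn0 cat_take_drop. Qed.

Fixpoint bit_words n : seq (seq bool) :=
  if n is n'.+1 then [seq true :: w | w <- bit_words n'] ++ [seq false :: w | w <- bit_words n']
  else [:: [::]].

Lemma mem_bit_words s : s \in bit_words (size s).
Proof.
elim: s => [|b s IH] //=; rewrite mem_cat.
by case: b; rewrite map_f ?orbT.
Qed.

Definition same_run n f g :=
  all (fun s => all [in run g s] (run f s) && all [in run f s] (run g s)) (bit_words n).

Lemma same_runP n f g s : same_run n f g -> size s = n -> run f s =i run g s.
Proof.
move=> /allP h ss t; have := h s; rewrite -ss mem_bit_words => /(_ isT)/andP[fg gf].
by apply/idP/idP => [/(allP fg)|/(allP gf)].
Qed.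

Lemma wf_src n m f : h_wf n m f -> n = if f is p :: f' then h_src (last p f') else n.
Proof.
case: f => // p f; elim: f p m => [|p' f IH] p m /wf_consP[_ [[//]|]] //.
exact: IH.
Qed.

(** The axioms on a fixed number of wires are checked on all inputs.  In an
    interchange the two generators act on separate segments of the input. *)
Lemma ax_run n m f g s : h_ax f g -> h_wf n m f -> size s = n -> run f s =i run g s.
Proof.
case=> {f g}; try (by move=> /wf_src E ss; rewrite E in ss; apply: same_runP ss; vm_compute).
- move=> n' m' f _ _ _ t; apply/run_cat/idP => [[z]|tf]; rewrite ?run_one ?inE.
    by move=> /eqP->.
  by exists s; rewrite ?run_one ?inE.
- move=> n' m' f _ _ _ t; apply/run_cat/idP => [[z zf]|tf]; rewrite ?run_one ?inE.
    by move=> /eqP->.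
  by exists t; rewrite ?run_one ?inE.
move=> xi theta r _ _ p q k l /wf_src es ss t; rewrite /= in es.
have [|a [w [c [-> sa sw sc]]]] := @split3 s p r k; first by rewrite ss es add0n addnA.
have first_gen x i z y b : size y = h_gen_src x ->
    (z \in step (HPrim 0 x i) (y ++ b)) <-> exists2 o, o \in gen_run x y & z = o ++ b.
  by move=> sy; split=> [/(@stepP 0 x i [::] y b z erefl sy)|/(@stepP 0 x i [::] y b z erefl sy)].
have last_gen N x z y b : size b = N -> size y = h_gen_src x ->
    (z \in step (HPrim N x 0) (b ++ y)) <-> exists2 o, o \in gen_run x y & z = b ++ o.
  move=> sb sy; have E := @stepP N x 0 b y [::] z sb sy; rewrite cats0 in E.
  by split=> [/E[o oy ->]|[o oy ez]]; [exists o; rewrite ?cats0|apply/E; exists o; rewrite ?cats0].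
rewrite /h_comp; apply/run_cat/run_cat => -[z]; rewrite run1.
  move=> /(first_gen _ _ _ _ _ sa)[o oa ->]; rewrite run1 (catA o w c).
  have so : size (o ++ w) = q + r by rewrite size_cat sw (gen_run_size sa oa).
  move=> /(last_gen _ _ _ _ _ so sc)[o' oc ->].
  exists (a ++ w ++ o'); rewrite run1.
    rewrite (catA a w c); apply/last_gen; rewrite ?size_cat ?sa ?sw //.
    by exists o'; rewrite ?catA.
  by apply/first_gen => //; exists o; rewrite ?catA.
have sa' : size (a ++ w) = p + r by rewrite size_cat sa sw.
rewrite (catA a w c) => /(last_gen _ _ _ _ _ sa' sc)[o' oc ->].
rewrite -catA run1 => /(first_gen _ _ _ _ _ sa)[o oa ->].
exists (o ++ w ++ c); rewrite run1; first by rewrite -catA; apply/first_gen => //; exists o.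
rewrite (catA o w c); apply/last_gen => //; first by rewrite size_cat sw (gen_run_size sa oa).
by exists o'; rewrite ?catA.
Qed.

Lemma h_eq_wf n m f g : h_eq n m f g -> h_wf n m f /\ h_wf n m g.
Proof.
elim=> {n m f g} //.
- by move=> n m f g _ [].
- by move=> n m f g h _ [wf _] _ [].
- move=> a b n m f g _ [wf wg].
  have ww n' m' h : h_wf n' m' h -> h_wf (a + n' + b) (a + m' + b) (h_whisker a h b).
    elim: h m' => [//|[k x l] h IH] m' /wf_consP[<- [[-> <-]|wh]] /=.
      by rewrite -!addnA !eqxx.
    have := IH _ wh; rewrite /h_whisker /=.
    case: h {IH} wh => //= p h _ wh.
    by rewrite /h_src /h_tgt !addnA in wh *; rewrite eqxx -!addnA in wh *.
  by split; apply: ww.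
- by move=> n m k f g f' g' _ [wf wg] _ [wf' wg']; split; apply: h_wf_comp; eassumption.
Qed.

Lemma h_eq_run n m f g s : h_eq n m f g -> size s = n -> run f s =i run g s.
Proof.
move=> e; elim: e s => {n m f g}.
- by move=> n m f g /ax_run h wf _ s; apply: h wf.
- by [].
- by move=> n m f g _ IH s ss t; rewrite IH.
- by move=> n m f g h _ IH _ IH' s ss t; rewrite IH // IH'.
- move=> a b n m f g e IH s ss t; have [wf wg] := h_eq_wf e.
  have [p [z [q [-> sp sz sq]]]] := split3 ss.
  by apply/(run_whisker _ _ _ wf sp sz)/(run_whisker _ _ _ wg sp sz) => -[t' tf ->];
    exists t'; rewrite // ?IH // -?IH.
- move=> n m k f g f' g' e IH e' IH' s ss t; have [wf wg] := h_eq_wf e.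
  rewrite /h_comp; apply/run_cat/run_cat => -[z zf tz]; exists z.
  + by rewrite -IH.
  + by rewrite -IH' // (run_size wf ss zf).
  + by rewrite IH.
  + by rewrite IH' // (run_size wg ss zf).
Qed.

(** [h_whisker 1 f 0], without the addition of zero to the right subscripts. *)
Definition shift (f : h_raw) : h_raw :=
  [seq (let: HPrim k x l := p in HPrim k.+1 x l) | p <- f].

Lemma shiftE f : shift f = h_whisker 1 f 0.
Proof. by apply: eq_map => -[k x l]; rewrite addn0. Qed.

Lemma wf_shift n m f : h_wf n m f -> h_wf n.+1 m.+1 (shift f).
Proof.
elim: f m => [//|[k x l] f IH] m /wf_consP[<- [[-> <-]|wf]] /=.
  by rewrite /h_src /h_tgt !addSn !eqxx.
have := IH _ wf; case: f {IH} wf => //= p f _ wf.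
by rewrite /h_src /h_tgt /= !addSn eqxx.
Qed.

Lemma h_eq_shift n m f g : h_eq n m f g -> h_eq n.+1 m.+1 (shift f) (shift g).
Proof. by move=> /(h_eq_whisker 1 0); rewrite !addn0 -!shiftE. Qed.

Definition hM_term n m (f : h_term n m) : h_term n.+1 m.+1 :=
  exist _ (shift (val f)) (wf_shift (valP f)).

Definition hM n m (f : h_hom n m) : h_hom n.+1 m.+1 := h_class (hM_term (h_repr f)).

Lemma hM_class n m (f : h_term n m) : hM (h_class f) = h_class (hM_term f).
Proof. by apply/h_classP/h_eq_shift; apply/h_classP/h_reprK. Qed.

Lemma wf_prim x n : h_wf (h_gen_src x + n) (h_gen_tgt x + n) [:: HPrim 0 x n].
Proof. by rewrite /= !add0n !eqxx. Qed.

Definition h_arr x n : h_hom (h_gen_src x + n) (h_gen_tgt x + n) :=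
  h_class (exist _ [:: HPrim 0 x n] (wf_prim x n)).

Lemma h_eq_class n m (f g : h_term n m) :
  h_eq n m (val f) (val g) -> h_class f = h_class g.
Proof. by move=> e; apply/h_classP. Qed.

(** By iteration of the axiom that identifies the two identities of 1. *)
Lemma h_one_split k l : h_eq (k + l) (k + l) (h_one k l) (h_one 0 (k + l)).
Proof.
elim: k => [|k IH]; first by apply: h_eq_refl; rewrite /= !addn0 eqxx.
apply: (@h_eq_trans _ _ _ (h_one 1 (k + l))); first exact: (h_eq_shift IH).
have e : h_eq 1 1 (h_one 1 0) (h_one 0 1) by apply: h_eq_ax h_ax_one _ _.
exact: (h_eq_whisker 0 (k + l) e).
Qed.

Lemma h_eq_idl n m f : h_wf n m f -> h_eq n m (h_comp (h_one 0 m) f) f.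
Proof.
by move=> wf; apply: h_eq_ax; [exact: h_ax_idl wf|apply: h_wf_comp wf; exact: h_wf_one|].
Qed.

Lemma h_eq_idr n m f : h_wf n m f -> h_eq n m (h_comp f (h_one 0 n)) f.
Proof.
by move=> wf; apply: h_eq_ax; [exact: h_ax_idr wf|apply: h_wf_comp wf _; exact: h_wf_one|].
Qed.

Definition shiftn p (f : h_raw) : h_raw :=
  [seq (let: HPrim k x l := y in HPrim (p + k) x l) | y <- f].

Lemma wf_shiftn p n m f : h_wf n m f -> h_wf (p + n) (p + m) (shiftn p f).
Proof.
elim: p => [|p IH] wf; first by rewrite /shiftn map_id_in // => -[].
have := wf_shift (IH wf); rewrite /shift /shiftn -map_comp.
by congr (is_true (h_wf _ _ _)); apply: eq_map => -[].
Qed.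

(** Naturality of the generators: the interchange axiom extends from generators to
    all terms by induction on the number of factors. *)
Lemma h_eq_nat xi n m f : xi <> HOne -> h_wf n m f ->
  h_eq (h_gen_src xi + n) (h_gen_tgt xi + m)
    (h_comp [:: HPrim 0 xi m] (shiftn (h_gen_src xi) f))
    (h_comp (shiftn (h_gen_tgt xi) f) [:: HPrim 0 xi n]).
Proof.
set p := h_gen_src xi; set q := h_gen_tgt xi => xi1.
have one k x l : h_eq (p + (k + h_gen_src x + l)) (q + (k + h_gen_tgt x + l))
    ([:: HPrim 0 xi (k + h_gen_tgt x + l)] ++ [:: HPrim (p + k) x l])
    ([:: HPrim (q + k) x l] ++ [:: HPrim 0 xi (k + h_gen_src x + l)]).
  have [->|x1] : x = HOne \/ x <> HOne by case: x; [left|right..].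
    rewrite /= !addn0.
    have wx : h_wf (p + (k + l)) (q + (k + l)) [:: HPrim 0 xi (k + l)] by apply: wf_prim.
    have E r : h_eq (r + (k + l)) (r + (k + l)) [:: HPrim (r + k) HOne l] (h_one 0 (r + (k + l))).
      by have := h_one_split (r + k) l; rewrite -addnA.
    apply: (h_eq_trans (h_eq_comp (E p) (h_eq_refl wx))).
    apply: (h_eq_trans (h_eq_idr wx)); apply: h_eq_sym.
    apply: (h_eq_trans (h_eq_comp (h_eq_refl wx) (E q))).
    exact: h_eq_idl.
  have := @h_ax_interchange xi x k xi1 x1; rewrite -/p -/q => ax.
  have e : h_eq (p + (k + h_gen_src x)) (q + (k + h_gen_tgt x))
      [:: HPrim (q + k) x 0; HPrim 0 xi (k + h_gen_src x)]
      [:: HPrim 0 xi (k + h_gen_tgt x); HPrim (p + k) x 0].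
    by apply: h_eq_ax ax _ _; rewrite /= /h_src /h_tgt !addn0 !add0n -?addnA !eqxx.
  by have := h_eq_sym (h_eq_whisker 0 l e); rewrite /= !add0n -!addnA.
elim: f m => [//|[k x l] f IH] m /wf_consP[<- [[-> <-]|wf]]; first exact: one.
have e1 := h_eq_comp (h_eq_refl (wf_shiftn p wf)) (one k x l).
have wx : h_wf (h_src (HPrim k x l)) (h_tgt (HPrim k x l)) [:: HPrim k x l].
  by rewrite /= !eqxx.
have e2 := h_eq_comp (IH _ wf) (h_eq_refl (wf_shiftn q wx)).
exact: h_eq_trans e1 e2.
Qed.

Lemma shiftn0 f : shiftn 0 f = f.
Proof. by rewrite /shiftn map_id_in // => -[]. Qed.

Lemma shiftn2 f : shiftn 2 f = shift (shift f).
Proof. by rewrite /shift -map_comp; apply: eq_map => -[]. Qed.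

Lemma h_eq_at a b f g : h_ax f g -> h_wf a b f -> h_wf a b g ->
  forall n, h_eq (a + n) (b + n) (h_whisker 0 f n) (h_whisker 0 g n).
Proof. by move=> ax wf wg n; apply: (@h_eq_whisker 0 n a b); apply: h_eq_ax. Qed.

Notation hu := (h_arr HU).
Notation he := (h_arr HEps).
Notation ht := (h_arr HTau).
Notation hH := (h_arr HH).

Lemma hM_id n : hM (h_hom_id n) = h_hom_id n.+1.
Proof.
rewrite /h_hom_id hM_class; apply: h_eq_class.
exact: (@h_eq_at 1 1 _ _ h_ax_one isT isT n).
Qed.

Lemma hM_comp n m k (g : h_hom m k) (f : h_hom n m) :
  hM (h_hom_comp g f) = h_hom_comp (hM g) (hM f).
Proof.
rewrite -[g]h_reprK -[f]h_reprK h_class_comp !hM_class h_class_comp.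
by congr h_class; apply: val_inj; apply: map_cat.
Qed.

Lemma hu_nat n m (f : h_hom n m) : h_hom_comp (hu m) f = h_hom_comp (hM f) (hu n).
Proof.
rewrite -[f]h_reprK hM_class !h_class_comp; apply: h_eq_class.
have := @h_eq_nat HU n m _ _ (valP (h_repr f)); rewrite shiftn0; exact.
Qed.

Lemma he_nat n m (f : h_hom n m) : h_hom_comp (he m) (hM f) = h_hom_comp f (he n).
Proof.
rewrite -[f]h_reprK hM_class !h_class_comp; apply: h_eq_class.
have := @h_eq_nat HEps n m _ _ (valP (h_repr f)); rewrite shiftn0; exact.
Qed.

Lemma ht_nat n m (f : h_hom n m) :
  h_hom_comp (ht m) (hM (hM f)) = h_hom_comp (hM (hM f)) (ht n).
Proof.
rewrite -[f]h_reprK !hM_class !h_class_comp; apply: h_eq_class.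
have := @h_eq_nat HTau n m _ _ (valP (h_repr f)); rewrite shiftn2; exact.
Qed.

Lemma hH_nat n m (f : h_hom n m) :
  h_hom_comp (hH m) (hM (hM f)) = h_hom_comp (hM (hM f)) (hH n).
Proof.
rewrite -[f]h_reprK !hM_class !h_class_comp; apply: h_eq_class.
have := @h_eq_nat HH n m _ _ (valP (h_repr f)); rewrite shiftn2; exact.
Qed.

Lemma rep_comp n m k (g : h_hom m k) (f : h_hom n m) a b :
  g = h_class a -> f = h_class b -> h_hom_comp g f = h_class (h_comp_term a b).
Proof. by move=> -> ->; rewrite h_class_comp. Qed.

Lemma rep_M n m (f : h_hom n m) a : f = h_class a -> hM f = h_class (hM_term a).
Proof. by move=> ->; rewrite hM_class. Qed.

Lemma rep_eq n m (f g : h_hom n m) a b :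
  f = h_class a -> g = h_class b -> h_eq n m (val a) (val b) -> f = g.
Proof. by move=> -> -> /h_eq_class. Qed.

(* [h_rep] solves [f = h_class ?a] by computing a term for [f].  It descends along
   the syntax of [f], since rewriting with [h_class_comp] could unfold a composite
   to a class and choose representatives for its parts. *)
Ltac h_rep := lazymatch goal with
  | |- h_hom_comp _ _ = _ => eapply rep_comp; h_rep
  | |- hM _ = _ => eapply rep_M; h_rep
  | |- _ => reflexivity
  end.

Ltac h_axiom ax a b n :=
  eapply rep_eq; [h_rep | h_rep | exact (@h_eq_at a b _ _ ax isT isT n)].

Definition PFH_structure : h_structure.
Proof.
refine (@HStructure h_hom h_hom_id h_hom_comp hM hu he ht hH h_hom_idl h_hom_idr
  (fun n m k l h g f => h_hom_assoc h g f) hM_id hM_comp hu_nat he_nat ht_nat hH_nat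
  _ _ _ _ _ _ _ _ _ _ _ _ _ _ _ _) => n.
- h_axiom h_ax_tau_tau 2 2 n.
- h_axiom h_ax_yang_baxter 3 3 n.
- h_axiom h_ax_tau_u 1 2 n.
- h_axiom h_ax_eps_tau 2 1 n.
- h_axiom h_ax_H_H 2 2 n.
- h_axiom h_ax_tau_H 3 3 n.
- h_axiom h_ax_HtH_l 2 2 n.
- h_axiom h_ax_HtH_r 2 2 n.
- h_axiom h_ax_eps_HtH_u 1 1 n.
- h_axiom h_ax_H_comm 3 3 n.
- h_axiom h_ax_H_fork 3 3 n.
- h_axiom h_ax_H_join 3 3 n.
- h_axiom h_ax_eps_u 0 0 n.
- h_axiom h_ax_eps_u_fork 2 2 n.
- h_axiom h_ax_eps_u_join 2 2 n.
- h_axiom h_ax_bialgebra 4 4 n.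
Defined.

Definition h_den n m (f : h_hom n m) (v w : seq bool) : Prop :=
  size v = n /\ w \in run (val (h_repr f)) v.

Lemma h_den_class n m (f : h_term n m) v w :
  h_den (h_class f) v w <-> size v = n /\ w \in run (val f) v.
Proof.
have e : h_eq n m (val (h_repr (h_class f))) (val f) by apply/h_classP/h_reprK.
by split=> -[sv]; rewrite /h_den (h_eq_run e sv).
Qed.

Lemma h_den_id n v w : h_den (h_hom_id n) v w <-> v = w /\ size v = n.
Proof.
rewrite h_den_class [run _ _]run_one inE.
by split=> [[sv /eqP->]|[<- sv]].
Qed.

Lemma h_den_comp n m k (g : h_hom m k) (f : h_hom n m) v w :
  h_den (h_hom_comp g f) v w <-> exists z, h_den f v z /\ h_den g z w.
Proof.
rewrite h_den_class; split=> [[sv /run_cat[z zf zw]]|[z [[sv zf] [_ zw]]]].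
  by exists z; split=> //; split=> //; exact: (run_size (valP (h_repr f)) sv zf).
by split=> //; apply/run_cat; exists z.
Qed.

Lemma h_den_M n m (f : h_hom n m) v w : h_den (hM f) v w <->
  exists b v' w', [/\ v = b :: v', w = b :: w' & h_den f v' w'].
Proof.
rewrite h_den_class /= shiftE; split=> [[]|[b [v' [w' [-> -> [sv wf]]]]]].
  case: v => // b v [sv]; rewrite -[v]cats0 -[b :: _]/([:: b] ++ v ++ [::]).
  move=> /(@run_whisker 1 0 n m _ [:: b] v [::] _ (valP (h_repr f)) erefl sv)[w' wf ->].
  by exists b, v, w'; rewrite ?cats0.
split; first by rewrite /= sv.
rewrite -[v']cats0 -[b :: v' ++ _]/([:: b] ++ v' ++ [::]).
by apply/(@run_whisker 1 0 n m _ [:: b] v' [::] _ (valP (h_repr f)) erefl sv); exists w'; rewrite ?cats0.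
Qed.

Lemma h_den_arr x n v w : h_den (h_arr x n) v w <->
  exists a o z, [/\ size z = n, v = a ++ z, w = o ++ z, size a = h_gen_src x & o \in gen_run x a].
Proof.
rewrite h_den_class run1; split=> [[]|[a [o [z [sz -> -> sa ox]]]]].
  rewrite -[X in size _ = X]add0n addnA => /split3[p [a [z [-> sp sa sz]]]].
  by rewrite (size0nil sp) => /(@stepP _ _ _ [::] _ _ _ erefl sa)[o ox ->]; exists a, o, z.
by rewrite size_cat sa sz; split=> //; apply/(@stepP _ _ _ [::] _ _ _ erefl sa); exists o.
Qed.

Lemma h_den_u n v w : h_den (hu n) v w <-> size v = n /\ exists b, w = b :: v.
Proof.
rewrite h_den_arr; split=> [[a [o [z [<- -> -> sa]]]]|[sv [b ->]]].
  by case: a sa => // _; rewrite !inE => /orP[]/eqP->; split=> //; [exists true|exists false].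
by exists [::], [:: b], v; split=> //; case: b.
Qed.

Lemma h_den_e n v w : h_den (he n) v w <-> size w = n /\ exists b, v = b :: w.
Proof.
rewrite h_den_arr; split=> [[a [o [z [<- -> -> sa]]]]|[sv [b ->]]].
  by case: a sa => [|b []] // _; rewrite !inE => /eqP->; split=> //; exists b.
by exists [:: b], [::], w.
Qed.

Lemma h_den_t n v w : h_den (ht n) v w <->
  exists a b z, [/\ size z = n, v = [:: a, b & z] & w = [:: b, a & z]].
Proof.
rewrite h_den_arr; split=> [[c [o [z [<- -> -> sc]]]]|[a [b [z [sz -> ->]]]]].
  by case: c sc => [|a [|b []]] // _; rewrite !inE => /eqP->; exists a, b, z.
by exists [:: a; b], [:: b; a], z; rewrite /= inE.
Qed.

Lemma h_den_H n v w : h_den (hH n) v w <->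
  exists a b z, [/\ size z = n, v = [:: a, b & z], w = v & a ==> b].
Proof.
rewrite h_den_arr; split=> [[c [o [z [<- -> -> sc]]]]|[a [b [z [sz -> -> ab]]]]].
  by case: c sc => [|a [|b []]] //= _; case: ifP => // ab; rewrite inE => /eqP->; exists a, b, z.
by exists [:: a; b], [:: a; b], z; rewrite /= ab inE.
Qed.

Lemma h_generated (Q : forall n m, h_hom n m -> Prop) :
  (forall n, Q n n (h_hom_id n)) ->
  (forall n m k g f, Q m k g -> Q n m f -> Q n k (h_hom_comp g f)) ->
  (forall n m f, Q n m f -> Q n.+1 m.+1 (hM f)) ->
  (forall n, Q _ _ (hu n)) -> (forall n, Q _ _ (he n)) ->
  (forall n, Q _ _ (ht n)) -> (forall n, Q _ _ (hH n)) ->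
  forall n m f, Q n m f.
Proof.
move=> Qid Qcomp QM Qu Qe Qt QH n m f; rewrite -[f]h_reprK.
have prim k x l (wf : h_wf (k + h_gen_src x + l) (k + h_gen_tgt x + l) [:: HPrim k x l]) :
    Q _ _ (h_class (exist _ [:: HPrim k x l] wf)).
  elim: k wf => [|k IH] wf.
    case: x wf => wf.
    - by rewrite (bool_irrelevance wf (h_wf_one l)); apply: Qid.
    - by rewrite (bool_irrelevance wf (wf_prim HU l)); apply: Qu.
    - by rewrite (bool_irrelevance wf (wf_prim HEps l)); apply: Qe.
    - by rewrite (bool_irrelevance wf (wf_prim HTau l)); apply: Qt.
    - by rewrite (bool_irrelevance wf (wf_prim HH l)); apply: QH.
  have wf' : h_wf (k + h_gen_src x + l) (k + h_gen_tgt x + l) [:: HPrim k x l].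
    by rewrite /= !eqxx.
  have := QM _ _ _ (IH wf'); rewrite hM_class.
  by congr (Q _ _ (h_class _)); apply: val_inj.
case: (h_repr f) => t wf.
elim: t m wf {f} => [//|[k x l] t IH] m wf; have := wf => /wf_consP[em [[et en]|wt]].
  by subst; apply: prim.
subst m; have wp : h_wf (k + h_gen_src x + l) (k + h_gen_tgt x + l) [:: HPrim k x l].
  by rewrite /= !eqxx.
have := Qcomp _ _ _ _ _ (prim _ _ _ wp) (IH _ wt); rewrite h_class_comp.
by congr (Q _ _ (h_class _)); apply: val_inj.
Qed.

Definition PFH_semantics : upset_semantics PFH_structure :=
  @UpsetSemantics PFH_structure h_den h_den_id h_den_comp h_den_M h_den_u h_den_e h_den_t
    h_den_H h_generated.

Lemma PFH_SplPre : isomorphic PFH SplPre.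
Proof. exact: (iso_SplPre PFH_semantics). Qed.

(** * Preordering Frobenius monads *)

(** Preordering Frobenius monads on the objects [M^n 0].  The equation [fud] is the
    up-and-down equation with the transposed link written out. *)
Record frob_structure := FrobStructure {
  farr : nat -> nat -> Type;
  fid : forall n, farr n n;
  fcomp : forall n m k, farr m k -> farr n m -> farr n k;
  fM : forall n m, farr n m -> farr n.+1 m.+1;
  fnabla : forall n, farr n.+2 n.+1;
  fDelta : forall n, farr n.+1 n.+2;
  fu : forall n, farr n n.+1;
  feps : forall n, farr n.+1 n;
  ftau : forall n, farr n.+2 n.+2;
  fdown : forall n, farr n.+1 n.+1;
  fidl : forall n m (f : farr n m), fcomp (fid m) f = f;
  fidr : forall n m (f : farr n m), fcomp f (fid n) = f;
  fcompA : forall n m k l (h : farr k l) (g : farr m k) (f : farr n m),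
    fcomp h (fcomp g f) = fcomp (fcomp h g) f;
  fM_id : forall n, fM (fid n) = fid n.+1;
  fM_comp : forall n m k (g : farr m k) (f : farr n m), fM (fcomp g f) = fcomp (fM g) (fM f);
  fnabla_nat : forall n m (f : farr n m), fcomp (fnabla m) (fM (fM f)) = fcomp (fM f) (fnabla n);
  fDelta_nat : forall n m (f : farr n m), fcomp (fDelta m) (fM f) = fcomp (fM (fM f)) (fDelta n);
  fu_nat : forall n m (f : farr n m), fcomp (fu m) f = fcomp (fM f) (fu n);
  feps_nat : forall n m (f : farr n m), fcomp (feps m) (fM f) = fcomp f (feps n);
  ftau_nat : forall n m (f : farr n m), fcomp (ftau m) (fM (fM f)) = fcomp (fM (fM f)) (ftau n);
  fdown_nat : forall n m (f : farr n m), fcomp (fdown m) (fM f) = fcomp (fM f) (fdown n);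
  fNN : forall n, fcomp (fnabla n) (fnabla n.+1) = fcomp (fnabla n) (fM (fnabla n));
  fNu : forall n, fcomp (fnabla n) (fu n.+1) = fid n.+1;
  fNMu : forall n, fcomp (fnabla n) (fM (fu n)) = fid n.+1;
  fDD : forall n, fcomp (fDelta n.+1) (fDelta n) = fcomp (fM (fDelta n)) (fDelta n);
  feD : forall n, fcomp (feps n.+1) (fDelta n) = fid n.+1;
  fMeD : forall n, fcomp (fM (feps n)) (fDelta n) = fid n.+1;
  fF : forall n, fcomp (fDelta n) (fnabla n) = fcomp (fnabla n.+1) (fM (fDelta n));
  ftau_inv : forall n, fcomp (ftau n) (ftau n) = fid n.+2;
  fYB : forall n, fcomp (fM (ftau n)) (fcomp (ftau n.+1) (fM (ftau n))) =
    fcomp (ftau n.+1) (fcomp (fM (ftau n)) (ftau n.+1));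
  fNt : forall n, fcomp (fnabla n) (ftau n) = fnabla n;
  ftD : forall n, fcomp (ftau n) (fDelta n) = fDelta n;
  ftN : forall n, fcomp (ftau n) (fnabla n.+1) = fcomp (fM (fnabla n)) (fcomp (ftau n.+1) (fM (ftau n)));
  fDt : forall n, fcomp (fDelta n.+1) (ftau n) = fcomp (fM (ftau n)) (fcomp (ftau n.+1) (fM (fDelta n)));
  ftu : forall n, fcomp (ftau n) (fu n.+1) = fM (fu n);
  fet : forall n, fcomp (feps n.+1) (ftau n) = fM (feps n);
  feu : forall n, fcomp (feps n) (fu n) = fid n;
  fdd : forall n, fcomp (fdown n) (fdown n) = fdown n;
  ftd : forall n, fcomp (ftau n) (fdown n.+1) = fcomp (fM (fdown n)) (ftau n);
  fud : forall n, fcomp (fnabla n) (fcomp (fM (fdown n)) (fcomp (fM (feps n.+1)) (fcomp (fM (fnabla n.+1))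
    (fcomp (fM (fdown n.+2)) (fcomp (fDelta n.+2) (fcomp (fu n.+2) (fDelta n))))))) = fid n.+1;
  feN : forall n, fcomp (feps n) (fcomp (fnabla n) (fcomp (fM (fdown n)) (fdown n.+1))) =
    fcomp (feps n) (fM (feps n));
  fDu : forall n, fcomp (fM (fdown n)) (fcomp (fdown n.+1) (fcomp (fDelta n) (fu n))) =
    fcomp (fM (fu n)) (fu n);
  fbi : forall n, let ND n := fcomp (fnabla n) (fcomp (fM (fdown n)) (fdown n.+1)) in
    let DN n := fcomp (fM (fdown n)) (fcomp (fdown n.+1) (fDelta n)) in
    fcomp (DN n) (ND n) = fcomp (fM (ND n)) (fcomp (ND n.+2) (fcomp (fM (ftau n.+1))
      (fcomp (fM (fM (DN n))) (DN n.+1))));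
  fsep : forall n, fcomp (fcomp (fnabla n) (fcomp (fM (fdown n)) (fdown n.+1)))
    (fcomp (fM (fdown n)) (fcomp (fdown n.+1) (fDelta n))) = fdown n }.

Section Frob.
Variable Y : frob_structure.
Local Notation F := (farr Y).
Local Notation "g ∘ f" := (fcomp g f).
Local Notation M := fM.
Local Notation "∇" := (@fnabla Y).
Local Notation Δ := (@fDelta Y).
Local Notation u := (@fu Y).
Local Notation ε := (@feps Y).
Local Notation τ := (@ftau Y).
Local Notation "↓" := (@fdown Y).

Lemma frw n m k l (f : F m k) (g : F n m) (h : F n k) (e : f ∘ g = h) (x : F l n) :
  f ∘ g ∘ x = h ∘ x.
Proof. by rewrite fcompA e. Qed.

Lemma mM n m k (f : F m k) (g : F n m) (h : F n k) (e : f ∘ g = h) : M f ∘ M g = M h.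
Proof. by rewrite -fM_comp e. Qed.

Lemma frw3 n m k l p (f : F k l) (g : F m k) (h : F n m) (r : F n l)
  (e : f ∘ g ∘ h = r) (x : F p n) : f ∘ g ∘ h ∘ x = r ∘ x.
Proof. by rewrite -e -!fcompA. Qed.

Lemma frw4 n m k l p q (f : F l p) (g : F k l) (h : F m k) (i : F n m) (r : F n p)
  (e : f ∘ g ∘ h ∘ i = r) (x : F q n) : f ∘ g ∘ h ∘ i ∘ x = r ∘ x.
Proof. by rewrite -e -!fcompA. Qed.

Lemma mM3 n m k l (f : F k l) (g : F m k) (h : F n m) (r : F n l)
  (e : f ∘ g ∘ h = r) : M f ∘ M g ∘ M h = M r.
Proof. by rewrite -!fM_comp e. Qed.

(* [rw e] rewrites with [e : f ∘ g = h], possibly below up to three occurrences of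
   [M] and before a further factor, and restores the right-nested form in which
   [M] is distributed. *)
Ltac norm := rewrite ?fM_comp ?fM_id -?fcompA ?fidl ?fidr.
Ltac rw e :=
  first [ rewrite (frw e) | rewrite e | rewrite (frw (mM e)) | rewrite (mM e)
        | rewrite (frw (mM (mM e))) | rewrite (mM (mM e))
        | rewrite (frw (mM (mM (mM e)))) | rewrite (mM (mM (mM e))) ]; norm.

Fact fH_key : unit. Proof. exact: tt. Qed.

(** Copy the first wire, send the copy through the link and merge it with the
    second wire. *)
Definition fH := locked_with fH_key (fun n =>
  M (∇ n) ∘ M (↓ n.+1) ∘ Δ n.+1 : F n.+2 n.+2).
Lemma fHE n : fH n = M (∇ n) ∘ M (↓ n.+1) ∘ Δ n.+1.
Proof. by rewrite /fH unlock. Qed.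
Local Notation H := fH.

Lemma fH_nat n m (f : F n m) : H m ∘ M (M f) = M (M f) ∘ H n.
Proof.
rewrite !fHE; norm.
rw (fDelta_nat (M f)). rw (fdown_nat (M f)). rw (fnabla_nat f).
done.
Qed.

(** By the Frobenius equation: [H] is linear in its first wire with respect to the
    merging of a further wire.  [H_MN], [D_H] and [H_MD] are the corresponding
    facts for its second wire and for copies. *)
Lemma H_N n : H n ∘ ∇ n.+1 = ∇ n.+1 ∘ M (H n).
Proof.
rewrite !fHE; norm.
rw (fF Y n.+1). rw (esym (fnabla_nat (↓ n.+1))). rw (esym (fnabla_nat (∇ n))).
done.
Qed.

Lemma H_MN n : H n ∘ M (∇ n) = M (∇ n) ∘ H n.+1.
Proof.
rewrite !fHE; norm.
rw (fDelta_nat (∇ n)). rw (fdown_nat (∇ n)). rw (esym (fNN Y n)).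
done.
Qed.

Lemma D_H n : Δ n.+1 ∘ H n = M (H n) ∘ Δ n.+1.
Proof.
rewrite !fHE; norm.
rw (fDelta_nat (∇ n)). rw (fDelta_nat (↓ n.+1)). rw (fDD Y n.+1).
done.
Qed.

Lemma H_MD n : H n.+1 ∘ M (Δ n) = M (Δ n) ∘ H n.
Proof.
rewrite !fHE; norm.
rw (fDelta_nat (Δ n)). rw (fdown_nat (Δ n)). rw (esym (fF Y n)).
done.
Qed.

Lemma fsep' n : ∇ n ∘ ↓ n.+1 ∘ M (↓ n) ∘ Δ n = ↓ n.
Proof.
rewrite -[RHS]fsep; norm.
rw (fdown_nat (↓ n)). rw (fdown_nat (↓ n)). rw (fdd Y n). rw (fdd Y n.+1).
done.
Qed.

Lemma fHH n : H n ∘ H n = H n.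
Proof.
rewrite !fHE; norm.
rw (fDelta_nat (∇ n)). rw (fDelta_nat (↓ n.+1)). rw (fDD Y n.+1).
rw (fdown_nat (∇ n)). rw (esym (fNN Y n)).
have e : M (∇ n.+1) ∘ M (↓ n.+2) ∘ M (M (↓ n.+1)) ∘ M (Δ n.+1) = M (↓ n.+1).
  by rewrite -[↓ n.+1 in RHS]fsep'; norm.
by rewrite (frw4 e).
Qed.

Lemma fM_tau_tauK n l (x : F l n.+3) : M (τ n) ∘ M (τ n) ∘ x = x.
Proof. by rewrite (frw (mM (ftau_inv Y n))) fM_id fidl. Qed.

Lemma ftau_tauK n l (x : F l n.+2) : τ n ∘ τ n ∘ x = x.
Proof. by rewrite (frw (ftau_inv Y n)) fidl. Qed.

(** The link from the first wire to the third. *)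
Lemma sHs n : M (τ n) ∘ H n.+1 ∘ M (τ n) =
  M (M (∇ n)) ∘ M (M (↓ n.+1)) ∘ M (τ n.+1) ∘ Δ n.+2.
Proof.
rewrite !fHE; norm.
rw (fDelta_nat (τ n)). rw (fdown_nat (τ n)). rw (ftN Y n). rw (ftau_inv Y n). rw (ftd Y n.+1).
done.
Qed.

Lemma tMDt n : τ n.+2 ∘ M (Δ n.+1) ∘ τ n.+1 = M (τ n.+1) ∘ Δ n.+2.
Proof.
have e := fDt Y n.+1.
transitivity (M (τ n.+1) ∘ (Δ n.+2 ∘ τ n.+1) ∘ τ n.+1); last by norm; rewrite ftau_inv fidr.
by rewrite e; norm; rewrite fM_tau_tauK.
Qed.

Lemma ftH n : M (τ n) ∘ H n.+1 ∘ M (τ n) = τ n.+1 ∘ M (H n) ∘ τ n.+1.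
Proof.
rewrite sHs fHE; norm.
rw (ftau_nat (∇ n)). rw (ftau_nat (↓ n.+1)). rewrite tMDt.
done.
Qed.

Lemma MH_t' n : M (H n) = τ n.+1 ∘ M (τ n) ∘ H n.+1 ∘ M (τ n) ∘ τ n.+1.
Proof.
have := congr1 (fun x => τ n.+1 ∘ x ∘ τ n.+1) (ftH n).
by norm; rewrite !ftau_tauK ftau_inv fidr => <-.
Qed.

Lemma K_N n : (τ n ∘ H n ∘ τ n) ∘ ∇ n.+1 = ∇ n.+1 ∘ M (τ n ∘ H n ∘ τ n).
Proof.
have tMN : τ n ∘ M (∇ n) = ∇ n.+1 ∘ M (τ n) ∘ τ n.+1.
  have := congr1 (fun x => τ n ∘ x ∘ M (τ n) ∘ τ n.+1) (ftN Y n).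
  norm; rewrite ftau_tauK => ->.
  by rewrite fM_tau_tauK ftau_inv fidr.
rewrite -[X in _ ∘ X = _]fNt; norm.
rw (ftN Y n). rw (H_MN n). rw tMN.
rewrite MH_t'; norm.
rewrite -[∇ n.+1 in LHS]fNt; norm.
by rewrite (fYB Y n) (frw3 (fYB Y n)); norm.
Qed.

Lemma ftd' n : ↓ n.+1 ∘ τ n = τ n ∘ M (↓ n).
Proof.
have := congr1 (fun x => τ n ∘ x ∘ τ n) (ftd Y n).
by norm; rewrite ftau_tauK ftau_inv fidr.
Qed.

Lemma eH n : ε n.+1 ∘ H n = ∇ n ∘ ↓ n.+1.
Proof.
rewrite !fHE; norm.
rw (feps_nat (∇ n)). rw (feps_nat (↓ n.+1)). by rw (feD Y n.+1).
Qed.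

(** This is the up-and-down equation: in [fud] the reversed link applied to a copy
    of a wire is [H ∘ u]. *)
Lemma feHtHu n : ε n.+1 ∘ H n ∘ τ n ∘ H n ∘ u n.+1 = fid Y n.+1.
Proof.
rewrite -[RHS]fud.
have e : M (ε n.+1) ∘ H n.+1 ∘ u n.+2 ∘ Δ n = H n ∘ u n.+1.
  rw (fu_nat (Δ n)). rw (H_MD n). by rw (feD Y n).
have := congr1 (fun x => ∇ n ∘ M (↓ n) ∘ x) e; rewrite (fHE n.+1); norm => ->.
rw (eH n). rw (ftd' n). rw (fNt Y n).
done.
Qed.

Lemma K_MD n : (τ n.+1 ∘ H n.+1 ∘ τ n.+1) ∘ M (Δ n) = M (Δ n) ∘ τ n ∘ H n ∘ τ n.
Proof.
have tMD : τ n.+1 ∘ M (Δ n) = M (τ n) ∘ Δ n.+1 ∘ τ n.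
  by rw (fDt Y n); rewrite fM_tau_tauK.
norm; rewrite tMD.
have HsE : H n.+1 ∘ M (τ n) = M (τ n) ∘ τ n.+1 ∘ M (H n) ∘ τ n.+1.
  by rewrite -ftH fM_tau_tauK.
rw HsE. rw (ftD Y n.+1). rw (esym (D_H n)). rewrite (frw3 (esym (fYB Y n))); norm.
have sD : M (τ n) ∘ Δ n.+1 = τ n.+1 ∘ M (Δ n) ∘ τ n by rewrite (frw tMD); norm; rewrite ftau_inv fidr.
by rw sD; rewrite ftau_tauK; rw (ftD Y n).
Qed.

(** By linearity in the first wire, the left side is determined by its value on a
    fresh first wire.  By linearity in the second one, that value is [Δ], since a
    fresh wire linked both ways with a given wire carries its value ([feHtHu]). *)
Lemma spider n : τ n ∘ H n ∘ τ n ∘ H n = Δ n ∘ ∇ n.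
Proof.
have X_N : τ n ∘ H n ∘ τ n ∘ H n ∘ ∇ n.+1 =
    ∇ n.+1 ∘ M (τ n) ∘ M (H n) ∘ M (τ n) ∘ M (H n).
  rw (H_N n).
  by move: (K_N n); norm => e; rewrite (frw4 e); norm.
have X_MD : τ n.+1 ∘ H n.+1 ∘ τ n.+1 ∘ H n.+1 ∘ M (Δ n) =
    M (Δ n) ∘ τ n ∘ H n ∘ τ n ∘ H n.
  rw (H_MD n).
  by move: (K_MD n); norm => e; rewrite (frw4 e); norm.
have Xu : τ n ∘ H n ∘ τ n ∘ H n ∘ u n.+1 = Δ n.
  transitivity (M (ε n.+1) ∘ M (Δ n) ∘ τ n ∘ H n ∘ τ n ∘ H n ∘ u n.+1).
    by rw (feD Y n).
  have := congr1 (fun x => M (ε n.+1) ∘ x ∘ u n.+1) X_MD; norm => <-.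
  rw (esym (fu_nat (Δ n))). rewrite -fet; norm; rewrite ftau_tauK.
  have := congr1 (fun x => x ∘ Δ n) (feHtHu n.+1); norm; exact.
have := congr1 (fun x => x ∘ M (u n.+1)) X_N; norm.
rewrite fNMu !fidr => ->.
by rewrite fF -Xu; norm.
Qed.

Lemma spider_u n : τ n ∘ H n ∘ τ n ∘ H n ∘ u n.+1 = Δ n.
Proof.
have := congr1 (fun x => x ∘ u n.+1) (spider n); norm => ->.
by rewrite fNu fidr.
Qed.

Lemma e_spider n : ε n.+1 ∘ τ n ∘ H n ∘ τ n ∘ H n = ∇ n.
Proof. by rewrite spider; rw (feD Y n). Qed.

Lemma HtH n : H n ∘ τ n ∘ H n = Δ n ∘ ∇ n.
Proof.
by have := congr1 (fun x => τ n ∘ x) (spider n); norm; rewrite ftau_tauK (frw (ftD Y n)).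
Qed.

Lemma fHtHl n : τ n ∘ H n ∘ τ n ∘ H n = H n ∘ τ n ∘ H n.
Proof. by rewrite spider HtH. Qed.

Lemma fHtHr n : H n ∘ τ n ∘ H n = H n ∘ τ n ∘ H n ∘ τ n.
Proof.
transitivity ((H n ∘ τ n ∘ H n) ∘ τ n); last by norm.
by rewrite HtH -fcompA fNt.
Qed.

Lemma fHcomm n : M (H n) ∘ H n.+1 = H n.+1 ∘ M (H n).
Proof.
rewrite (fHE n.+1); norm.
rw (fDelta_nat (H n)). rw (fdown_nat (H n)). rw (H_N n).
done.
Qed.

Lemma tMN n : τ n ∘ M (∇ n) = ∇ n.+1 ∘ M (τ n) ∘ τ n.+1.
Proof.
have := congr1 (fun x => τ n ∘ x ∘ M (τ n) ∘ τ n.+1) (ftN Y n).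
norm; rewrite ftau_tauK => ->.
by rewrite fM_tau_tauK ftau_inv fidr.
Qed.

Lemma join_aux n : (M (τ n) ∘ H n.+1 ∘ M (τ n)) ∘ H n.+1 =
  H n.+1 ∘ M (τ n) ∘ H n.+1 ∘ M (τ n).
Proof.
transitivity (M (M (∇ n) ∘ M (↓ n.+1) ∘ ∇ n.+2 ∘ M (τ n.+1) ∘ ↓ n.+3) ∘
  M (Δ n.+2) ∘ Δ n.+2).
  rewrite sHs fHE; norm.
  rw (fDelta_nat (∇ n.+1)). rw (fDelta_nat (↓ n.+2)). rw (tMN n.+1).
  rw (esym (ftd' n.+2)). rw (fDD Y n.+2). rw (ftD Y n.+2).
  done.
rewrite sHs fHE; norm.
rw (fDelta_nat (M (∇ n))). rw (fDelta_nat (M (↓ n.+1))). rw (fDelta_nat (τ n.+1)).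
rw (fDD Y n.+2).
rw (fdown_nat (M (∇ n))). rw (fdown_nat (M (↓ n.+1))). rw (fdown_nat (τ n.+1)).
rw (fnabla_nat (∇ n)). rw (fnabla_nat (↓ n.+1)).
done.
Qed.

Lemma fjoin n : M (τ n) ∘ H n.+1 ∘ M (τ n) ∘ H n.+1 =
  H n.+1 ∘ M (τ n) ∘ H n.+1 ∘ M (τ n).
Proof. by rewrite -join_aux; norm. Qed.

(** Both links end in the third wire, which is merged with the copies in either
    order. *)
Lemma ffork n : τ n.+1 ∘ M (H n) ∘ τ n.+1 ∘ M (H n) =
  M (H n) ∘ τ n.+1 ∘ M (H n) ∘ τ n.+1.
Proof.
transitivity ((τ n.+1 ∘ M (H n) ∘ τ n.+1) ∘ M (H n)); first by norm.
rewrite -ftH sHs; norm.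
rw (fDelta_nat (H n)).
have g_H : M (∇ n) ∘ M (↓ n.+1) ∘ τ n.+1 ∘ M (H n) =
    H n ∘ M (∇ n) ∘ M (↓ n.+1) ∘ τ n.+1.
  have e : τ n.+1 ∘ M (H n) = M (τ n) ∘ H n.+1 ∘ M (τ n) ∘ τ n.+1.
    transitivity ((τ n.+1 ∘ M (H n) ∘ τ n.+1) ∘ τ n.+1); first by norm; rewrite ftau_inv fidr.
    by rewrite -ftH; norm.
  rw e. rw (ftd' n). rw (fNt Y n).
  rw (esym (fH_nat (↓ n))). rw (esym (ftd Y n)).
  rw (esym (H_MN n)). rw (fNt Y n).
  by rw (H_MN n).
have := congr1 (fun x => M x ∘ Δ n.+2) g_H; norm => ->.
by rewrite -sHs ftH.
Qed.

Lemma H_Mu n : H n ∘ M (u n) = M (↓ n) ∘ Δ n.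
Proof.
rewrite fHE; norm.
rw (fDelta_nat (u n)). rw (fdown_nat (u n)). by rw (fNMu Y n).
Qed.

Lemma e_H_Mu n : ε n.+1 ∘ H n ∘ M (u n) = ↓ n.
Proof. by rw (H_Mu n); rw (feps_nat (↓ n)); rw (feD Y n). Qed.

Lemma feN' n : ε n ∘ ∇ n ∘ ↓ n.+1 ∘ M (↓ n) = ε n ∘ M (ε n).
Proof. by rewrite -feN fdown_nat. Qed.

Lemma feu_fork n : M (M (ε n)) ∘ M (H n) ∘ τ n.+1 ∘ M (H n) ∘ M (M (u n)) = τ n.
Proof.
rw (H_Mu n). rewrite fHE; norm.
rw (ftau_nat (↓ n)). rw (fDelta_nat (↓ n)).
have e : M (M (ε n)) ∘ M (M (∇ n)) ∘ M (M (↓ n.+1)) ∘ M (M (M (↓ n))) =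
    M (M (ε n)) ∘ M (M (M (ε n))).
  by have := congr1 (fun x => M (M x)) (feN' n); norm.
rewrite (frw4 e); norm.
rw (esym (fDelta_nat (ε n))). rw (fMeD Y n).
rw (esym (ftau_nat (ε n))). rw (fMeD Y n).
done.
Qed.

Lemma feu_join n : ε n.+2 ∘ H n.+1 ∘ M (τ n) ∘ H n.+1 ∘ u n.+2 = τ n.
Proof.
rw (eH n.+1). rewrite fHE; norm.
rw (fdown_nat (τ n)). rw (fdown_nat (∇ n.+1)). rw (fdown_nat (↓ n.+2)).
rewrite (fDu Y n.+2).
rw (fNu Y n.+1). rw (esym (fu_nat (τ n))). rw (fNu Y n.+1).
done.
Qed.

Definition Delta_down := locked_with fH_key (fun n =>
  M (↓ n) ∘ ↓ n.+1 ∘ Δ n : F n.+1 n.+2).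
Lemma Delta_downE n : Delta_down n = M (↓ n) ∘ ↓ n.+1 ∘ Δ n.
Proof. by rewrite /Delta_down unlock. Qed.

Lemma Delta_down_nat n m (f : F n m) : Delta_down m ∘ M f = M (M f) ∘ Delta_down n.
Proof.
rewrite !Delta_downE; norm.
rw (fDelta_nat f). rw (fdown_nat (M f)). rw (fdown_nat f).
done.
Qed.

Lemma down_Delta_down n : ↓ n.+1 ∘ Delta_down n = Delta_down n.
Proof. by rewrite Delta_downE; rw (fdown_nat (↓ n)); rw (fdd Y n.+1). Qed.

Lemma M_down_Delta_down n : M (↓ n) ∘ Delta_down n = Delta_down n.
Proof. by rewrite Delta_downE; rw (fdd Y n). Qed.

(** Componentwise multiplication of two pairs of wires. *)
Definition mulM2 := locked_with fH_key (fun n =>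
  M (∇ n) ∘ ∇ n.+2 ∘ M (τ n.+1) : F n.+4 n.+2).
Lemma mulM2E n : mulM2 n = M (∇ n) ∘ ∇ n.+2 ∘ M (τ n.+1).
Proof. by rewrite /mulM2 unlock. Qed.

Lemma mulM2_nat n m (f : F n m) : mulM2 m ∘ M (M (M (M f))) = M (M f) ∘ mulM2 n.
Proof.
rewrite !mulM2E; norm.
rw (ftau_nat (M f)). rw (fnabla_nat (M (M f))). rw (fnabla_nat f).
done.
Qed.

Lemma mulM2_tau n : mulM2 n ∘ M (M (τ n)) = ∇ n.+1 ∘ M (τ n) ∘ M (∇ n.+1).
Proof. by rewrite mulM2E; rw (ftN Y n); rw (fnabla_nat (∇ n)). Qed.

Lemma mulM2A n : mulM2 n ∘ M (M (mulM2 n)) = mulM2 n ∘ mulM2 n.+2.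
Proof.
transitivity (M (∇ n) ∘ M (∇ n.+1) ∘ ∇ n.+3 ∘ ∇ n.+4 ∘ M (M (τ n.+2)) ∘
  M (τ n.+3) ∘ M (M (M (τ n.+1)))).
  rewrite !mulM2E; norm.
  rw (ftau_nat (∇ n)). rw (fnabla_nat (M (∇ n))). rw (esym (fNN Y n)).
  rw (tMN n.+2). rw (esym (fNN Y n.+3)).
  done.
rewrite !mulM2E; norm.
rw (ftN Y n.+1). rw (fnabla_nat (∇ n.+1)).
rw (esym (fnabla_nat (M (τ n.+1)))). rw (esym (fnabla_nat (τ n.+2))).
rw (ftau_nat (τ n.+1)).
done.
Qed.

(** A wire is split in two, and the parts are sent through links to the first and
    second of two further wires, which are thereby interchanged; by [eHsH] this is
    what remains of two links when their common source is forgotten. *)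
Definition Fan := locked_with fH_key (fun n =>
  mulM2 n ∘ M (M (τ n)) ∘ Delta_down n.+2 : F n.+3 n.+2).
Lemma FanE n : Fan n = mulM2 n ∘ M (M (τ n)) ∘ Delta_down n.+2.
Proof. by rewrite /Fan unlock. Qed.

Lemma HsH n : H n.+1 ∘ M (τ n) ∘ H n.+1 = M (Fan n) ∘ Δ n.+2.
Proof.
rewrite fHE FanE; norm.
rw (fDelta_nat (τ n)). rw (fDelta_nat (∇ n.+1)). rw (fDelta_nat (↓ n.+2)).
rw (fDD Y n.+2).
rw (fdown_nat (τ n)). rw (fdown_nat (∇ n.+1)). rw (fdown_nat (↓ n.+2)).
rewrite Delta_downE; norm; rw (mulM2_tau n).
done.
Qed.

Lemma eHsH n : ε n.+2 ∘ H n.+1 ∘ M (τ n) ∘ H n.+1 = Fan n.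
Proof. rewrite HsH. rw (feps_nat (Fan n)). by rw (feD Y n.+2). Qed.

Lemma HtHu m : M (H m) ∘ τ m.+1 ∘ M (H m) ∘ M (M (u m)) =
  M (M (∇ m ∘ M (↓ m) ∘ ↓ m.+1)) ∘ M (Δ m.+1) ∘ τ m.+1 ∘ M (Δ m).
Proof.
rw (H_Mu m). rewrite fHE; norm.
rw (ftau_nat (↓ m)). rw (fDelta_nat (↓ m)). rw (fdown_nat (↓ m)).
done.
Qed.

(** The bialgebra equation for the linked operations.  Its right side contains every link
    twice, once after splitting and once before merging, and links are idempotent. *)
Lemma fbi' m : Delta_down m ∘ ∇ m ∘ M (↓ m) ∘ ↓ m.+1 = mulM2 m ∘ Delta_down m.+2 ∘ M (Delta_down m).
Proof.
have := fbi Y m; rewrite /= -!Delta_downE => ->; rewrite mulM2E; norm.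
rw (esym (fnabla_nat (↓ m.+1))). rw (esym (fnabla_nat (M (↓ m)))).
rw (fdown_nat (τ m.+1)). rw (ftd' m.+1). rw (esym (ftd Y m.+1)).
rw (esym (ftau_nat (↓ m))). rw (esym (Delta_down_nat (Delta_down m))).
rw (down_Delta_down m.+2). rw (esym (Delta_down_nat (↓ m.+1))). rw (down_Delta_down m).
rw (M_down_Delta_down m.+2). rw (esym (Delta_down_nat (M (↓ m)))). rw (M_down_Delta_down m).
done.
Qed.

Lemma Fan_Fan n : Fan n ∘ ∇ n.+2 ∘ M (↓ n.+2) ∘ ↓ n.+3 = Fan n ∘ M (τ n) ∘ M (Fan n).
Proof.
rewrite FanE; norm; rewrite fbi'.
rw (esym (mulM2_nat (τ n))).
rw (Delta_down_nat (τ n)). rw (Delta_down_nat (mulM2 n)). rw (Delta_down_nat (M (M (τ n)))).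
rw (ftau_inv Y n). rw (mulM2A n).
done.
Qed.

(** Both sides copy the two source wires and apply to the copies an operation with
    values in the two target wires: on the left, merge the copies and fan out; on
    the right, fan out one copy after the other. *)
Lemma fbialg n :
  M (M (ε n.+2)) ∘ M (M (H n.+1)) ∘ M (H n.+2) ∘ M (M (M (τ n))) ∘ τ n.+3 ∘
    M (M (H n.+1)) ∘ M (H n.+2) ∘ M (M (u n.+2)) =
  M (H n.+1) ∘ M (M (τ n)) ∘ M (H n.+1) ∘ M (M (τ n)) ∘ τ n.+2 ∘
    M (H n.+1) ∘ M (M (τ n)) ∘ M (H n.+1).
Proof.
pose tail := M (Δ n.+3) ∘ τ n.+3 ∘ M (Δ n.+2).
transitivity (M (M (Fan n ∘ ∇ n.+2 ∘ M (↓ n.+2) ∘ ↓ n.+3)) ∘ tail).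
  rw (ftau_nat (H n.+1)).
  rw (fH_nat (τ n)). rw (esym (fHcomm n.+1)).
  rewrite HtHu.
  by have := congr1 (fun x => M (M x)) (eHsH n); rewrite /tail; norm => e; rewrite (frw4 e); norm.
transitivity (M (M (Fan n ∘ M (τ n) ∘ M (Fan n))) ∘ tail); last first.
  rewrite (frw3 (mM3 (HsH n))) (mM3 (HsH n)) /tail; norm.
  rw (ftau_nat (Fan n)). rw (fDelta_nat (τ n)). rw (fDelta_nat (Fan n)).
  done.
by rewrite Fan_Fan.
Qed.

Definition h_of_frob : h_structure :=
  @HStructure F (@fid Y) (@fcomp Y) (@fM Y) u ε τ H (@fidl Y) (@fidr Y) (@fcompA Y)
   (@fM_id Y) (@fM_comp Y) (@fu_nat Y) (@feps_nat Y) (@ftau_nat Y) fH_nat (@ftau_inv Y)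
   (@fYB Y) (@ftu Y) (@fet Y) fHH ftH fHtHl fHtHr feHtHu fHcomm ffork fjoin
   (@feu Y) feu_fork feu_join fbialg.

End Frob.

(** * The free preordering Frobenius monad *)

Definition pM n m (f : pf_hom n m) : pf_hom n.+1 m.+1 := pf_class (pf_M (pf_repr f)).

Lemma pM_class n m (f : pf_term n m) : pM (pf_class f) = pf_class (pf_M f).
Proof. by apply/pf_classP/pf_cong_M; apply/pf_classP/pf_reprK. Qed.

Notation pN n := (pf_class (pf_nabla n)).
Notation pD n := (pf_class (pf_Delta n)).
Notation pu n := (pf_class (pf_u n)).
Notation pe n := (pf_class (pf_eps n)).
Notation pt n := (pf_class (pf_tau n)).
Notation pd n := (pf_class (pf_down n)).

Lemma prep_comp n m k (g : pf_hom m k) (f : pf_hom n m) a b :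
  g = pf_class a -> f = pf_class b -> pf_hom_comp g f = pf_class (pf_comp a b).
Proof. by move=> -> ->; rewrite pf_class_comp. Qed.

Lemma prep_M n m (f : pf_hom n m) a : f = pf_class a -> pM f = pf_class (pf_M a).
Proof. by move=> ->; rewrite pM_class. Qed.

Lemma prep_eq n m (f g : pf_hom n m) a b :
  f = pf_class a -> g = pf_class b -> pf_eq a b -> f = g.
Proof. by move=> -> -> /pf_classP. Qed.

Ltac p_rep := lazymatch goal with
  | |- pf_hom_comp _ _ = _ => eapply prep_comp; p_rep
  | |- pM _ = _ => eapply prep_M; p_rep
  | |- pf_class _ = _ => reflexivity
  | |- pf_hom_id _ = _ => reflexivity
  | |- _ => symmetry; apply pf_reprK
  end.

Ltac p_law ax :=
  rewrite ?pf_hom_assoc; eapply prep_eq; [p_rep | p_rep | apply ax].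

Local Notation "g ∘ f" := (pf_hom_comp g f).

Definition pup n := pM (pe n) ∘ pM (pN n) ∘ pM (pd n.+1) ∘ pD n.+1 ∘ pu n.+1.
Definition pND n := (pN n ∘ pM (pd n)) ∘ pd n.+1.
Definition pDN n := (pM (pd n) ∘ pd n.+1) ∘ pD n.

Lemma prep_up n : pup n = pf_class (pf_up n).
Proof. by rewrite /pup ?pf_hom_assoc; p_rep. Qed.

Lemma prep_ND n : pND n = pf_class (pf_nabla_down n).
Proof. by rewrite /pND; p_rep. Qed.

Lemma prep_DN n : pDN n = pf_class (pf_Delta_down n).
Proof. by rewrite /pDN; p_rep. Qed.

Definition PF_structure : frob_structure.
Proof.
refine (@FrobStructure pf_hom pf_hom_id pf_hom_comp pM
  (fun n => pN n) (fun n => pD n) (fun n => pu n) (fun n => pe n) (fun n => pt n) (fun n => pd n)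
  pf_hom_idl pf_hom_idr (fun n m k l h g f => pf_hom_assoc h g f)
  _ _ _ _ _ _ _ _ _ _ _ _ _ _ _ _ _ _ _ _ _ _ _ _ _ _ _ _ _ _ _) => /=.
- by move=> n; p_law pf_M_id.
- by move=> n m k g f; p_law pf_M_comp.
- by move=> n m f; p_law pf_nabla_nat.
- by move=> n m f; p_law pf_Delta_nat.
- by move=> n m f; p_law pf_u_nat.
- by move=> n m f; p_law pf_eps_nat.
- by move=> n m f; p_law pf_tau_nat.
- by move=> n m f; p_law pf_down_nat.
- by move=> n; p_law pf_monad_assoc.
- by move=> n; p_law pf_monad_idl.
- by move=> n; p_law pf_monad_idr.
- by move=> n; p_law pf_comonad_assoc.
- by move=> n; p_law pf_comonad_idl.
- by move=> n; p_law pf_comonad_idr.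
- by move=> n; p_law pf_frobenius2.
- by move=> n; p_law pf_tau_tau.
- by move=> n; p_law pf_yang_baxter.
- by move=> n; p_law pf_nabla_tau.
- by move=> n; p_law pf_tau_Delta.
- by move=> n; p_law pf_tau_nabla.
- by move=> n; p_law pf_Delta_tau.
- by move=> n; p_law pf_tau_u.
- by move=> n; p_law pf_eps_tau.
- by move=> n; p_law pf_eps_u.
- by move=> n; p_law pf_down_down.
- by move=> n; p_law pf_tau_down.
- move=> n; have e : ((pN n ∘ pM (pd n)) ∘ pup n.+1) ∘ pD n = pf_hom_id n.+1.
    by rewrite prep_up; p_law pf_up_and_down.
  by rewrite /pup -?pf_hom_assoc in e.
- move=> n; have e : pe n ∘ pND n = pe n ∘ pM (pe n).
    by rewrite prep_ND; p_law pf_eps_nabla_down.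
  by rewrite /pND -?pf_hom_assoc in e.
- move=> n; have e : pDN n ∘ pu n = pM (pu n) ∘ pu n.
    by rewrite prep_DN; p_law pf_Delta_down_u.
  by rewrite /pDN -?pf_hom_assoc in e.
- move=> n; have e : pDN n ∘ pND n =
      pM (pND n) ∘ pND n.+2 ∘ pM (pt n.+1) ∘ pM (pM (pDN n)) ∘ pDN n.+1.
    by rewrite !prep_ND !prep_DN; p_law pf_bialgebra_down.
  by rewrite /pDN /pND -?pf_hom_assoc in e *.
- move=> n; have e : pND n ∘ pDN n = pd n.
    by rewrite prep_ND prep_DN; p_law pf_separable_down.
  by rewrite /pDN /pND -?pf_hom_assoc in e *.
Defined.

Lemma flat1 (A B : Type) (g : A -> seq B) h l :
  (forall z, g z = [:: h z]) -> flatten (map g l) = map h l.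
Proof. by move=> e; elim: l => //= z l ->; rewrite e. Qed.

Lemma flat0 (A B : Type) (g : A -> seq B) l :
  (forall z, g z = [::]) -> flatten (map g l) = [::].
Proof. by move=> e; elim: l => //= z l ->; rewrite e. Qed.

(** The possible values of the target wires for given values of the source wires; [pf_down]
    may raise a bit. *)
Fixpoint prun n m (f : pf_term n m) (s : seq bool) : seq (seq bool) :=
  match f with
  | pf_id _ => [:: s]
  | pf_comp _ _ _ g f => flatten [seq prun g t | t <- prun f s]
  | pf_M _ _ f => if s is b :: s' then [seq b :: t | t <- prun f s'] else [::]
  | pf_nabla _ => if s is [:: a, b & w] then if a == b then [:: a :: w] else [::] else [::]
  | pf_Delta _ => if s is a :: w then [:: [:: a, a & w]] else [::]
  | pf_u _ => [:: true :: s; false :: s]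
  | pf_eps _ => if s is a :: w then [:: w] else [::]
  | pf_tau _ => if s is [:: a, b & w] then [:: [:: b, a & w]] else [::]
  | pf_down _ => if s is a :: w then if a then [:: true :: w] else [:: true :: w; false :: w]
                 else [::]
  end.

Lemma prun_size n m (f : pf_term n m) s t : size s = n -> t \in prun f s -> size t = m.
Proof.
elim: f s t => {n m} [n|n m k g IHg f IHf|n m f IH|n|n|n|n|n|n] s t /=.
- by move=> <-; rewrite inE => /eqP->.
- by move=> ss /flatten_mapP[z /(IHf _ _ ss) sz /(IHg _ _ sz)].
- by case: s => // b s [ss] /mapP[z /(IH _ _ ss) <- ->].
- by case: s => [|a [|b s]] //= [<-]; case: ifP => // _; rewrite inE => /eqP->.
- by case: s => [|a s] //= [<-]; rewrite inE => /eqP->.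
- by move=> <-; rewrite !inE => /orP[] /eqP->.
- by case: s => [|a s] //= [<-]; rewrite inE => /eqP->.
- by case: s => [|a [|b s]] //= [<-]; rewrite inE => /eqP->.
- by case: s => [|[] s] //= [<-]; rewrite !inE; [|case/orP]; move/eqP->.
Qed.

(** The equations involve at most three head wires; after a case analysis on their
    bits both sides are explicit lists. *)
Lemma pf_eq_run n m (f g : pf_term n m) s : pf_eq f g -> size s = n -> prun f s =i prun g s.
Proof.
move=> e; elim: e s => {n m f g}.
- by [].
- by move=> n m f g _ IH s ss t; rewrite IH.
- by move=> n m f g h _ IH _ IH' s ss t; rewrite IH // IH'.
- move=> n m k g g' f f' _ IHg _ IHf s ss t /=.
  apply/flatten_mapP/flatten_mapP => -[z zf tz]; exists z.
  + by rewrite -IHf.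
  + by rewrite -IHg // (prun_size ss zf).
  + by rewrite IHf.
  + by rewrite IHg // (prun_size ss zf).
- move=> n m f f' _ IH [|b s] //= [ss] t.
  by apply/mapP/mapP => -[z zf ->]; exists z; rewrite // ?IH // -?IH.
- by move=> n m f s _ t; rewrite /= (flat1 (h := id)) ?map_id.
- by move=> n m f s _ t; rewrite /= cats0.
- move=> n m k l h g f s _ t /=.
  apply/flatten_mapP/flatten_mapP => -[z].
    by move=> /flatten_mapP[y yf zy] tz; exists y => //; apply/flatten_mapP; exists z.
  by move=> zf /flatten_mapP[y yz ty]; exists y => //; apply/flatten_mapP; exists z.
- by move=> n [|b s].
- move=> n m k g f [|b s] //= _ t; rewrite map_flatten -!map_comp.
  congr (t \in flatten _); exact: eq_map.
- move=> n m f [|a [|b s]] //= _ t; rewrite -!map_comp.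
  by case: a; case: b; rewrite /= ?cats0;
    [rewrite (flat1 (h := cons true))|rewrite flat0..|rewrite (flat1 (h := cons false))].
- by move=> n m f [|a s] //= _ t; rewrite -!map_comp cats0 (flat1 (h := fun z => [:: a, a & z])).
- move=> n m f s _ t /=; rewrite cats0 mem_cat.
  apply/flatten_mapP/orP => [[z zf]|[]/mapP[z zf ->]].
  + by rewrite !inE => /orP[]/eqP->; [left|right]; apply: map_f.
  + by exists z => //; rewrite !inE eqxx.
  + by exists z => //; rewrite !inE eqxx orbT.
- by move=> n m f [|a s] //= _ t; rewrite -!map_comp cats0 (flat1 (h := id)) ?map_id.
- by move=> n m f [|a [|b s]] //= _ t; rewrite -!map_comp cats0 (flat1 (h := fun z => [:: b, a & z])).
- move=> n m f [|a s] //= _ t; rewrite -!map_comp; case: a => /=.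
    by rewrite cats0 (flat1 (h := cons true)).
  rewrite cats0 mem_cat; apply/flatten_mapP/orP => [[z zf]|[]/mapP[z zf ->]].
  + by rewrite !inE => /orP[]/eqP->; [left|right]; apply: map_f.
  + by exists z => //; rewrite !inE eqxx.
  + by exists z => //; rewrite !inE eqxx orbT.
all: move=> n [|[] [|[] [|[] s]]] //= _ t; rewrite ?inE //.
all: by do ![match goal with |- context [@eq_op ?T ?x ?w] => case: (@eq_op T x w) end].
Qed.

Definition PF_h_structure : h_structure := h_of_frob PF_structure.

Definition p_den n m (f : pf_hom n m) (v w : seq bool) : Prop :=
  size v = n /\ w \in prun (pf_repr f) v.

Lemma p_den_class n m (f : pf_term n m) v w :
  p_den (pf_class f) v w <-> size v = n /\ w \in prun f v.
Proof.
have e : pf_eq (pf_repr (pf_class f)) f by apply/pf_classP/pf_reprK.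
by split=> -[sv]; rewrite /p_den (pf_eq_run e sv).
Qed.

Lemma p_den_id n v w : p_den (pf_hom_id n) v w <-> v = w /\ size v = n.
Proof. by rewrite p_den_class /= inE; split=> [[sv /eqP->]|[<-]]. Qed.

Lemma p_den_comp n m k (g : pf_hom m k) (f : pf_hom n m) v w :
  p_den (pf_hom_comp g f) v w <-> exists z, p_den f v z /\ p_den g z w.
Proof.
rewrite p_den_class /=; split=> [[sv /flatten_mapP[z zf zw]]|[z [[sv zf] [_ zw]]]].
  by exists z; split=> //; split=> //; exact: (prun_size sv zf).
by split=> //; apply/flatten_mapP; exists z.
Qed.

Lemma p_den_M n m (f : pf_hom n m) v w : p_den (pM f) v w <->
  exists b v' w', [/\ v = b :: v', w = b :: w' & p_den f v' w'].
Proof.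
rewrite p_den_class /=; split=> [[]|[b [v' [w' [-> -> [sv wf]]]]]].
  by case: v => // b v [sv] /mapP[w' wf ->]; exists b, v, w'.
by rewrite /= sv; split=> //; apply: map_f.
Qed.

Lemma p_den_u n v w : p_den (pu n) v w <-> size v = n /\ exists b, w = b :: v.
Proof.
rewrite p_den_class /= !inE; split=> [[sv /orP[]/eqP->]|[sv [[] ->]]]; rewrite ?eqxx ?orbT //.
  by split=> //; exists true.
by split=> //; exists false.
Qed.

Lemma p_den_e n v w : p_den (pe n) v w <-> size w = n /\ exists b, v = b :: w.
Proof.
rewrite p_den_class /=; split=> [[]|[<- [b ->]]]; last by rewrite inE.
by case: v => // b v [sv]; rewrite inE => /eqP->; split=> //; exists b.
Qed.

Lemma p_den_t n v w : p_den (pt n) v w <->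
  exists a b z, [/\ size z = n, v = [:: a, b & z] & w = [:: b, a & z]].
Proof.
rewrite p_den_class /=; split=> [[]|[a [b [z [<- -> ->]]]]]; last by rewrite inE.
by case: v => [|a [|b v]] // [sv]; rewrite inE => /eqP->; exists a, b, v.
Qed.

Notation pH n := (fH PF_structure n).

Lemma pH_class n : pH n = pf_class (pf_comp (pf_M (pf_nabla n))
  (pf_comp (pf_M (pf_down n.+1)) (pf_Delta n.+1))).
Proof.
transitivity (pM (pN n) ∘ (pM (pd n.+1) ∘ pD n.+1)); last by p_rep.
exact: (@fHE PF_structure n).
Qed.

Lemma p_den_H n v w : p_den (pH n : pf_hom _ _) v w <->
  exists a b z, [/\ size z = n, v = [:: a, b & z], w = v & a ==> b].
Proof.
rewrite pH_class p_den_class; split=> [[]|[a [b [z [<- -> -> ab]]]]].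
  case: v => [|a [|b z]] //= [sz]; case: a; case: b; rewrite //= ?inE => /eqP->;
  by [exists true, true, z|exists false, true, z|exists false, false, z].
by split=> //; case: a ab => /= [->|_]; case: b; rewrite /= inE.
Qed.

(** [∇], [Δ] and [↓] are expressed by [H] through the spider equation and through
    [H] with a fresh second wire. *)
Lemma p_generated (Q : forall n m, pf_hom n m -> Prop) :
  (forall n, Q n n (pf_hom_id n)) ->
  (forall n m k g f, Q m k g -> Q n m f -> Q n k (pf_hom_comp g f)) ->
  (forall n m f, Q n m f -> Q n.+1 m.+1 (pM f)) ->
  (forall n, Q _ _ (pu n)) -> (forall n, Q _ _ (pe n)) ->
  (forall n, Q _ _ (pt n)) -> (forall n, Q _ _ (pH n)) ->
  forall n m f, Q n m f.
Proof.
move=> Qid Qcomp QM Qu Qe Qt QH n m f; rewrite -[f]pf_reprK.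
have QD k : Q _ _ (pD k).
  have e : _ = pD k := @spider_u PF_structure k; rewrite -e.
  by do 4 apply: (Qcomp) => //.
have QN k : Q _ _ (pN k).
  have e : _ = pN k := @e_spider PF_structure k; rewrite -e.
  by do 4 apply: (Qcomp) => //.
elim: (pf_repr f) => {n m f} [n|n m k g IHg f IHf|n m f IH|n|n|n|n|n|n] //.
- by rewrite -pf_class_comp; apply: Qcomp.
- by rewrite -pM_class; apply: QM.
have e : _ = pd n := @e_H_Mu PF_structure n; rewrite -e.
by do 2 apply: (Qcomp) => //; apply: QM.
Qed.

Definition PF_semantics : upset_semantics PF_h_structure :=
  @UpsetSemantics PF_h_structure p_den p_den_id p_den_comp p_den_M p_den_u p_den_e p_den_t
    p_den_H p_generated.

Lemma PF_SplPre : isomorphic PF SplPre.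
Proof. exact: (iso_SplPre PF_semantics). Qed.

Theorem mainTheorem1 :
  [/\ isomorphic PF PFH, isomorphic PFH SplPre & isomorphic PF SplPre].
Proof.
split; [|exact: PFH_SplPre|exact: PF_SplPre].
exact: isomorphic_trans PF_SplPre (isomorphic_sym PFH_SplPre).
Qed.
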